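(* Let $p$ be a prime number, let $f(t)\in\mathbb{Z}_p[t^{\pm1}]$ be an irreducible polynomial, let $s\in\mathbb{Z}_p[t^{\pm1}]$ be an element whose class in the field $X:=\mathbb{Z}_p[t^{\pm1}]/(f(t))$ is invertible, regard $X$ as an Alexander biquandle by means of $s$ and $t$, and let $m=\operatorname{type}X$, so that $X$ is a $\mathbb{Z}_m$-family of Alexander biquandles. Let $H$ be an $S^1$-oriented handlebody-knot and let $D$ be a diagram of $H$. Then $$\max_{\phi\in\mathrm{Flow}(D;\mathbb{Z}_m)}\dim\mathrm{Col}_X(D,\phi)-1\ \le\ u(H),$$ where $\dim$ denotes dimension over the field $X$ and $u(H)$ is the unknotting number of $H$.
   Context: Notation: $\mathbb{Z}_m=\mathbb{Z}/m\mathbb{Z}$. Handlebody-links. A handlebody-link is a disjoint union of handlebodies, each of genus at least $1$, embedded in $S^3$; a handlebody-knot is a handlebody-link with one component. An $S^1$-orientation is a choice of orientation of (the core circle of) every genus $1$ component. Two $S^1$-oriented handlebody-links are equivalent if an orientation-preserving self-homeomorphism of $S^3$ takes one to the other preserving the $S^1$-orientation. Diagrams. A spatial trivalent graph is a graph with all vertices of valency 3 embedded in $S^3$ (circle components without vertices are allowed). A Y-orientation of it is a direction of all edges such that every vertex is both the initial vertex of a directed edge and the terminal vertex of a directed edge (so each vertex has either two incoming edges and one outgoing edge, or one incoming and two outgoing). A Y-oriented spatial trivalent graph represents an $S^1$-oriented handlebody-link $H$ if $H$ is a regular neighborhood of it and the $S^1$-orientation agrees with the Y-orientation. A diagram of $H$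 is a diagram of a Y-oriented spatial trivalent graph representing $H$. An $S^1$-oriented handlebody-link is trivial if it has a diagram with no crossings. An arc of a diagram is a piece of curve whose endpoints are undercrossings or vertices; a semi-arc is a piece of curve each of whose endpoints is a crossing (over or under) or a vertex (a circle component without crossings counts as one arc and one semi-arc). The normal orientation of a (semi-)arc is obtained by rotating its orientation counterclockwise by $\pi/2$ in the plane; the side to which it points is the front, the other side is behind. Unknotting number. A crossing change of an $S^1$-oriented handlebody-link is a crossing change of a spatial trivalent graph representing it (switching over/under information at a crossing of a diagram). For $S^1$-oriented handlebody-knots $H_1,H_2$ of the same genus, the Gordian distance $d(H_1,H_2)$ is the minimal number of crossing changes needed to deform one into the other (up to equivalence). The unknotting number is $u(H)=d(H,O)$, where $O$ is the $S^1$-oriented trivial handlebody-knot of the same genus as $H$. Local notation. At a crossing let $u$ and $w$ be the under semi-arcs lying respectively behind and in front of the over strand, and let $v$ and $v'$ be the over semi-arcs lying respectively behind and in front of the under strand (with respect to normal orientations). At a vertex let $\gamma$ be the edge that is the unique incoming or the unique outgoing one, and let $\alpha$, $\beta$ be the other two, with $\alpha$ on the right and $\beta$ on the left when looking in the direction of the orientation. Flows. A $\mathbb{Z}_m$-flow of $D$ is a map $\phi$ from the set of arcs of $D$ to $\mathbb{Z}_m$ with $\phi(u)=\phi(w)$ at each crossing and $\phi(\gamma)=\phi(\alpha)+\phi(\beta)$ at each vertex; a semi-arc carries the value of the arc containing it. $\mathrm{Flow}(D;\mathbb{Z}_m)$ is the set of all $\mathbb{Z}_m$-flows of $D$. Alexander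 biquandles. The $\mathbb{Z}_p[s^{\pm1},t^{\pm1}]$-module $X$ is a biquandle (an Alexander biquandle) with $a\mathbin{\underline{*}}b=ta+(s-t)b$, $a\mathbin{\overline{*}}b=sa$. For $n\in\mathbb{Z}$, $a\mathbin{\underline{*}^{[n]}}b=t^na+(s^n-t^n)b$ and $a\mathbin{\overline{*}^{[n]}}b=s^na$. The type of $X$ is $\operatorname{type}X=\min\{n>0\mid a\mathbin{\underline{*}^{[n]}}b=a=a\mathbin{\overline{*}^{[n]}}b\ \text{for all }a,b\in X\}$. With $m=\operatorname{type}X$ finite, the operations $\underline{*}^{[n]},\overline{*}^{[n]}$ depend only on $n$ mod $m$, and $X$ with these operations ($[n]\in\mathbb{Z}_m$) is called a $\mathbb{Z}_m$-family of Alexander biquandles. Colorings. An $X$-coloring of $(D,\phi)$ is a map $C$ from the set of semi-arcs of $D$ to $X$ such that at each crossing $C(w)=C(u)\mathbin{\underline{*}^{[\phi(v)]}}C(v)$ and $C(v')=C(v)\mathbin{\overline{*}^{[\phi(u)]}}C(u)$, and at each vertex $C(\alpha)=C(\gamma)$ and $C(\beta)=C(\gamma)\mathbin{\overline{*}^{[\phi(\alpha)]}}C(\gamma)=s^{\phi(\alpha)}C(\gamma)$. $\mathrm{Col}_X(D,\phi)$ is the set of all $X$-colorings, a vector space over the field $X$. *)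

(* Defs.v *)
From HB Require Import structures.
From mathcomp Require Import all_boot all_order all_algebra.
From mathcomp Require Import boolp classical_sets reals topology normedtype.
From mathcomp Require Import prodnormedzmodule trigo.
Set Implicit Arguments.
Unset Strict Implicit.
Unset Printing Implicit Defensive.
Import Order.TTheory GRing.Theory Num.Theory numFieldNormedType.Exports.
Local Open Scope classical_set_scope.
Local Open Scope ring_scope.

(* K[t, t^-1] is realized as the subring of K(t) formed by the fractions
   P / t^n. *)
Definition is_laurent (K : fieldType) : pred {fraction {poly K}} :=
  fun x => `[< exists (P : {poly K}) (n : nat),
     x = FracField.tofrac P / FracField.tofrac 'X ^+ n >].

Section LaurentRing.
Variable K : fieldType.
Local Notation "x %:F" := (FracField.tofrac x).

Lemma fracX_neq0 n : ('X : {poly K})%:F ^+ n != 0.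
Proof. by rewrite expf_neq0 // tofrac_eq0 polyX_eq0. Qed.

Lemma is_laurent_subring : subring_closed (@is_laurent K).
Proof.
split.
- by apply/asboolP; exists 1, 0; rewrite expr0 divr1 tofrac1.
- move=> _ _ /asboolP[P [n ->]] /asboolP[Q [k ->]].
  apply/asboolP; exists (P * 'X^k - Q * 'X^n), (n + k)%N.
  rewrite tofracB !tofracM !tofracXn exprD mulrBl; congr (_ - _).
    by rewrite -mulf_div divff ?fracX_neq0// mulr1.
  by rewrite [_ ^+ n * _ ^+ k]mulrC -mulf_div divff ?fracX_neq0// mulr1.
- move=> _ _ /asboolP[P [n ->]] /asboolP[Q [k ->]].
  apply/asboolP; exists (P * Q), (n + k)%N.
  by rewrite mulf_div tofracM exprD.
Qed.

HB.instance Definition _ :=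
  GRing.isSubringClosed.Build {fraction {poly K}} (@is_laurent K)
    is_laurent_subring.

Record laurent : Type :=
  Laurent { laurent_val : {fraction {poly K}};
            laurentP : laurent_val \in @is_laurent K }.

HB.instance Definition _ := [isSub for laurent_val].
HB.instance Definition _ := [Choice of laurent by <:].
HB.instance Definition _ := [SubChoice_isSubComNzRing of laurent by <:].

Lemma is_laurentX : ('X : {poly K})%:F \in @is_laurent K.
Proof. by apply/asboolP; exists 'X, 0; rewrite expr0 divr1. Qed.

Definition laurentX : laurent := Laurent is_laurentX.

Definition laurent_unit (a : laurent) : Prop := exists b, a * b = 1.

Definition laurent_irreducible (a : laurent) : Prop :=
  [/\ a <> 0, ~ laurent_unit a &
      forall b c, a = b * c -> laurent_unit b \/ laurent_unit c].

End LaurentRing.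

Section AlexanderBiquandle.
Variables (X : fieldType) (s t : X).

Definition biq_under (n : int) (a b : X) : X := t ^ n * a + (s ^ n - t ^ n) * b.
Definition biq_over (n : int) (a b : X) : X := s ^ n * a.

Definition biq_trivial (n : nat) : Prop :=
  forall a b, biq_under n a b = a /\ biq_over n a b = a.

Definition is_biq_type (m : nat) : Prop :=
  [/\ (0 < m)%N, biq_trivial m &
      forall n, (0 < n)%N -> biq_trivial n -> (m <= n)%N].

End AlexanderBiquandle.

Definition S3 (R : realType) := one_point_compactification (R * R * R)%type.

Section Sphere.
Variable R : realType.
Local Notation R3 := (R * R * R)%type.

Definition in_S3 (A : set R3) : set (S3 R) := [set (Some q : S3 R) | q in A].

Definition homeomorphism_S3 (h : S3 R -> S3 R) : Prop :=
  continuous h /\ exists k : S3 R -> S3 R, [/\ continuous k, cancel h k & cancel k h].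

(* A self-homeomorphism of a sphere preserves the orientation iff it has
   degree 1, that is, iff it is homotopic to the identity. *)
Definition orientation_preserving (h : S3 R -> S3 R) : Prop :=
  exists F : R * S3 R -> S3 R,
    [/\ continuous F, forall q, F (0, q) = q & forall q, F (1, q) = h q].

Definition op_homeo (h : S3 R -> S3 R) : Prop :=
  homeomorphism_S3 h /\ orientation_preserving h.

(* Loops are 1-periodic maps; this is free homotopy of loops inside H. *)
Definition loop_homotopic (H : set (S3 R)) (c d : R -> S3 R) : Prop :=
  exists F : R * R -> S3 R,
    [/\ continuous F, forall u x, H (F (u, x)),
        forall u x, F (u, x + 1) = F (u, x),
        forall x, F (0, x) = c x & forall x, F (1, x) = d x].

(* A square with g square holes, times an interval. *)
Definition handlebody_model (g : nat) : set R3 :=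
  [set q | [/\ 0 <= q.1.1 <= (2 * g + 1)%:R, 0 <= q.1.2 <= 3, 0 <= q.2 <= 1 &
     forall i, (i < g)%N ->
       ~ ((2 * i + 1)%:R < q.1.1 < (2 * i + 2)%:R /\ 1 < q.1.2 < 2)]].

Definition model_core (x : R) : R3 :=
  (3 / 2 + cos (2 * pi * x), 3 / 2 + sin (2 * pi * x), 1 / 2).

Definition is_handlebody (g : nat) (H : set (S3 R)) (core : R -> S3 R) : Prop :=
  exists h : R3 -> S3 R,
    [/\ {within handlebody_model g, continuous h},
        {in handlebody_model g &, injective h},
        [set h q | q in handlebody_model g] = H &
        g = 1%N -> loop_homotopic H core (h \o model_core)].

(* The S^1-orientation is carried by [hk_core], an oriented core circle up to
   homotopy; it is irrelevant unless the genus is 1. *)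
Record handlebody_knot : Type := HandlebodyKnot {
  hk_genus : nat;
  hk_set : set (S3 R);
  hk_core : R -> S3 R;
  hk_genus_gt0 : (0 < hk_genus)%N;
  hk_handlebody : is_handlebody hk_genus hk_set hk_core
}.

Definition hk_equiv (H1 H2 : handlebody_knot) : Prop :=
  exists h, [/\ op_homeo h, [set h q | q in hk_set H1] = hk_set H2 &
    hk_genus H1 = 1%N -> loop_homotopic (hk_set H2) (h \o hk_core H1) (hk_core H2)].

End Sphere.

(* A diagram is given by a polygonal directed graph in R^3 whose projection to
   the plane of the first two coordinates is generic; the third coordinate
   tells over from under.  The corners are the trivalent vertices, bends of the
   polygonal curves and the two preimages of every crossing point: curves are
   subdivided so that no crossing occurs inside an edge. *)
Record diagram (R : realType) : Type := Diagram {
  corner : finType;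
  edge : finType;
  src : edge -> corner;
  tgt : edge -> corner;
  pos : corner -> R * R * R
}.

Section Diagrams.
Variable R : realType.
Local Notation R2 := (R * R)%type.
Local Notation R3 := (R * R * R)%type.
Implicit Types D : diagram R.

Definition shadow D (a : corner D) : R2 := (pos a).1.
Definition height D (a : corner D) : R := (pos a).2.

Definition edge_point D (e : edge D) (x : R) : R3 :=
  (1 - x) *: pos (src e) + x *: pos (tgt e).

Definition spine D : set R3 :=
  [set q | exists (e : edge D) (x : R), 0 <= x <= 1 /\ q = edge_point e x].

Definition incident D (e : edge D) (a : corner D) : bool :=
  (src e == a) || (tgt e == a).

Definition dir D (e : edge D) : R2 := shadow (tgt e) - shadow (src e).
Definition outward D (a : corner D) (e : edge D) : R2 :=
  if src e == a then dir e else - dir e.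

(* Positive iff y lies on the side of the line directed by x to which the
   counterclockwise rotation of x by pi/2 points. *)
Definition det2 (x y : R2) : R := x.1 * y.2 - x.2 * y.1.

Definition indegree D (a : corner D) : nat := #|[set e : edge D | tgt e == a]%SET|.
Definition outdegree D (a : corner D) : nat := #|[set e : edge D | src e == a]%SET|.

Definition bivalent D (a : corner D) : Prop :=
  indegree a = 1%N /\ outdegree a = 1%N.

Definition passes_over D (a b : corner D) : Prop :=
  shadow a = shadow b /\ height b < height a.

Definition generic_crossing D (a b : corner D) : Prop :=
  [/\ bivalent a,
      forall e e', tgt e = a -> src e' = a ->
        exists2 k : R, 0 < k & dir e' = k *: dir e,
      forall e e', incident e a -> incident e' b -> det2 (dir e) (dir e') != 0 &
      forall c : corner D, shadow c = shadow a -> c = a \/ c = b].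

Definition wf_diagram D : Prop :=
  [/\ injective (@pos R D),
      forall a : corner D,
        (indegree a, outdegree a) \in [:: (1, 1); (2, 1); (1, 2)]%N,
      forall e : edge D, shadow (src e) <> shadow (tgt e),
      forall (e e' : edge D) (x y : R), e <> e' -> 0 <= x <= 1 -> 0 <= y <= 1 ->
        (edge_point e x).1 = (edge_point e' y).1 ->
        (x = 0 \/ x = 1) /\ (y = 0 \/ y = 1) &
      forall a b : corner D, a <> b -> shadow a = shadow b ->
        generic_crossing a b].

Definition crossingless D : Prop := injective (@shadow D).

Definition neighborhood (eps : R) (A : set R3) : set R3 :=
  [set q | exists2 a, A a & `|q - a : R3| <= eps].

(* Small closed neighborhoods of the polyhedron A, for the max norm of R^3, are
   regular neighborhoods of A; all others are isotopic to them rel A. *)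
Definition regular_neighborhood (A : set R3) (H : set (S3 R)) : Prop :=
  exists2 eps0 : R, 0 < eps0 & forall eps, 0 < eps < eps0 ->
    exists h : S3 R -> S3 R,
      [/\ op_homeo h, forall q, A q -> h (Some q) = Some q &
          [set h q | q in in_S3 (neighborhood eps A)] = H].

(* When the graph of D is a circle, c runs once around it along its
   orientation. *)
Definition traverses D (c : R -> S3 R) : Prop :=
  exists es : seq (edge D),
    [/\ uniq es, forall e, e \in es,
        cycle [rel e e' : edge D | tgt e == src e'] es &
        (forall x, c (x + 1) = c x) /\
        forall (i : 'I_(size es)) (x : R), 0 <= x <= 1 ->
          c ((i%:R + x) / (size es)%:R) = Some (edge_point (tnth (in_tuple es) i) x)].

Definition is_diagram_of D (H : handlebody_knot R) : Prop :=
  [/\ wf_diagram D, regular_neighborhood (spine D) (hk_set H) &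
      hk_genus H = 1%N ->
        exists2 c, traverses D c & loop_homotopic (hk_set H) c (hk_core H)].

Definition set_heights D (z : corner D -> R) : diagram R :=
  @Diagram R (corner D) (edge D) (@src R D) (@tgt R D) (fun a => (shadow a, z a)).

Definition switches D (z : corner D -> R) : Prop :=
  exists a b : corner D,
    passes_over a b /\
    forall c d : corner D, passes_over c d ->
      if (c, d) == (a, b) then z c < z d else z d < z c.

Definition crossing_change (H1 H2 : handlebody_knot R) : Prop :=
  exists D (z : corner D -> R),
    [/\ switches z, is_diagram_of D H1 & is_diagram_of (set_heights z) H2].

Inductive deforms : nat -> handlebody_knot R -> handlebody_knot R -> Prop :=
| deforms_equiv H1 H2 : hk_equiv H1 H2 -> deforms 0%N H1 H2
| deforms_change H1 H2 : crossing_change H1 H2 -> deforms 1%N H1 H2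
| deforms_trans n k H1 H2 H3 :
    deforms n H1 H2 -> deforms k H2 H3 -> deforms (n + k)%N H1 H3.

Definition is_gordian_distance (H1 H2 : handlebody_knot R) (d : nat) : Prop :=
  deforms d H1 H2 /\ forall n, deforms n H1 H2 -> (d <= n)%N.

Definition trivial_knot (O : handlebody_knot R) : Prop :=
  exists D, is_diagram_of D O /\ crossingless D.

Definition is_unknotting_number (H : handlebody_knot R) (u : nat) : Prop :=
  exists O, [/\ trivial_knot O, hk_genus O = hk_genus H &
                is_gordian_distance H O u].

(* u and w are the under semi-arcs behind and in front of the over strand,
   v and v' the over semi-arcs behind and in front of the under strand. *)
Definition at_crossing D (u w v v' : edge D) : Prop :=
  exists a b : corner D,
    [/\ passes_over a b, incident v a /\ incident v' a, incident u b /\ incident w b,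
        det2 (dir v) (outward b u) < 0 < det2 (dir v) (outward b w) &
        det2 (dir u) (outward a v) < 0 < det2 (dir u) (outward a v')].

(* Pairwise distinct directions x, y, z occur in this counterclockwise cyclic
   order: of the three angles from one to the next at most one is not in
   ]0, pi[. *)
Definition counterclockwise (x y z : R2) : bool :=
  [|| (0 < det2 x y) && (0 < det2 y z),
      (0 < det2 y z) && (0 < det2 z x) |
      (0 < det2 z x) && (0 < det2 x y)].

Definition at_vertex D (ga al be : edge D) : Prop :=
  exists a : corner D, al != be /\
    ([/\ tgt ga = a, src al = a, src be = a &
         counterclockwise (outward a ga) (outward a al) (outward a be)] \/
     [/\ src ga = a, tgt al = a, tgt be = a &
         counterclockwise (outward a ga) (outward a be) (outward a al)]).

(* A map on the set of arcs (semi-arcs) is a map on the edges that takes the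
   same value on two edges belonging to the same arc (semi-arc). *)
Definition constant_on_arcs D (T : Type) (f : edge D -> T) : Prop :=
  forall (a : corner D) (e e' : edge D), tgt e = a -> src e' = a ->
    bivalent a -> ~ (exists b, passes_over b a) -> f e = f e'.

Definition constant_on_semi_arcs D (T : Type) (f : edge D -> T) : Prop :=
  forall (a : corner D) (e e' : edge D), tgt e = a -> src e' = a ->
    bivalent a -> ~ (exists b, passes_over b a \/ passes_over a b) -> f e = f e'.

(* 'I_m stands for Z/mZ: 'Z_m would be wrong for m = 1. *)
Definition is_flow D (m : nat) (phi : edge D -> 'I_m) : Prop :=
  [/\ constant_on_arcs phi,
      forall u w v v', at_crossing u w v v' -> phi u = phi w &
      forall ga al be, at_vertex ga al be -> (phi ga = phi al + phi be %[mod m])%N].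

Definition Flow D (m : nat) : {set {ffun edge D -> 'I_m}} :=
  [set phi : {ffun edge D -> 'I_m} | `[< is_flow phi >]]%SET.

Section Colorings.
Variables (X : fieldType) (s t : X) (D : diagram R) (m : nat).
Variable phi : edge D -> 'I_m.

Definition is_coloring (C : edge D -> X) : Prop :=
  [/\ constant_on_semi_arcs C,
      forall u w v v', at_crossing u w v v' ->
        C w = biq_under s t (phi v) (C u) (C v) /\
        C v' = biq_over s (phi u) (C v) (C u) &
      forall ga al be, at_vertex ga al be ->
        C al = C ga /\ C be = biq_over s (phi al) (C ga) (C ga)].

End Colorings.
End Diagrams.

Lemma submod_vspace (K : fieldType) (vT : vectType K) (P : vT -> Prop) :
  P 0 -> (forall a u v, P u -> P v -> P (a *: u + v)) ->
  exists U : {vspace vT}, forall v, v \in U <-> P v.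
Proof.
move=> P0 Plin.
have PZ a u : P u -> P (a *: u) by move=> Pu; rewrite -[_ *: _]addr0; exact: Plin.
pose Q n := `[< exists2 U : {vspace vT}, \dim U = n & forall v, v \in U -> P v >].
have exQ : exists n, Q n.
  exists 0%N; apply/asboolP; exists 0%VS; first exact: dimv0.
  by move=> v; rewrite memv0 => /eqP->.
have ubQ n : Q n -> (n <= \dim {: vT})%N.
  by move=> /asboolP[U <- _]; exact: dimvS (subvf U).
case: (ex_maxnP exQ ubQ) => n /asboolP[U dU UP] nmax.
exists U => v; split; first exact: UP.
move=> Pv; apply: contrapT => /negP vU.
have : Q (\dim (<[v]> + U)%VS).
  apply/asboolP; exists (<[v]> + U)%VS => // w.
  by move=> /memv_addP[_ /vlineP[a ->]] [u uU ->]; apply: Plin => //; exact: UP.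
move=> /nmax; rewrite -dU => le.
have UvU : (U <= <[v]> + U)%VS by exact: addvSr.
have /eqP E : (U == <[v]> + U)%VS by rewrite eqEdim UvU.
by move: vU; rewrite E memvE addvSl.
Qed.

Section ColoringSpace.
Variables (R : realType) (X : fieldType) (s t : X) (D : diagram R) (m : nat).
Variable phi : edge D -> 'I_m.

Lemma is_coloring_vspace : exists U : {vspace {ffun edge D -> X^o}},
  forall C : {ffun edge D -> X^o}, C \in U <-> is_coloring s t phi C.
Proof.
apply: submod_vspace.
  split=> [a e e' _ _ _ _|u w v v' _|ga al be _]; rewrite !ffunE//.
    by rewrite /biq_under /biq_over !mulr0 addr0.
  by rewrite /biq_over mulr0.
move=> k C1 C2 [s1 c1 v1] [s2 c2 v2].
split=> [a e e' h1 h2 h3 h4|u w v v' h|ga al be h]; rewrite !ffunE.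
- by rewrite (s1 a e e') // (s2 a e e').
- have [-> ->] := c1 _ _ _ _ h; have [-> ->] := c2 _ _ _ _ h.
  rewrite /biq_under /biq_over /GRing.scale /=.
  split; last by rewrite mulrDr mulrCA.
  by rewrite !mulrDr !(mulrCA k) addrACA.
- have [-> ->] := v1 _ _ _ h; have [-> ->] := v2 _ _ _ h.
  by rewrite /biq_over /GRing.scale /= mulrDr mulrCA.
Qed.

Definition Col : {vspace {ffun edge D -> X^o}} := sval (cid is_coloring_vspace).

Lemma mem_Col (C : {ffun edge D -> X^o}) : C \in Col <-> is_coloring s t phi C.
Proof. exact: (svalP (cid is_coloring_vspace)). Qed.

End ColoringSpace.

(* Main.v *)
Require Import Defs.
From HB Require Import structures.
From mathcomp Require Import all_boot all_order all_algebra.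
From mathcomp Require Import boolp classical_sets functions reals topology normedtype.
From mathcomp Require Import prodnormedzmodule derive realfun zify ring lra.
Set Implicit Arguments.
Unset Strict Implicit.
Unset Printing Implicit Defensive.
Import Order.TTheory GRing.Theory Num.Theory numFieldNormedType.Exports.
Local Open Scope classical_set_scope.
Local Open Scope ring_scope.

(* For a group G, a locally constant G-valued function K on the complement of
   the shadow of a diagram determines a flat G-bundle on the complement of the
   spine, whose monodromy is picked up on the walls rising vertically from the
   edges: the wall above e contributes the quotient (right value)^-1 (left
   value) of K along e.  The only condition on K is that both edges at an under
   corner contribute the same jump.  Conversely every flat bundle arises in
   this way, and its structure group reduces to the subgroup generated by the
   jumps.  As the complement of the spine retracts by deformation into the
   complement of a small tube around it, a homeomorphism of the sphere matching
   tubes of two diagrams transports bundles; hence for every K on the first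
   diagram there is one on the second whose jumps generate a subgroup that
   contains the jumps of the first.

   Take G to be the semidirect product of Z/m and a vector space V on which k
   acts by (s/t)^k.  The Z/m-component of K has a flow phi as its jump, the
   V-component a solution of the linear system of the incidence matrix twisted
   by phi, with one row per edge and one column per corner.  So the nullity of
   this system, for a suitable flow on the second diagram, does not decrease.
   A crossing change modifies a single column, so it changes the nullity by at
   most 1; for trivial twist the nullity is that of the graph, at most E - V + 1
   when the graph is connected; and a diagram without crossings has no twist.
   Finally, if C is a coloring and r(e) is the Z/m-index of the region to the
   right of e, then s^(-r) C defines an element of the kernel on the other side
   of the incidence matrix, so that dim Col + E - V is at most the nullity. *)

(** * Flat bundles *)

(** A crossing change may use any diagram of the handlebody-knot, so quantities must be comparable
    between two arbitrary diagrams of the same set, and the only link between these is a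
    homeomorphism of the sphere that matches tubes. This is why the algebra is packaged in bundles,
    given by transition functions between nearby points: statements about them are local and are
    propagated along segments and homotopies, without base points or generators of a fundamental
    group. The vector space $V$ is $X^k$, where $k$ is the nullity on the first diagram, so that a
    whole basis of solutions is carried over as one bundle. It stays independent because the
    elements whose $V$-component is killed by a fixed linear form make up a subgroup. The twist
    $s/t$ arises when a coloring is multiplied by $s^{-r}$: the over operation becomes trivial and
    the under one becomes $u-v=(s/t)^{\phi(v)}(w-v)$. The nullity for trivial twist is carried back
    from the crossingless diagram to the given one, so that $E-V$ refers to a single diagram and
    cancels. *)

Section LocallyConstant.
Variable R : realType.

(** The points of the segment where [P] holds form a set that is open and closed in it, and a
    segment is connected. *)
Lemma segment_induction (a b : R) (P : R -> Prop) :
  (forall t, a <= t <= b -> \forall u \near t, a <= u <= b -> (P t <-> P u)) ->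
  forall t u, a <= t <= b -> a <= u <= b -> P t -> P u.
Proof.
move=> lcP t u tab uab Pt.
have := @segment_connected R a b.
pose B := `[a, b]%classic `&` P.
have itvE v : (`[a, b]%classic v : Prop) <-> a <= v <= b.
  by rewrite /= in_itv.
move=> /(_ B) H.
suff : B = `[a, b]%classic by move/seteqP => [_ /(_ u)]; case => //; exact/itvE.
apply: H.
- by exists t; split => //; exact/itvE.
- exists [set v | a <= v <= b -> P v]°; first exact: open_interior.
  apply/seteqP; split=> v [/itvE vab].
    move=> Pv; split; first exact/itvE.
    by rewrite /interior /=; near=> w => wab; apply/(near (lcP v vab) w).
  by move=> /interior_subset /= /(_ vab) Pv; split => //; exact/itvE.
- exists (~` [set v | a <= v <= b -> ~ P v]°).
    by apply: open_closedC; exact: open_interior.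
  apply/seteqP; split=> v [/itvE vab].
    move=> Pv; split; first exact/itvE.
    by move=> /interior_subset /= /(_ vab).
  move=> nP; split; first exact/itvE.
  apply: contrapT => nPv; apply: nP.
  by rewrite /interior /=; near=> w => wab Pw; apply: nPv; apply/(near (lcP v vab) w).
Unshelve. all: by end_near. Qed.

Lemma line_induction (V : normedModType R) (x y : V) (P : V -> Prop) :
  (forall t, 0 <= t <= 1 -> let p := x + t *: (y - x) in
     \forall q \near p, P p <-> P q) ->
  P x -> P y.
Proof.
move=> lcP Px.
have c (t : R) : {for t, continuous (fun t : R => x + t *: (y - x))}.
  by apply: cvgD; [exact: cvg_cst|apply: cvgZr_tmp; exact: cvg_id].
have := @segment_induction 0 1 (fun t => P (x + t *: (y - x))).
move=> /(_ _ 0 1); rewrite scale0r addr0 scale1r [x + _]addrC subrK; apply; rewrite ?lexx ?ler01//.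
move=> t t01; have := c t _ (lcP t t01); rewrite /nbhs /= => H.
near=> u => _; near: u; exact: H.
Unshelve. all: by end_near.
Qed.

Lemma near_norm (V : normedModType R) (x : V) (P : V -> Prop) :
  (\forall y \near x, P y) <->
  exists2 d : R, 0 < d & forall y, `|x - y| < d -> P y.
Proof. exact: (nbhs_normP x P). Qed.

End LocallyConstant.

Lemma continuous_near (T T' : topologicalType) (f : T -> T') (x : T) (P : T' -> Prop) :
  {for x, continuous f} -> (\forall y \near f x, P y) -> \forall y \near x, P (f y).
Proof. by move=> + Pf; exact. Qed.

Lemma near_all (T : topologicalType) (I : finType) (x : T) (P : I -> T -> Prop) :
  (forall i, \forall y \near x, P i y) -> \forall y \near x, forall i, P i y.
Proof. by move=> h; exact: (@filter_forall T I P (nbhs x) _ h). Qed.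

Lemma near_always (T : topologicalType) (x : T) (P : T -> Prop) :
  (forall y, P y) -> \forall y \near x, P y.
Proof. exact: nearW. Qed.

Lemma continuous_pair (T T1 T2 : topologicalType) (f : T -> T1) (g : T -> T2) (x : T) :
  {for x, continuous f} -> {for x, continuous g} ->
  {for x, continuous (fun y => (f y, g y))}.
Proof. by move=> cf cg; exact: (@cvg_pair _ _ _ (nbhs x) _ _ _ _ _ _ _ cf cg). Qed.

Section Cocycle.
Variables (G : groupType).
Local Open Scope group_scope.

Definition subgroup (S : G -> Prop) : Prop :=
  S 1 /\ forall x y, S x -> S y -> S (x^-1 * y).

Section Subgroup.
Variables (S : G -> Prop) (sS : subgroup S).

Lemma sub1 : S 1. Proof. by case: sS. Qed.

Lemma subV x : S x -> S x^-1.
Proof. by case: sS => S1 SV Sx; rewrite -[x^-1]mulg1; apply: SV. Qed.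

Lemma subM x y : S x -> S y -> S (x * y).
Proof. by case: sS => S1 SV /subV Sx Sy; rewrite -[x]invgK; apply: SV. Qed.

Lemma subMr x y : S y -> S (x * y) <-> S x.
Proof.
move=> Sy; split=> [Sxy|Sx]; last exact: subM.
by rewrite -(mulgK y x); apply: subM => //; exact: subV.
Qed.

End Subgroup.

Definition trivial_subgroup (x : G) : Prop := x = 1.

Lemma trivial_subgroupP : subgroup trivial_subgroup.
Proof. by split=> // x y -> ->; rewrite invg1 mulg1. Qed.

(* The transition function of a flat bundle with fibre [G]: [tau x y] compares
   the fibres over [x] and over any [y] close to [x]; how close is allowed to
   depend on [x] in a discontinuous way. *)
Definition local_cocycle (T : topologicalType) (U : set T) (tau : T -> T -> G) :=
  forall x, U x -> \forall y \near x, \forall z \near y,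
    tau x z = tau x y * tau y z.

(* [F] reduces the structure group of the bundle to [S] over [U]. *)
Definition reduction (S : G -> Prop) (T : topologicalType) (U : set T)
    (tau : T -> T -> G) (F : T -> G) :=
  forall x, U x -> \forall y \near x, S (F x * tau x y * (F y)^-1).

Lemma local_cocycle1 (T : topologicalType) (U : set T) tau x :
  local_cocycle U tau -> U x -> tau x x = 1.
Proof.
move=> c Ux; have /nbhs_singleton /nbhs_singleton := c x Ux.
by move/(congr1 (fun g => (tau x x)^-1 * g)); rewrite mulKg mulVg.
Qed.

Lemma local_cocycle_comp (T T' : topologicalType) (U : set T) (U' : set T') r tau :
  open U' -> (forall x, U' x -> {for x, continuous r}) ->
  (forall x, U' x -> U (r x)) -> local_cocycle U tau ->
  local_cocycle U' (fun x y => tau (r x) (r y)).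
Proof.
move=> oU' cr rU c x U'x; near=> y.
have U'y : U' y by near: y; exact: open_nbhs_nbhs.
have Hy : \forall z \near r y, tau (r x) z = tau (r x) (r y) * tau (r y) z.
  by near: y; have := cr x U'x _ (c (r x) (rU _ U'x)).
exact: (cr y U'y _ Hy).
Unshelve. all: by end_near. Qed.

(** Parallel transport along a path, [sigma] being the pulled back transition function. [E t] is the
    existence of a transport on $[0,t]$; it spreads along the segment. *)
Lemma transport_exists (R : realType) (sigma : R -> R -> G) :
  local_cocycle [set t : R | (0 <= t <= 1)%R] sigma ->
  exists2 phi : R -> G, phi 0%R = 1 & forall t : R, (0 <= t <= 1)%R ->
    \forall u \near t, (0 <= u <= 1)%R -> phi u = phi t * sigma t u.
Proof.
move=> c.
pose E (t : R) := exists2 phi : R -> G, phi 0%R = 1 &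
  forall s : R, (0 <= s <= t)%R ->
    \forall u \near s, (0 <= u <= t)%R -> phi u = phi s * sigma s u.
suff : E 1%R by [].
apply: (@segment_induction R 0%R 1%R E _ 0%R); rewrite ?lexx ?ler01//; last first.
  exists (fun=> 1) => // s; rewrite -eq_le => /eqP <-.
  apply/near_norm; exists 1%R => // u _; rewrite -eq_le => /eqP <-.
  by rewrite (local_cocycle1 c) ?mul1g//= lexx ler01.
suff mono (t : R) : (0 <= t <= 1)%R -> exists2 d : R, (0 < d)%R &
    forall t1 t2, (`|t - t1| < d)%R -> (`|t - t2| < d)%R ->
      (0 <= t1 <= 1)%R -> (0 <= t2 <= 1)%R -> E t1 -> E t2.
  move=> t t01; have [d d0 H] := mono t t01.
  apply/near_norm; exists d => // u ud u01.
  by split; apply: H => //; rewrite subrr normr0.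
move=> t01; have := c t t01.
move=> /near_norm[d d0 H]; exists d => // t1 t2 d1 d2 t101 t201.
have {}H (y : R) : (`|t - y| < d)%R ->
    \forall z \near y, sigma t z = sigma t y * sigma y z by exact: H.
case=> phi phi0 phiP.
have [t21|t12] := leP t2 t1.
  exists phi => // s /andP[s0 st2].
  have := phiP s; rewrite s0 (le_trans st2)// => /(_ isT); apply: filterS => u Hu /andP[u0 ut2].
  by apply: Hu; rewrite u0 (le_trans ut2).
have [t10 t11] := andP t101; have [t20 t22] := andP t201.
(* Beyond [t1] the transport continues through the transition function based at [t], normalised to
   agree with [phi] at [t1]. *)
pose psi s := if (s <= t1)%R then phi s else phi t1 * (sigma t t1)^-1 * sigma t s.
exists psi => [|s /andP[s0 st2]]; first by rewrite /psi t10.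
have [st1|st1|->] := ltgtP s t1.
- near=> u => /andP[u0 _].
  have ut1 : (u <= t1)%R by near: u; exact: lt_le_nbhsl.
  rewrite /psi (ltW st1) ut1; have : (0 <= u <= t1)%R by rewrite u0.
  by near: u; apply: phiP; rewrite s0 ltW.
- near=> u => /andP[u0 _].
  have ut1 : (t1 < u)%R by near: u; exact: lt_nbhsr.
  rewrite /psi !leNgt st1 ut1 /= -!mulgA; do 2!congr (_ * _).
  near: u; apply: H.
  rewrite ltr_norml; move: d1 d2; rewrite !ltr_norml => /andP[? ?] /andP[? ?].
  by apply/andP; split; lra.
- near=> u => /andP[u0 _]; rewrite /psi lexx; case: leP => ut1.
    have : (0 <= u <= t1)%R by rewrite u0.
    by near: u; apply: phiP; rewrite t10 lexx.
  have -> : sigma t u = sigma t t1 * sigma t1 u by near: u; exact: H.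
  by rewrite mulgA mulgVK.
Unshelve. all: by end_near. Qed.

(** Homotopy invariance of reductions: [F0] is transported along each path of the homotopy. The
    transports for different [x] are chosen independently of each other; what has to be shown is
    that the reduction condition [P x t] at [x] is locally constant in [t]. *)
Lemma reduction_homotopy (R : realType) (T T' : topologicalType) (S : G -> Prop)
    (A : set T) (U : set T') (tau : T' -> T' -> G) (gam : T * R -> T') (F0 : T -> G) :
  subgroup S -> open A ->
  (forall x (t : R), A x -> {for (x, t), continuous gam}) ->
  (forall x (t : R), A x -> (0 <= t <= 1)%R -> U (gam (x, t))) ->
  local_cocycle U tau ->
  reduction S A (fun x y => tau (gam (x, 0%R)) (gam (y, 0%R))) F0 ->
  exists F1, reduction S A (fun x y => tau (gam (x, 1%R)) (gam (y, 1%R))) F1.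
Proof.
move=> sS oA cg gU c red0.
have gamt x (t : R) : A x -> {for t, continuous (fun u : R => gam (x, u))}.
  move=> Ax; apply: (continuous_comp (g := gam) (f := fun u : R => (x, u))).
    by apply: continuous_pair; [exact: cvg_cst|exact: cvg_id].
  exact: cg.
have gamx x (t : R) : A x -> {for x, continuous (fun y => gam (y, t))}.
  move=> Ax; apply: (continuous_comp (g := gam) (f := fun y => (y, t))).
    by apply: continuous_pair; [exact: cvg_id|exact: cvg_cst].
  exact: cg.
have /choice[phi phiP] x : exists phi : R -> G, A x -> phi 0%R = 1 /\
    forall t : R, (0 <= t <= 1)%R -> \forall u \near t, (0 <= u <= 1)%R ->
      phi u = phi t * tau (gam (x, t)) (gam (x, u)).
  have [Ax|nAx] := pselect (A x); last by exists (fun=> 1).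
  have [|phi phi0 phiP] := @transport_exists R (fun t u => tau (gam (x, t)) (gam (x, u))).
    move=> t /= t01; have := continuous_near (gamt x t Ax) (c _ (gU x t Ax t01)).
    by apply: filterS => u; exact: (continuous_near (gamt x u Ax)).
  by exists phi.
pose g x t := F0 x * phi x t.
pose P x t := \forall y \near x,
  S (g x t * tau (gam (x, t)) (gam (y, t)) * (g y t)^-1).
suff step x : A x -> forall t : R, (0 <= t <= 1)%R -> \forall u \near t,
    (0 <= u <= 1)%R -> (P x t <-> P x u).
  exists (g ^~ 1%R) => x Ax; have := @segment_induction R 0%R 1%R (P x) (step x Ax).
  move=> /(_ 0%R 1%R); rewrite !lexx !ler01; apply => //.
  have Ay : \forall y \near x, A y by exact: open_nbhs_nbhs.
  have := red0 x Ax; apply: filterS2 Ay => y Ay.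
  by rewrite /g (phiP x Ax).1 (phiP y Ay).1 !mulg1.
move=> Ax t0 t01.
pose q0 := gam (x, t0).
have [[B J] /= [Bx Jt] BJ] := cg x t0 Ax _ (c _ (gU x t0 Ax t01)).
have {}Jt : nbhs t0 J by exact: Jt.
move/near_norm: Jt => [d d0 dJ].
have {}BJ y u : B y -> (`|t0 - u| < d)%R -> \forall z \near gam (y, u),
    tau q0 z = tau q0 (gam (y, u)) * tau (gam (y, u)) z.
  by move=> By ud; apply: (BJ (y, u)); split => //=; exact: dJ.
have dom t1 t2 u : (t1 <= u <= t2)%R -> (`|t0 - t1| < d)%R -> (`|t0 - t2| < d)%R ->
    (`|t0 - u| < d)%R.
  move=> /andP[? ?]; rewrite !ltr_norml => /andP[? ?] /andP[? ?].
  by apply/andP; split; lra.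
(* Measured against the fixed fibre over [q0], the transported value does not move with time, and
   the time window is the same for all [y] in [B]. *)
have cst y t1 t2 : A y -> B y -> (`|t0 - t1| < d)%R -> (`|t0 - t2| < d)%R ->
    (0 <= t1 <= 1)%R -> (0 <= t2 <= 1)%R -> (t1 <= t2)%R ->
    g y t1 * (tau q0 (gam (y, t1)))^-1 = g y t2 * (tau q0 (gam (y, t2)))^-1.
  move=> Ay By td1 td2 t11 t21 t12; apply/esym.
  apply: (@segment_induction R t1 t2 (fun u => g y u * (tau q0 (gam (y, u)))^-1 =
    g y t1 * (tau q0 (gam (y, t1)))^-1) _ t1) => //; rewrite ?lexx ?andbT//.
  move=> u ut; have ud := dom _ _ _ ut td1 td2.
  have u01 : (0 <= u <= 1)%R.
    by apply/andP; split; move: ut t11 t21 => /andP[? ?] /andP[? ?] /andP[? ?]; lra.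
  have H1 := (phiP y Ay).2 u u01.
  have H2 := continuous_near (gamt y u Ay) (BJ y u By ud).
  apply: filterS2 H1 H2 => v + -> vt.
  have v01 : (0 <= v <= 1)%R.
    by apply/andP; split; move: vt t11 t21 => /andP[? ?] /andP[? ?] /andP[? ?]; lra.
  by move=> /(_ v01); rewrite /g => ->; rewrite invgM !mulgA mulgK.
pose h y := g y t0 * (tau q0 (gam (y, t0)))^-1.
have hE : forall (v : T) (u : R), A v -> B v -> (`|t0 - u| < d)%R ->
    (0 <= u <= 1)%R -> g v u * (tau q0 (gam (v, u)))^-1 = h v.
  move=> v u Av Bv ud u01; rewrite /h; have t0d : (`|t0 - t0| < d)%R by rewrite subrr normr0.
  by have [ut|/ltW ut] := leP u t0; [exact: cst|rewrite -(cst v t0 u)].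
have PE u : (`|t0 - u| < d)%R -> (0 <= u <= 1)%R ->
    P x u <-> \forall y \near x, S (h x * (h y)^-1).
  move=> ud u01; have Bxx := nbhs_singleton Bx.
  have H0 : \forall y \near x, A y by exact: open_nbhs_nbhs.
  have H1 := continuous_near (gamx x u Ax) (BJ x u Bxx ud).
  have H2 : \forall y \near x, S (g x u * tau (gam (x, u)) (gam (y, u)) * (g y u)^-1) <->
      S (h x * (h y)^-1).
    apply: filterS3 H0 Bx H1 => y Ay By E.
    rewrite -(hE x u Ax Bxx ud u01) -(hE y u Ay By ud u01).
    by rewrite invgF E !mulgA mulgVK.
  by split=> H; apply: filterS2 H H2 => y ? [? ?]; auto.
apply/near_norm; exists d => // u ud u01.
by rewrite !PE// subrr normr0.
Qed.

(** Shrinking to [o] makes the bundle constant at time 0, where the constant 1 reduces it. *)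
Lemma reduction_star (R : realType) (V : normedModType R) (A U : set V)
    (tau : V -> V -> G) (o : V) :
  open A -> (forall x (t : R), A x -> (0 <= t <= 1)%R -> U (o + t *: (x - o))%R) ->
  local_cocycle U tau -> exists F, reduction trivial_subgroup A tau F.
Proof.
move=> oA AU c.
have [[x0 Ax0]|A0] := pselect (exists x, A x); last first.
  by exists (fun=> 1) => x Ax; case: A0; exists x.
pose gam (p : V * R) := (o + p.2 *: (p.1 - o))%R.
suff [F redF] : exists F, reduction trivial_subgroup A
    (fun x y => tau (gam (x, 1%R)) (gam (y, 1%R))) F.
  exists F => x Ax; have := redF x Ax; apply: filterS => y /=.
  by rewrite /gam /= !scale1r !(addrC o) !subrK.
apply: (@reduction_homotopy R V V trivial_subgroup A U tau gam (fun=> 1)) => //.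
- exact: trivial_subgroupP.
- move=> x t _; apply: cvgD; first exact: cvg_cst.
  apply: cvgZ; first exact: cvg_snd.
  by apply: cvgB; [exact: cvg_fst|exact: cvg_cst].
- move=> x Ax; apply: nearW => y /=; rewrite /gam /= !scale0r addr0.
  rewrite (local_cocycle1 c) ?mulg1 ?mul1g ?invg1//.
  by have := AU x0 0%R Ax0; rewrite scale0r addr0 lexx ler01; apply.
Qed.

End Cocycle.

(** * Determinant and scalar product in the plane *)

Section Plane.
Variable R : realType.
Local Notation R2 := (R * R)%type.
Local Notation R3 := (R * R * R)%type.
Implicit Types x y d : R2.

Lemma scaleR2 (k : R) x : k *: x = (k * x.1, k * x.2).
Proof. by []. Qed.

Lemma det2Dr d x y : det2 d (x + y) = det2 d x + det2 d y.
Proof. by rewrite /det2 ?scaleR2 /=; ring. Qed.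

Lemma det2Br d x y : det2 d (x - y) = det2 d x - det2 d y.
Proof. by rewrite /det2 ?scaleR2 /=; ring. Qed.

Lemma det2Zr d k x : det2 d (k *: x) = k * det2 d x.
Proof. by rewrite /det2 ?scaleR2 /=; ring. Qed.

Lemma det2Zl d k x : det2 (k *: d) x = k * det2 d x.
Proof. by rewrite /det2 ?scaleR2 /=; ring. Qed.

Lemma det2Nl d x : det2 (- d) x = - det2 d x.
Proof. by rewrite /det2 ?scaleR2 /=; ring. Qed.

Lemma det2Nr d x : det2 d (- x) = - det2 d x.
Proof. by rewrite /det2 ?scaleR2 /=; ring. Qed.

Lemma det2xx d : det2 d d = 0.
Proof. by rewrite /det2 ?scaleR2 /=; ring. Qed.

Lemma det2C d x : det2 d x = - det2 x d.
Proof. by rewrite /det2 ?scaleR2 /=; ring. Qed.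

Lemma det2_continuous d y : continuous (fun x : R2 => det2 d (x - y)).
Proof.
move=> x; rewrite /det2 /=.
apply: cvgB; apply: cvgM; try exact: cvg_cst; apply: cvgB; try exact: cvg_cst.
  exact: cvg_snd.
exact: cvg_fst.
Qed.

Lemma near_det2_gt0 d x y : 0 < det2 d (x - y) -> \forall z \near x, 0 < det2 d (z - y).
Proof.
move=> h; have := @lt_nbhsr R 0 _ h.
by move/(continuous_near (@det2_continuous d y x)).
Qed.

Lemma near_det2_lt0 d x y : det2 d (x - y) < 0 -> \forall z \near x, det2 d (z - y) < 0.
Proof.
move=> h; have := @lt_nbhsl R _ 0 h.
by move/(continuous_near (@det2_continuous d y x)).
Qed.

Definition dot2 x y : R := x.1 * y.1 + x.2 * y.2.

Lemma dot2_gt0 d : d != 0 -> 0 < dot2 d d.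
Proof.
case: d => a b; rewrite /dot2 /= => ab0.
have : (a != 0) || (b != 0).
  by apply: contraNT ab0; rewrite negb_or !negbK => /andP[/eqP-> /eqP->].
have := sqr_ge0 a; have := sqr_ge0 b; rewrite -!expr2 => b2 a2.
by case/orP => h; [apply: ltr_wpDr|apply: ltr_wpDl]; rewrite ?lt_neqAle ?b2 ?a2 ?andbT// eq_sym sqrf_eq0.
Qed.

Lemma dot2_continuous d y : continuous (fun x : R2 => dot2 d (x - y)).
Proof.
move=> x; rewrite /dot2 /=.
apply: cvgD; apply: cvgM; try exact: cvg_cst; apply: cvgB; try exact: cvg_cst.
  exact: cvg_fst.
exact: cvg_snd.
Qed.

Lemma det2_eq0P d x : d != 0 -> det2 d x = 0 -> x = (dot2 d x / dot2 d d) *: d.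
Proof.
move=> /dot2_gt0 d0 dx; have d1 : dot2 d d != 0 by rewrite gt_eqF.
move: d0 d1 dx; case: x => x1 x2; case: d => d1 d2; rewrite /dot2 /det2 /= => d0 d01 dx.
have E1 : x1 * (d1 * d1 + d2 * d2) = (d1 * x1 + d2 * x2) * d1.
  by apply/eqP; rewrite -subr_eq0; apply/eqP; transitivity (- d2 * (d1 * x2 - d2 * x1)); [ring|rewrite dx mulr0].
have E2 : x2 * (d1 * d1 + d2 * d2) = (d1 * x1 + d2 * x2) * d2.
  by apply/eqP; rewrite -subr_eq0; apply/eqP; transitivity (d1 * (d1 * x2 - d2 * x1)); [ring|rewrite dx mulr0].
congr (_, _) => /=; apply: (mulIf d01).
  by rewrite E1 mulrAC divfK.
by rewrite E2 mulrAC divfK.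
Qed.

End Plane.

(** * The shadow of a diagram *)

Section Shade.
Variables (R : realType) (D : diagram R).
Local Notation R2 := (R * R)%type.
Local Notation R3 := (R * R * R)%type.
Implicit Types (e : edge D) (a b c : corner D) (t u : R) (x y : R2) (q : R3).

Definition sh e t : R2 := (edge_point e t).1.
Definition ht e t : R := (edge_point e t).2.

Definition shade : set R2 := [set x | exists e t, 0 <= t <= 1 /\ sh e t = x].

Lemma sh0 e : sh e 0 = shadow (src e).
Proof. by rewrite /sh /edge_point subr0 scale1r scale0r addr0. Qed.

Lemma sh1 e : sh e 1 = shadow (tgt e).
Proof. by rewrite /sh /edge_point subrr scale0r scale1r add0r. Qed.

Lemma ht0 e : ht e 0 = height (src e).
Proof. by rewrite /ht /edge_point subr0 scale1r scale0r addr0. Qed.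

Lemma ht1 e : ht e 1 = height (tgt e).
Proof. by rewrite /ht /edge_point subrr scale0r scale1r add0r. Qed.

Lemma shE e t : sh e t = shadow (src e) + t *: dir e.
Proof.
rewrite /sh /edge_point /dir /shadow.
case: (pos (src e)) (pos (tgt e)) => [[a b] c] [[a' b'] c'].
by rewrite scaleR2 /=; congr (_, _) => /=; rewrite /GRing.scale /=; ring.
Qed.

Lemma shB e t u : sh e t - sh e u = (t - u) *: dir e.
Proof. by rewrite !shE opprD addrACA subrr add0r -scalerBl. Qed.

Lemma htE e t : ht e t = (1 - t) * height (src e) + t * height (tgt e).
Proof. by []. Qed.

Lemma edge_pointE e t : edge_point e t = (sh e t, ht e t).
Proof. by rewrite -surjective_pairing. Qed.

Lemma sh_continuous e : continuous (sh e).
Proof.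
move=> t; have -> : sh e = fun t => shadow (src e) + t *: dir e by apply/funext => u; rewrite shE.
by apply: cvgD; [exact: cvg_cst|apply: cvgZr_tmp; exact: cvg_id].
Qed.

Lemma ht_continuous e : continuous (ht e).
Proof.
move=> t; have -> : ht e = fun t => (1 - t) * height (src e) + t * height (tgt e).
  by apply/funext => u; rewrite htE.
apply: cvgD; apply: cvgM; try exact: cvg_cst; last exact: cvg_id.
by apply: cvgB; [exact: cvg_cst|exact: cvg_id].
Qed.

Lemma edge_point_continuous e : continuous (edge_point e).
Proof.
move=> t; rewrite (_ : edge_point e = fun t => (sh e t, ht e t)).
  by apply: continuous_pair; [exact: sh_continuous|exact: ht_continuous].
by apply/funext => u; rewrite edge_pointE.
Qed.

Lemma edge_compact e : compact [set edge_point e t | t in `[0, 1]%classic].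
Proof.
apply: continuous_compact; last exact: segment_compact.
by apply: continuous_subspaceT => t; exact: edge_point_continuous.
Qed.

Lemma edge_shadow_compact e : compact [set sh e t | t in `[0, 1]%classic].
Proof.
apply: continuous_compact; last exact: segment_compact.
by apply: continuous_subspaceT => t; exact: sh_continuous.
Qed.

Hypothesis wfD : wf_diagram D.

Lemma dir_neq0 e : dir e != 0.
Proof.
case: wfD => _ _ /(_ e) h _ _; apply/eqP => /eqP; rewrite subr_eq0 => /eqP E.
by apply: h; rewrite E.
Qed.

Lemma sh_param e t u : t = u + dot2 (dir e) (sh e t - sh e u) / dot2 (dir e) (dir e).
Proof.
rewrite shB; have h : dot2 (dir e) (dir e) != 0 by rewrite gt_eqF// dot2_gt0// dir_neq0.
by move: h; rewrite /dot2 scaleR2 /= => h; field.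
Qed.

Lemma sh_inj e t u : sh e t = sh e u -> t = u.
Proof. by move=> E; rewrite (sh_param e t u) E subrr /dot2 /= !mulr0 addr0 mul0r addr0. Qed.

(** For an edge whose shadow passes through [x0] the parameter is an affine function of the point;
    the shadow of any other edge is compact and stays away from [x0]. *)
Lemma near_sh (x0 : R2) (eps : R) : 0 < eps ->
  \forall x \near x0, forall e t, 0 <= t <= 1 -> sh e t = x ->
    exists t0, [/\ 0 <= t0 <= 1, sh e t0 = x0 & `|t - t0| < eps].
Proof.
move=> eps0; apply: near_all => e.
have [[t0 [t01 E]]|nE] := pselect (exists t0, 0 <= t0 <= 1 /\ sh e t0 = x0).
  have : \forall x \near x0, `|dot2 (dir e) (x - x0) / dot2 (dir e) (dir e)| < eps.
    have c : {for x0, continuous (fun x => `|dot2 (dir e) (x - x0) / dot2 (dir e) (dir e)|)}.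
      apply: (continuous_comp (g := fun r : R => `|r|)); last exact: norm_continuous.
      by apply: cvgM; [exact: dot2_continuous|exact: cvg_cst].
    apply: (continuous_near (P := fun r : R => r < eps) c); apply: lt_nbhsl.
    by rewrite subrr /dot2 /= !mulr0 addr0 mul0r normr0.
  apply: filterS => x hx t t01' Et; exists t0; split=> //.
  by rewrite {1}(sh_param e t t0) E Et addrAC subrr add0r.
have cl : closed [set sh e t | t in `[0, 1]%classic].
  by apply: compact_closed; [exact: norm_hausdorff|exact: edge_shadow_compact].
have : \forall x \near x0, ~ [set sh e t | t in `[0, 1]%classic] x.
  apply: open_nbhs_nbhs; split; first exact: closed_openC.
  by case=> t /=; rewrite in_itv /= => t01 Et; apply: nE; exists t.
apply: filterS => x nx t t01 Et; exfalso; apply: nx; exists t => //=.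
Qed.

Lemma shadeC_open : open (~` shade).
Proof.
rewrite openE => x0 nx0; have := near_sh x0 (@ltr01 R).
apply: filterS => x hx [e [t [t01 Et]]]; apply: nx0.
by have [t0 [? ? _]] := hx e t t01 Et; exists e, t0.
Qed.

Lemma near_spine (q0 : R3) (eps : R) : 0 < eps ->
  \forall q \near q0, forall e t, 0 <= t <= 1 -> edge_point e t = q ->
    exists t0, [/\ 0 <= t0 <= 1, edge_point e t0 = q0 & `|t - t0| < eps].
Proof.
move=> eps0; have H1 : \forall q \near q0, forall e t, 0 <= t <= 1 -> sh e t = q.1 ->
    exists t0, [/\ 0 <= t0 <= 1, sh e t0 = q0.1 & `|t - t0| < eps].
  exact: (continuous_near (f := fst) (@cvg_fst _ _ _ _ _) (near_sh q0.1 eps0)).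
have H2 : \forall q \near q0, forall e, [set edge_point e t | t in `[0, 1]%classic] q ->
    [set edge_point e t | t in `[0, 1]%classic] q0.
  apply: near_all => e.
  have [h|h] := pselect ([set edge_point e t | t in `[0, 1]%classic] q0).
    by near=> q.
  have : \forall q \near q0, ~ [set edge_point e t | t in `[0, 1]%classic] q.
    apply: open_nbhs_nbhs; split => //; apply: closed_openC.
    by apply: compact_closed; [exact: norm_hausdorff|exact: edge_compact].
  by apply: filterS => q nq /nq.
apply: filterS2 H1 H2 => q H1 H2 e t t01 Et.
have [|t0] := H2 e; first by exists t => //=; rewrite in_itv.
rewrite /= in_itv /= => t001 Et0.
exists t0; split => //.
have [|t1 [t101 Et1 tt1]] := H1 e t t01; first by rewrite -Et.
by have -> : t0 = t1 by apply: (@sh_inj e); rewrite Et1 -Et0.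
Unshelve. all: by end_near. Qed.

Lemma spineC_open : open (~` spine D).
Proof.
rewrite openE => q0 nq0; have := near_spine q0 (@ltr01 R).
apply: filterS => q hq [e [t [t01 Et]]]; apply: nq0.
by have [t0 [? ? _]] := hq e t t01 (esym Et); exists e, t0.
Qed.

Lemma inner_unique e e' t u : 0 < t < 1 -> 0 <= u <= 1 -> sh e t = sh e' u ->
  e = e' /\ t = u.
Proof.
move=> /andP[t0 t1] u01 E.
have ee' : e = e'.
  apply: contrapT => ne; case: wfD => _ _ _ /(_ e e' t u ne) h _.
  have [|[] Et _] := h _ u01 E; first by rewrite !ltW.
    by rewrite Et ltxx in t0.
  by rewrite Et ltxx in t1.
by move: E; rewrite ee' => /sh_inj.
Qed.

Lemma near_inner e t : 0 < t < 1 ->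
  \forall x \near sh e t,
    (forall e' u, 0 <= u <= 1 -> sh e' u = x -> e' = e /\ 0 < u < 1) /\
    (det2 (dir e) (x - sh e t) = 0 -> exists2 u, 0 < u < 1 & x = sh e u).
Proof.
move=> t01; have [t0 t1] := andP t01.
pose eps := Num.min t (1 - t).
have eps0 : 0 < eps by rewrite lt_min t0 subr_gt0.
have win u : `|u - t| < eps -> 0 < u < 1.
  by rewrite lt_min !ltr_norml => /andP[/andP[? ?] /andP[? ?]]; apply/andP; split; lra.
have H1 := near_sh (sh e t) eps0.
have H2 : \forall x \near sh e t,
    `|dot2 (dir e) (x - sh e t) / dot2 (dir e) (dir e)| < eps.
  have c : {for sh e t, continuous
      (fun x => `|dot2 (dir e) (x - sh e t) / dot2 (dir e) (dir e)|)}.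
    apply: (continuous_comp (g := fun r : R => `|r|)); last exact: norm_continuous.
    by apply: cvgM; [exact: dot2_continuous|exact: cvg_cst].
  apply: (continuous_near (P := fun r : R => r < eps) c); apply: lt_nbhsl.
  by rewrite subrr /dot2 /= !mulr0 addr0 mul0r normr0.
apply: filterS2 H1 H2 => x H1 H2; split=> [e' u u01 E|/(det2_eq0P (dir_neq0 e)) E].
  have [u0 [u001 E0 d]] := H1 e' u u01 E.
  by have [-> tu] := inner_unique t01 u001 (esym E0); split=> //; apply: win; rewrite tu.
exists (t + dot2 (dir e) (x - sh e t) / dot2 (dir e) (dir e)).
  by apply: win; rewrite addrAC subrr add0r.
by rewrite shE scalerDl addrA -shE -E addrC subrK.
Qed.

Lemma shade_cases x : shade x ->
  (exists e t, 0 < t < 1 /\ x = sh e t) \/ (exists a, x = shadow a).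
Proof.
case=> e [t [/andP[t0 t1] <-]].
have [t0'|t0'|<-] := ltgtP 0 t; last by right; exists (src e); rewrite sh0.
  have [t1'|t1'|->] := ltgtP t 1; last by right; exists (tgt e); rewrite sh1.
    by left; exists e, t; rewrite t0' t1'.
  by rewrite leNgt t1' in t1.
by rewrite leNgt t0' in t0.
Qed.

Lemma corner_edge a : exists e, incident e a.
Proof.
case: wfD => _ /(_ a) h _ _ _.
have : (0 < indegree a)%N by move: h; rewrite !inE => /or3P[] /eqP[-> _].
rewrite /indegree card_gt0 => /set0Pn[e]; rewrite inE => /eqP te.
by exists e; rewrite /incident te eqxx orbT.
Qed.

Lemma incident_sh e a : incident e a -> exists2 t, (t = 0 \/ t = 1) & edge_point e t = pos a.
Proof.
case/orP => /eqP <-; [exists 0; first by left|exists 1; first by right];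
by rewrite /edge_point ?subr0 ?subrr ?scale0r ?scale1r ?addr0 ?add0r.
Qed.

Lemma inner_neq_shadow e t a : 0 < t < 1 -> sh e t <> shadow a.
Proof.
move=> t01 E; have [e' /incident_sh[u u01 Eu]] := corner_edge a.
have [||_ tu] := @inner_unique e e' t u t01.
- by case: u01 => ->; rewrite lexx ler01.
- by rewrite E /sh Eu.
by case: u01 tu => -> tu; rewrite tu ?ltxx ?andbF in t01.
Qed.

Lemma shade_shadow a : shade (shadow a).
Proof.
have [e /incident_sh[u u01 Eu]] := corner_edge a.
by exists e, u; split; [case: u01 => ->; rewrite lexx ler01|rewrite /sh Eu].
Qed.

Lemma near_corner a (eps : R) : 0 < eps ->
  \forall x \near shadow a, forall e t, 0 <= t <= 1 -> sh e t = x ->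
    (shadow (src e) = shadow a /\ t < eps) \/ (shadow (tgt e) = shadow a /\ 1 - eps < t).
Proof.
move=> eps0; have := near_sh (shadow a) eps0.
apply: filterS => x H e t t01 E; have [t0 [t001 E0 tt0]] := H e t t01 E.
have [t00 t01'] := andP t001.
have [t00'|t00'|z] := ltgtP 0 t0; last 1 first.
- by left; rewrite -sh0 z E0; split=> //; move: tt0; rewrite -z subr0 ltr_norml => /andP[].
- have [t1'|t1'|z] := ltgtP t0 1; last 1 first.
  + right; rewrite -sh1 -z E0; split=> //.
    by move: tt0; rewrite z ltr_norml => /andP[? _]; lra.
  + by have := @inner_neq_shadow e t0 a; rewrite t00' t1' => /(_ isT).
  + by rewrite leNgt t1' in t01'.
- by rewrite leNgt t00' in t00.
Qed.

End Shade.

(** * Propagation of local properties along segments *)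

Section Segments.
Variables (R : realType) (V : normedModType R).
Implicit Types x y c p q : V.

Lemma ball_convex c x y (r s : R) : `|c - x| < r -> `|c - y| < r -> 0 <= s <= 1 ->
  `|c - (x + s *: (y - x))| < r.
Proof.
move=> cx cy /andP[s0 s1].
have -> : c - (x + s *: (y - x)) = (1 - s) *: (c - x) + s *: (c - y).
  have -> : c - y = c - x - (y - x) by rewrite opprB addrA subrK.
  by rewrite [s *: (c - x - _)]scalerBr addrA -scalerDl subrK scale1r opprD addrA.
apply: le_lt_trans (ler_normD _ _) _; rewrite !normrZ (ger0_norm s0) ger0_norm ?subr_ge0//.
have [->|s_neq0] := eqVneq s 0; first by rewrite subr0 mul1r mul0r addr0.
have s_gt0 : 0 < s by rewrite lt_neqAle eq_sym s_neq0.
rewrite (_ : r = (1 - s) * r + s * r); last by ring.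
by rewrite ler_ltD// ?ltr_pM2l// ler_wpM2l ?subr_ge0// ltW.
Qed.

Lemma near_ball_lt c x (r : R) : `|c - x| < r -> \forall y \near x, `|c - y| < r.
Proof.
move=> cx; apply/near_norm; exists (r - `|c - x|); first by rewrite subr_gt0.
move=> y xy; have := ler_distD x c y; lra.
Qed.

Definition convex_set (C : set V) :=
  forall x y (s : R), C x -> C y -> 0 <= s <= 1 -> C (x + s *: (y - x)).

Lemma convex_induction (C : set V) (P : V -> Prop) x y : convex_set C ->
  (forall p, C p -> \forall q \near p, P p <-> P q) -> C x -> C y -> P x -> P y.
Proof. by move=> cC lP Cx Cy; apply: line_induction => t t01 /=; apply/lP/cC. Qed.

Variable N : set V.
Hypothesis denseN : forall x (P : V -> Prop), (\forall y \near x, P y) -> exists2 y, N y & P y.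

(** [F] is only considered on the dense set [N]. Two local values agree as soon as their domains
    share a point of [N], so a value crosses the excluded points. *)
Lemma generic_induction (T : Type) (F : V -> T) x y (w : T) :
  (forall s : R, 0 <= s <= 1 -> exists w, \forall q \near x + s *: (y - x), N q -> F q = w) ->
  (\forall q \near x, N q -> F q = w) -> \forall q \near y, N q -> F q = w.
Proof.
move=> loc; apply: (line_induction (P := fun p => \forall q \near p, N q -> F q = w)).
move=> s s01 p; have [w' H] := loc s s01.
apply: filterS (nbhs_interior H) => q Hq; split=> [Pp|Pq].
  have [z Nz [E E']] := denseN (filterI H Pp).
  by have <- : w' = w by rewrite -E// E'.
have [z Nz [E E']] := denseN (filterI Hq Pq).
by have <- : w' = w by rewrite -E// E'.
Qed.

End Segments.

(** * Functions that are locally constant off the shadow *)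

Section Generic.
Variables (R : realType) (D : diagram R).
Hypothesis wfD : wf_diagram D.
Local Notation R2 := (R * R)%type.
Implicit Types (e : edge D) (a b : corner D) (t u : R) (x y : R2).

Lemma generic_direction : exists c : R2, forall e, det2 c (dir e) != 0.
Proof.
(* [k] exceeds every slope. A vertical edge contributes 0 to the sum and is transverse to the
   direction anyway. *)
pose k : R := 1 + \sum_(e : edge D) `|(dir e).2 / (dir e).1|.
exists (1, k) => e.
rewrite (_ : det2 _ _ = (dir e).2 - k * (dir e).1) ?subr_eq0; last by rewrite /det2 mul1r.
 apply/eqP => E.
have [d10|d10] := eqVneq (dir e).1 0.
  have /negP := dir_neq0 wfD e; apply; rewrite [dir e]surjective_pairing E d10 mulr0.
  exact/eqP.
have kE : k = (dir e).2 / (dir e).1 by rewrite E mulfK.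
have : (dir e).2 / (dir e).1 < k.
  rewrite /k (bigD1 e)//= addrCA ltr_pwDr//; last exact: ler_norm.
  by rewrite ltr_pwDl// sumr_ge0.
by rewrite -kE ltxx.
Qed.

(** A small push along the generic direction [c]: an edge that meets the pushed point also passes
    through [x], so it would be parallel to [c]. *)
Lemma shade_generic_dense x (P : R2 -> Prop) :
  (\forall y \near x, P y) -> exists2 y, (~` shade D) y & P y.
Proof.
move=> Px; have [c cg] := generic_direction.
have [d d0 H] := (near_norm x _).1 (filterI Px (near_sh wfD x (@ltr01 R))).
pose k := d / (2 * (1 + `|c|)).
have c1 : 0 < 1 + `|c| by rewrite ltr_pwDl.
have k0 : 0 < k by rewrite divr_gt0// mulr_gt0.
have xd : `|x - (x + k *: c)| < d.
  rewrite opprD addrA subrr add0r normrN normrZ gtr0_norm// /k.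
  rewrite mulrAC ltr_pdivrMr ?mulr_gt0// ltr_pM2l//.
  by have := normr_ge0 c; lra.
have [Py K] := H _ xd; exists (x + k *: c) => // -[e [t [t01 E]]].
have [t0 [t001 E0 _]] := K e t t01 E.
have : k *: c = (t - t0) *: dir e by rewrite -shB E E0 addrAC subrr add0r.
move/(congr1 (det2 c)); rewrite !det2Zr det2xx mulr0 => /esym/eqP.
rewrite mulf_eq0 (negbTE (cg e)) orbF subr_eq0 => /eqP tt0.
move: E0; rewrite -tt0 E => /eqP; rewrite -subr_eq0 addrAC subrr add0r scaler_eq0 gt_eqF//=.
move=> /eqP c0; have := cg e; rewrite c0 /det2 /= !mul0r subrr eqxx; exact/negP.
Qed.

Section LocallyConstantPlane.
Variable T : Type.
Implicit Types K : R2 -> T.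

Definition lconst K := forall x, ~ shade D x -> \forall y \near x, K y = K x.

(* [v] is the value of [K] on the side of [e] to which [d] turns when rotated
   by pi/2; [d] is [dir e] or [- dir e]. *)
Definition side_value K e (d : R2) (v : T) :=
  forall t, 0 < t < 1 -> \forall x \near sh e t, 0 < det2 d (x - sh e t) -> K x = v.

Lemma lconst_convex K (C : set R2) x y : convex_set C -> (forall p, C p -> ~ shade D p) ->
  lconst K -> C x -> C y -> K x = K y.
Proof.
move=> cC CN lK Cx Cy; apply/esym.
apply: (convex_induction (P := fun p => K p = K x) cC _ Cx Cy erefl) => p /CN/lK.
by apply: filterS => q ->.
Qed.

Definition rot2 (d : R2) : R2 := (- d.2, d.1).

Lemma det2_rot2 d : det2 d (rot2 d) = dot2 d d.
Proof. by rewrite /det2 /dot2 /rot2 /=; ring. Qed.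

Lemma near_push (V : normedModType R) (x v : V) (P : V -> Prop) : (\forall y \near x, P y) ->
  exists2 k : R, 0 < k & forall k', 0 < k' <= k -> P (x + k' *: v).
Proof.
move=> Px; have [d d0 H] := (near_norm x _).1 Px.
have c1 : 0 < 1 + `|v| by rewrite ltr_pwDl.
exists (d / (2 * (1 + `|v|))); first by rewrite divr_gt0// mulr_gt0.
move=> k' /andP[k'0]; rewrite ler_pdivlMr ?mulr_gt0// => k'd; apply: H.
rewrite opprD addrA subrr add0r normrN normrZ gtr0_norm//.
apply: lt_le_trans k'd; rewrite ltr_pM2l//.
by have := normr_ge0 v; lra.
Qed.

(** [K] is constant on a small half-disc beside each inner point of the edge; the half-discs at
    neighbouring points overlap, so the value is locally constant along the edge. *)
Lemma side_value_exists K e d : lconst K -> d = dir e \/ d = - dir e ->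
  exists v, side_value K e d v.
Proof.
move=> lK dE.
have d0 : det2 d (rot2 d) > 0.
  by rewrite det2_rot2 dot2_gt0//; case: dE => ->; rewrite ?oppr_eq0 dir_neq0.
have detd x : det2 d x = 0 -> det2 (dir e) x = 0.
  by case: dE => ->//; rewrite det2Nl => /eqP; rewrite oppr_eq0 => /eqP.
have detdir t : det2 d (t *: dir e) = 0.
  by case: dE => ->; rewrite ?det2Nl det2Zr det2xx mulr0 ?oppr0.
pose half t r : set R2 := [set x | `|sh e t - x| < r /\ 0 < det2 d (x - sh e t)].
have chalf t r : convex_set (half t r).
  move=> x y s [xr xd] [yr yd] s01; split; first exact: ball_convex.
  have -> : x + s *: (y - x) - sh e t = (1 - s) *: (x - sh e t) + s *: (y - sh e t).
    have -> : y - x = (y - sh e t) - (x - sh e t) by rewrite opprB addrA subrK.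
    by rewrite scalerBr scalerBl scale1r addrAC [RHS]addrAC -!addrA; congr (_ + (_ + _)); rewrite addrC.
  rewrite det2Dr !det2Zr; have /andP[s0 s1] := s01.
  have [->|s_neq0] := eqVneq s 0; first by rewrite subr0 mul1r mul0r addr0.
  have s_gt0 : 0 < s by rewrite lt_neqAle eq_sym s_neq0.
  apply: ltr_wpDl; last exact: mulr_gt0.
  by apply: mulr_ge0; [rewrite subr_ge0|exact: ltW].
have goodr t : 0 < t < 1 -> exists2 r : R, 0 < r & forall p, half t r p -> ~ shade D p.
  move=> t01; have [r r0 H] := (near_norm _ _).1 (near_inner wfD e t01).
  exists r => // p [pr pd] [e' [u [u01 E]]].
  have [/(_ e' u u01 E)[ee' u01'] _] := H p pr.
  by move: pd; rewrite -E ee' shB detdir ltxx.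
have hne t r : 0 < r -> exists x, half t r x.
  move=> r0; have [|k k0 /(_ k)] := @near_push _ (sh e t) (rot2 d) (fun x => `|sh e t - x| < r).
    by apply/near_norm; exists r.
  rewrite k0 lexx => /(_ isT) H; exists (sh e t + k *: rot2 d); split=> //.
  by rewrite addrAC subrr add0r det2Zr mulr_gt0.
have /choice[v vP] t : exists v, 0 < t < 1 -> \forall x \near sh e t,
    0 < det2 d (x - sh e t) -> K x = v.
  have [t01|nt] := pselect (0 < t < 1); last by exists (K (sh e t)).
  have [r r0 rP] := goodr t t01; have [x0 x0P] := hne t r r0.
  exists (K x0) => _; apply/near_norm; exists r => // x xr xd.
  by apply: (lconst_convex (@chalf t r) rP).
have lv t : 0 < t < 1 -> \forall u \near t, 0 < u < 1 -> v u = v t.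
  move=> t01; have [r r0 H] := (near_norm _ _).1 (vP t t01).
  have : \forall u \near t, `|sh e t - sh e u| < r.
    have rr : \forall y \near sh e t, `|sh e t - y| < r by apply/near_norm; exists r.
    exact: (continuous_near (@sh_continuous R D e t) rr).
  apply: filterS => u tu u01.
  have ru : \forall y \near sh e u, `|sh e t - y| < r by exact: near_ball_lt.
  have [k k0 /(_ k)] := near_push (rot2 d) (filterI ru (vP u u01)).
  rewrite k0 lexx => /(_ isT)[H1].
  rewrite addrAC subrr add0r det2Zr mulr_gt0// => /(_ isT) <-.
  apply: H => //; rewrite addrAC det2Dr shB detdir add0r det2Zr mulr_gt0//.
exists (v (1 / 2)) => t t01; suff <- : v t = v (1 / 2) by exact: vP.
have h0 : 0 < 1 / 2 :> R by lra.
have h1 : 1 / 2 < 1 :> R by lra.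
have [t0 t1] := andP t01.
pose a := Num.min t (1 / 2); pose b := Num.max t (1 / 2).
apply: (@segment_induction R a b (fun u => v u = v (1 / 2)) _ (1 / 2) t);
  rewrite ?ge_min ?le_max ?lexx ?orbT//.
move=> u /andP[au ub].
have u01 : 0 < u < 1.
  by rewrite (lt_le_trans _ au) ?lt_min ?t0 ?h0// (le_lt_trans ub)// gt_max t1 h1.
apply: filterS (lv u u01) => w H /andP[aw wb]; rewrite H//.
by rewrite (lt_le_trans _ aw) ?lt_min ?t0 ?h0// (le_lt_trans wb)// gt_max t1 h1.
Qed.

End LocallyConstantPlane.
End Generic.

(** * Cyclic order of directions *)

Section Theta.
Variable R : realType.
Local Notation R2 := (R * R)%type.
Implicit Types c d x y : R2.

Definition same_ray c d := det2 c d = 0 /\ 0 < dot2 c d.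

Lemma near_det_gt0 d x : 0 < det2 d x -> \forall y \near x, 0 < det2 d y.
Proof.
rewrite -{1}[x]subr0 => /near_det2_gt0.
by apply: filterS => y; rewrite subr0.
Qed.

Lemma near_det_lt0 d x : det2 d x < 0 -> \forall y \near x, det2 d y < 0.
Proof.
rewrite -{1}[x]subr0 => /near_det2_lt0.
by apply: filterS => y; rewrite subr0.
Qed.

Lemma near_det_sgn d x : det2 d x != 0 ->
  \forall y \near x, (0 < det2 d y) = (0 < det2 d x) /\ (det2 d y < 0) = (det2 d x < 0).
Proof.
case: ltgtP => // h _.
  by apply: filterS (near_det_gt0 h) => y hy; rewrite hy [_ < 0]ltNge ltW.
by apply: filterS (near_det_lt0 h) => y hy; rewrite hy ltNge ltW.
Qed.

Lemma same_ray_scale d x : d != 0 -> same_ray d x -> exists2 k : R, 0 < k & x = k *: d.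
Proof.
move=> d0 [dx dp]; exists (dot2 d x / dot2 d d); last exact: det2_eq0P.
by rewrite divr_gt0// dot2_gt0.
Qed.

Lemma ray_param_opp d x : d != 0 -> x != 0 -> det2 d x = 0 -> ~ same_ray d x ->
  exists2 k : R, 0 < k & x = - k *: d.
Proof.
move=> d0 x0 dx nr; have E := det2_eq0P d0 dx.
exists (- (dot2 d x / dot2 d d)); last by rewrite opprK.
rewrite oppr_gt0 pmulr_llt0 ?invr_gt0 ?dot2_gt0// ltNge le_eqVlt negb_or.
apply/andP; split; last by apply/negP => h; apply: nr.
by apply: contraNneq x0 => h; rewrite E -h mul0r scale0r.
Qed.

Lemma dot2Zr d k x : dot2 d (k *: x) = k * dot2 d x.
Proof. by rewrite /dot2 scaleR2 /=; ring. Qed.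

Lemma dot2Dr d x y : dot2 d (x + y) = dot2 d x + dot2 d y.
Proof. by rewrite /dot2 /=; ring. Qed.

Lemma dot2C x y : dot2 x y = dot2 y x.
Proof. by rewrite /dot2 mulrC [_.2 * _]mulrC. Qed.

Section Cut.
Variables c d : R2.
Hypotheses (c0 : c != 0) (d0 : d != 0) (cd : ~ same_ray c d).

Local Notation theta := (counterclockwise c d).

Lemma thetaE x : theta x = [|| (0 < det2 c d) && (0 < det2 d x),
  (0 < det2 d x) && (det2 c x < 0) | (det2 c x < 0) && (0 < det2 c d)].
Proof. by rewrite /counterclockwise (det2C x c) !oppr_gt0. Qed.

(** As a function of its third argument, [theta] is the indicator of the sector swept
    counterclockwise from [d] to [c]: it jumps up on the ray of [d], down on the ray of [c], and is
    locally constant elsewhere. The next two lemmas describe the jumps. *)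
Lemma near_theta x : x != 0 -> ~ same_ray c x -> ~ same_ray d x ->
  \forall y \near x, theta y = theta x.
Proof.
move=> x0 cx dx; have [A0|A0] := eqVneq (det2 d x) 0.
  have [k k0 xE] := ray_param_opp d0 x0 A0 dx.
  have Bk : det2 c x = - k * det2 c d by rewrite xE det2Zr.
  have cd0 : det2 c d != 0.
    apply/eqP => cd0; have [j j0 dE] := ray_param_opp c0 d0 cd0 cd.
    apply: cx; rewrite xE dE scalerA mulrNN; split; first by rewrite det2Zr det2xx mulr0.
    by rewrite dot2Zr mulr_gt0 ?mulr_gt0// dot2_gt0.
  have B0 : det2 c x != 0 by rewrite Bk mulf_neq0// oppr_eq0 gt_eqF.
  apply: filterS (near_det_sgn B0) => y [_ Ey]; rewrite !thetaE Ey A0 ltxx andbF /=.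
  rewrite Bk mulNr oppr_lt0 pmulr_rgt0//.
  by case: (0 < det2 c d); rewrite ?orbT ?andbF.
have [B0|B0] := eqVneq (det2 c x) 0.
  have [k k0 xE] := ray_param_opp c0 x0 B0 cx.
  have Ak : det2 d x = k * det2 c d by rewrite xE det2Zr (det2C d c) mulrNN.
  apply: filterS (near_det_sgn A0) => y [Ey _]; rewrite !thetaE Ey B0 ltxx /= andbF.
  rewrite Ak pmulr_rgt0//.
  by case: (0 < det2 c d); rewrite ?orbT ?andbF.
apply: filterS2 (near_det_sgn A0) (near_det_sgn B0) => y [Ey _] [_ Ey'].
by rewrite !thetaE Ey Ey'.
Qed.

Lemma near_theta_ray x : same_ray d x -> \forall y \near x, theta y = (0 < det2 d y).
Proof.
move=> /(same_ray_scale d0)[k k0 xE].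
have Bk : det2 c x = k * det2 c d by rewrite xE det2Zr.
have [cd0|cd0] := eqVneq (det2 c d) 0.
  have [j j0 dE] := ray_param_opp c0 d0 cd0 cd.
  apply: near_always => y; rewrite thetaE cd0 ltxx andbF orbF /= dE det2Zl mulNr oppr_gt0.
  by rewrite pmulr_rlt0// andbb.
have B0 : det2 c x != 0 by rewrite Bk mulf_neq0// gt_eqF.
apply: filterS (near_det_sgn B0) => y [_ Ey]; rewrite thetaE Ey Bk pmulr_rlt0//.
by case: ltgtP cd0 => // _ _; rewrite ?andbT ?andbF ?orbF /=.
Qed.

Lemma near_theta_cut x : same_ray c x -> \forall y \near x, theta y = (det2 c y < 0).
Proof.
move=> /(same_ray_scale c0)[k k0 xE].
have Ak : det2 d x = k * - det2 c d by rewrite xE det2Zr (det2C d c).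
have [cd0|cd0] := eqVneq (det2 c d) 0.
  have [j j0 dE] := ray_param_opp c0 d0 cd0 cd.
  apply: near_always => y; rewrite thetaE cd0 ltxx andbF orbF /= dE det2Zl mulNr oppr_gt0.
  by rewrite pmulr_rlt0// andbb.
have A0 : det2 d x != 0 by rewrite Ak mulf_neq0// ?oppr_eq0// gt_eqF.
apply: filterS (near_det_sgn A0) => y [Ey _]; rewrite thetaE Ey Ak pmulr_rgt0// oppr_gt0.
by case: ltgtP cd0 => // _ _; rewrite ?andbT ?andbF ?orbF /=.
Qed.

Lemma thetaZ k x : 0 < k -> theta (k *: x) = theta x.
Proof. by move=> k0; rewrite !thetaE !det2Zr pmulr_rgt0// pmulr_rlt0. Qed.

End Cut.

Lemma counterclockwise_rot x y z : counterclockwise x y z = counterclockwise y z x.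
Proof. by rewrite /counterclockwise orbC -orbA; congr (_ || _); rewrite orbC. Qed.

Lemma counterclockwise_swap x y z : counterclockwise x y z -> ~~ counterclockwise x z y.
Proof.
rewrite /counterclockwise (det2C x z) (det2C z y) (det2C y x).
set p := det2 x y; set q := det2 y z; set r := det2 z x.
rewrite !oppr_gt0; case: (ltgtP 0 p); case: (ltgtP 0 q); case: (ltgtP 0 r) => //=.
Qed.

End Theta.

(** * Local structure at a corner *)

Section Fan.
Variables (R : realType) (D : diagram R).
Hypothesis wfD : wf_diagram D.
Local Notation R2 := (R * R)%type.
Implicit Types (e : edge D) (a b : corner D) (t u : R) (x y : R2).

(* The half-edges: [(e, true)] is the germ of [e] at its source, [(e, false)]
   the one at its target, directed away from the corner. *)
Local Notation ray := (edge D * bool)%type.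
Implicit Types i j : ray.

Definition ray_end i : corner D := if i.2 then src i.1 else tgt i.1.
Definition ray_dir i : R2 := if i.2 then dir i.1 else - dir i.1.
Definition ray_param i t : R := if i.2 then t else 1 - t.
Definition ray_pt i t : R2 := sh i.1 (ray_param i t).
Definition ray_at a i : bool := shadow (ray_end i) == shadow a.

Lemma ray_dir_neq0 i : ray_dir i != 0.
Proof. by case: i => e [] /=; rewrite /ray_dir ?oppr_eq0 dir_neq0. Qed.

Lemma ray_ptE i t : ray_pt i t = shadow (ray_end i) + t *: ray_dir i.
Proof.
case: i => e [] /=; rewrite /ray_pt /ray_end /ray_dir /ray_param /=; first exact: shE.
have -> : sh e (1 - t) = sh e 1 - t *: dir e by rewrite !shE scalerBl addrA.
by rewrite sh1 scalerN.
Qed.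

Lemma ray_pt_at a i t : ray_at a i -> ray_pt i t = shadow a + t *: ray_dir i.
Proof. by move=> /eqP E; rewrite ray_ptE E. Qed.

Lemma ray_param01 i t : 0 < t < 1 -> 0 < ray_param i t < 1.
Proof. by rewrite /ray_param; case: i => e [] //= /andP[? ?]; apply/andP; split; lra. Qed.

Lemma ray_distinct a i j : ray_at a i -> ray_at a j -> i != j ->
  ~ same_ray (ray_dir i) (ray_dir j).
Proof.
move=> ai aj ij /(same_ray_scale (ray_dir_neq0 i))[k k0 E].
(* With this choice both [t] and [t * k] are less than 1, so two rays with the same direction would
   share an inner point of two edges. *)
pose t := 1 / (2 * (1 + k)).
have k1 : 0 < 1 + k by rewrite ltr_pwDl// ltW.
have t01 : 0 < t < 1.
  by rewrite /t divr_gt0 ?mulr_gt0//= ltr_pdivrMr ?mulr_gt0// mul1r; lra.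
have kt01 : 0 < t * k < 1.
  rewrite mulr_gt0//=; last by case/andP: t01.
  by rewrite /t mulrAC mul1r ltr_pdivrMr ?mulr_gt0// mul1r; lra.
have EP : ray_pt j t = ray_pt i (t * k) by rewrite (ray_pt_at _ ai) (ray_pt_at _ aj) E scalerA.
have u01 := ray_param01 i kt01; have v01 := ray_param01 j t01.
have [|ee tt] := @inner_unique _ _ wfD j.1 i.1 _ _ v01 _ EP.
  by case/andP: u01 => ? ?; rewrite !ltW.
have bb : i.2 <> j.2 by move=> bb; move/negP: ij; apply; apply/eqP;
  rewrite [i]surjective_pairing [j]surjective_pairing ee bb.
case: wfD => _ _ /(_ i.1) + _ _; apply.
move: ai aj bb; rewrite /ray_at /ray_end -ee.
by case: i.2; case: j.2 => // /eqP -> /eqP ->.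
Qed.

Lemma near_corner_rays a : \forall x \near shadow a,
  (shade D x -> x = shadow a \/
     exists i t, [/\ ray_at a i, 0 < t < 1 & x = ray_pt i t]) /\
  (forall i, ray_at a i -> same_ray (ray_dir i) (x - shadow a) ->
     exists2 t, 0 < t < 1 & x = ray_pt i t).
Proof.
have H2 : \forall x \near shadow a, forall i : ray,
    dot2 (ray_dir i) (x - shadow a) < dot2 (ray_dir i) (ray_dir i).
  apply: near_all => i.
  have := @lt_nbhsl R (dot2 (ray_dir i) (shadow a - shadow a)) (dot2 (ray_dir i) (ray_dir i)).
  rewrite {1}subrr {1}/dot2 /= !mulr0 addr0 dot2_gt0 ?ray_dir_neq0// => /(_ isT).
  by move/(continuous_near (@dot2_continuous R (ray_dir i) (shadow a) (shadow a))).
apply: filterS2 (near_corner wfD a (@ltr01 R)) H2 => x H1 {}H2; split.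
  case=> e [t [/andP[t0 t1] E]].
  have := H1 e t; rewrite t0 t1 => /(_ isT E); case=> -[Ea te].
    have [t0'|t0'] := eqVneq t 0; first by left; rewrite -E t0' sh0.
    right; exists (e, true), t; rewrite /ray_at /ray_end /= Ea eqxx te andbT.
    by split => //; rewrite lt_neqAle eq_sym t0'.
  have [t0'|t0'] := eqVneq t 1; first by left; rewrite -E t0' sh1.
  right; exists (e, false), (1 - t); rewrite /ray_at /ray_end /= Ea eqxx; split => //.
    have : t < 1 by rewrite lt_neqAle t0'.
    by move: te; rewrite subrr => ? ?; apply/andP; split; lra.
  by rewrite /ray_pt /ray_param /= opprB addrC subrK.
move=> i ai /(same_ray_scale (ray_dir_neq0 i))[k k0 E]; exists k.
  rewrite k0; move: (H2 i); rewrite E dot2Zr -{2}[dot2 _ _]mul1r ltr_pM2r//.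
  exact/dot2_gt0/ray_dir_neq0.
by rewrite (ray_pt_at k ai) -E addrC subrK.
Qed.

Variables (M : zmodType) (K : R2 -> M) (L Rv : edge D -> M).
Hypothesis lK : lconst D K.
Hypothesis KL : forall e, side_value K e (dir e) (L e).
Hypothesis KR : forall e, side_value K e (- dir e) (Rv e).

(** The values of [K] just counterclockwise and just clockwise of a ray. At its target an edge is
    seen backwards, so that its right side is the counterclockwise one. *)
Definition ccwv i := if i.2 then L i.1 else Rv i.1.
Definition cwv i := if i.2 then Rv i.1 else L i.1.
Definition ray_jump i := ccwv i - cwv i.

Lemma near_ray_pt i t : 0 < t < 1 -> \forall x \near ray_pt i t,
  [/\ 0 < det2 (ray_dir i) (x - ray_pt i t) -> K x = ccwv i,
      det2 (ray_dir i) (x - ray_pt i t) < 0 -> K x = cwv i &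
      det2 (ray_dir i) (x - ray_pt i t) = 0 -> shade D x].
Proof.
move=> t01; have u01 := ray_param01 i t01; rewrite /ray_pt.
have H1 := KL i.1 u01; have H2 := KR i.1 u01; have H3 := near_inner wfD i.1 u01.
apply: filterS (filterI H1 (filterI H2 H3)) => x [+ [+ +]].
rewrite /ccwv /cwv /ray_dir; case: i.2; rewrite ?det2Nl ?oppr_gt0 ?oppr_lt0.
  move=> hL hR [_ h0]; split=> // /h0[u /andP[? ?] ->].
  by exists i.1, u; rewrite !ltW.
move=> hL hR [_ h0]; split=> // /eqP; rewrite oppr_eq0 => /eqP/h0[u /andP[? ?] ->].
by exists i.1, u; rewrite !ltW.
Qed.

Lemma near_side (p d : R2) (P : R2 -> Prop) : d != 0 -> (\forall q \near p, P q) ->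
  exists q, [/\ ~ shade D q, P q & 0 < det2 d (q - p)].
Proof.
move=> d0 Pp; have [k k0 /(_ k)] := near_push (rot2 d) (nbhs_interior Pp).
rewrite k0 lexx => /(_ isT) Pq.
have h : 0 < det2 d (p + k *: rot2 d - p).
  by rewrite addrAC subrr add0r det2Zr det2_rot2 mulr_gt0// dot2_gt0.
have [q Nq [Pq' qd]] := shade_generic_dense wfD (filterI Pq (near_det2_gt0 h)).
by exists q.
Qed.

Section FanAt.
Variables (a : corner D) (i1 : ray).
Hypothesis ai1 : ray_at a i1.

Let d1 := ray_dir i1.
Let x0 := shadow a.
(** Subtracting a step function for every ray except [i1] removes the jumps of [K] there, so that
    [F] is constant on a small disc around the corner slit along [i1]. *)
Let F x := K x - \sum_(j | ray_at a j && (j != i1))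
  ray_jump j *+ counterclockwise d1 (ray_dir j) (x - x0).

Let near_shift (P : R2 -> Prop) p : (\forall y \near p - x0, P y) ->
  \forall x \near p, P (x - x0).
Proof.
move=> H; apply: (continuous_near (f := fun x => x - x0) (x := p) (P := P)) => //.
by apply: cvgB; [exact: cvg_id|exact: cvg_cst].
Qed.

Let dist1 j : ray_at a j -> j != i1 -> ~ same_ray d1 (ray_dir j).
Proof. by move=> aj ji; apply: (ray_distinct ai1 aj); rewrite eq_sym. Qed.

Let F_local p : p != x0 -> ~ (det2 d1 (p - x0) = 0 /\ 0 <= dot2 d1 (p - x0)) ->
  (shade D p -> p = x0 \/ exists i t, [/\ ray_at a i, 0 < t < 1 & p = ray_pt i t]) ->
  (forall i, ray_at a i -> same_ray (ray_dir i) (p - x0) ->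
     exists2 t, 0 < t < 1 & p = ray_pt i t) ->
  exists w, \forall q \near p, (~` shade D) q -> F q = w.
Proof.
move=> px0 p1 Hs Hr.
have v0 : p - x0 != 0 by rewrite subr_eq0.
have n1 : ~ same_ray d1 (p - x0) by case=> ? ?; apply: p1; split => //; exact: ltW.
have far j : ray_at a j && (j != i1) -> ~ same_ray (ray_dir j) (p - x0) ->
    \forall q \near p, counterclockwise d1 (ray_dir j) (q - x0) =
      counterclockwise d1 (ray_dir j) (p - x0).
  move=> /andP[aj ji] nj.
  exact: near_shift (near_theta (ray_dir_neq0 i1) (ray_dir_neq0 j) (dist1 aj ji) v0 n1 nj).
have [sp|nsp] := pselect (shade D p); last first.
  exists (F p); have H1 : \forall q \near p, forall j : ray, ray_at a j && (j != i1) ->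
      counterclockwise d1 (ray_dir j) (q - x0) = counterclockwise d1 (ray_dir j) (p - x0).
    apply: near_all => j; have [h|h] := boolP (ray_at a j && (j != i1)); last exact: near_always.
    have : ~ same_ray (ray_dir j) (p - x0).
      move=> sj; apply: nsp; have /andP[aj _] := h.
      have [t t01 ->] := Hr j aj sj; have /andP[? ?] := ray_param01 j t01.
      by exists j.1, (ray_param j t); rewrite !ltW.
    by move=> /(far j h); apply: filterS.
  apply: filterS2 H1 (lK nsp) => q H1 Kq _; rewrite /F Kq; congr (_ - _).
  by apply: eq_bigr => j /H1 ->.
have [|[i [t [ai t01 pE]]]] := Hs sp; first by move/eqP: px0.
have pv : p - x0 = t *: ray_dir i by rewrite pE (ray_pt_at t ai) addrAC subrr add0r.
have /andP[t0 _] := t01.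
have si : same_ray (ray_dir i) (p - x0).
  by rewrite pv; split; rewrite ?det2Zr ?det2xx ?mulr0// dot2Zr mulr_gt0// dot2_gt0// ray_dir_neq0.
have ii1 : i != i1 by apply/eqP => E; apply: n1; rewrite /d1 -E.
exists (cwv i - \sum_(j | ray_at a j && (j != i1) && (j != i))
  ray_jump j *+ counterclockwise d1 (ray_dir j) (p - x0)).
have H1 : \forall q \near p, forall j : ray, ray_at a j && (j != i1) && (j != i) ->
    counterclockwise d1 (ray_dir j) (q - x0) = counterclockwise d1 (ray_dir j) (p - x0).
  apply: near_all => j; have [h|h] := boolP (ray_at a j && (j != i1) && (j != i)); last exact: near_always.
  have /andP[h1 ji] := h; have /andP[aj ji1] := h1.
  have : ~ same_ray (ray_dir j) (p - x0).
    move=> /(same_ray_scale (ray_dir_neq0 j))[k k0 E].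
    have : ray_dir i = (t^-1 * k) *: ray_dir j.
      by rewrite -scalerA -E pv scalerA mulVf ?scale1r// gt_eqF.
    move=> E'; apply: (ray_distinct aj ai ji).
    rewrite E'; split; rewrite ?det2Zr ?det2xx ?mulr0// dot2Zr.
    by rewrite mulr_gt0 ?dot2_gt0 ?ray_dir_neq0// mulr_gt0// invr_gt0.
  by move=> /(far j h1); apply: filterS.
have H2 : \forall q \near p, counterclockwise d1 (ray_dir i) (q - x0) =
    (0 < det2 (ray_dir i) (q - x0)).
  exact: near_shift (near_theta_ray (ray_dir_neq0 i1) (ray_dir_neq0 i) (dist1 ai ii1) si).
have H3 := near_ray_pt i t01; rewrite -pE in H3.
apply: filterS3 H1 H2 H3 => q H1 H2 [H3 H4 H5] Nq.
rewrite /F (bigD1 i)/=; last by rewrite ai ii1.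
rewrite (eq_bigr (fun j => ray_jump j *+ counterclockwise d1 (ray_dir j) (p - x0))); last by move=> j /H1 ->.
rewrite H2 opprD addrA; congr (_ - _).
have detE : det2 (ray_dir i) (q - x0) = det2 (ray_dir i) (q - p).
  by rewrite -(subrK p q) -addrA det2Dr pv det2Zr det2xx mulr0 addr0 addrK.
rewrite detE; have [h|h|h] := ltgtP 0 (det2 (ray_dir i) (q - p)).
- by rewrite H3// mulr1n /ray_jump opprB addrC subrK.
- by rewrite H4// mulr0n subr0.
- by have := H5 (esym h).
Qed.

(** [w] is the constant value of [F] on the slit disc. Each identity evaluates [F] next to a ray:
    just counterclockwise of [i1] all step functions vanish, just clockwise of it they all equal
    1. *)
Lemma fan : exists w, [/\ ccwv i1 = w,
  cwv i1 = w + \sum_(j | ray_at a j && (j != i1)) ray_jump j &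
  forall i, ray_at a i -> i != i1 ->
    cwv i = w + \sum_(j | ray_at a j && (j != i1) && (j != i))
      ray_jump j *+ counterclockwise d1 (ray_dir j) (ray_dir i)].
Proof.
have [r r0 Hr] := (near_norm _ _).1 (near_corner_rays a).
have d10 : 0 < dot2 d1 d1 by apply: dot2_gt0; exact: ray_dir_neq0.
have nearx0 (v : R2) : exists2 k : R, 0 < k <= 1/2 & forall k', 0 < k' <= k -> `|x0 - (x0 + k' *: v)| < r.
  have [|k k0 H] := @near_push R _ x0 v (fun x => `|x0 - x| < r).
    by apply/near_norm; exists r.
  exists (Num.min k (1/2)).
    by rewrite lt_min k0 divr_gt0//= ge_min lexx orbT.
  by move=> k' /andP[k'0]; rewrite le_min => /andP[? _]; apply: H; rewrite k'0.
pose slit p := `|x0 - p| < r /\ ~ (det2 d1 (p - x0) = 0 /\ 0 <= dot2 d1 (p - x0)).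
have slit_local p : slit p -> exists w, \forall q \near p, (~` shade D) q -> F q = w.
  case=> pr pn; have [Hs Hd] := Hr p pr; apply: F_local => //.
  by apply: contra_notN pn => /eqP ->; rewrite subrr /det2 /dot2 /= !mulr0 subr0 addr0.
have [k0 /andP[k00 k01] Hk0] := nearx0 (- d1).
(* The slit disc is star-shaped around [o], which lies opposite to the ray [i1]. *)
pose o := x0 + k0 *: (- d1).
have ov : o - x0 = - k0 *: d1 by rewrite /o addrAC subrr add0r scalerN scaleNr.
have oslit : slit o.
  split; first by apply: Hk0; rewrite k00 lexx.
  rewrite ov dot2Zr mulNr oppr_ge0 => -[_].
  by rewrite leNgt mulr_gt0.
have star p s : slit p -> 0 <= s <= 1 -> slit (o + s *: (p - o)).
  move=> [pr pn] s01; split; first by apply: ball_convex => //; case: oslit.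
  have -> : o + s *: (p - o) - x0 = (1 - s) *: (o - x0) + s *: (p - x0).
    have -> : p - o = (p - x0) - (o - x0) by rewrite opprB addrA subrK.
    by rewrite scalerBr scalerBl scale1r addrAC [RHS]addrAC -!addrA; congr (_ + (_ + _)); rewrite addrC.
  rewrite ov scalerA det2Dr dot2Dr !det2Zr !dot2Zr det2xx mulr0 add0r => -[/eqP].
  have /andP[s0 s1] := s01.
  rewrite mulf_eq0 => /orP[/eqP->|/eqP dp].
    by rewrite subr0 mul1r mul0r addr0 mulNr oppr_ge0 leNgt mulr_gt0.
  move=> h; apply: pn; split=> //.
  have [s00|s00] := eqVneq s 0.
    by move: h; rewrite s00 subr0 mul1r mul0r addr0 mulNr oppr_ge0 leNgt mulr_gt0.
  have sp : 0 < s by rewrite lt_neqAle eq_sym s00.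
  rewrite -(pmulr_rge0 _ sp); apply: le_trans h _.
  rewrite gerDr mulrN mulNr oppr_le0.
  by do 2?apply: mulr_ge0; rewrite ?subr_ge0//; exact: ltW.
have [w Hw] := slit_local o oslit.
have F_slit p : slit p -> \forall q \near p, (~` shade D) q -> F q = w.
  move=> sp; apply: (generic_induction (N := ~` shade D) _ _ Hw).
    by move=> x P; exact: shade_generic_dense.
  by move=> s s01; apply: slit_local; exact: star.
have halfpt (i : ray) : exists t, 0 < t < 1 /\ `|x0 - (x0 + t *: ray_dir i)| < r.
  have [k /andP[k_0 k_1] Hk] := nearx0 (ray_dir i); exists k; split.
    by rewrite k_0 (le_lt_trans k_1)// ltr_pdivrMr// mul1r ltr1n.
  by apply: Hk; rewrite k_0 lexx.
have eval1 (sg : bool) : exists q, [/\ F q = w,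
    K q = if sg then ccwv i1 else cwv i1 & forall j, ray_at a j && (j != i1) ->
      counterclockwise d1 (ray_dir j) (q - x0) = ~~ sg].
  have [t [t01 tr]] := halfpt i1; have pE := ray_pt_at t ai1; have /andP[t0 _] := t01.
  have st : same_ray d1 (ray_pt i1 t - x0).
    by rewrite pE addrAC subrr add0r; split; rewrite ?det2Zr ?det2xx ?mulr0// dot2Zr mulr_gt0.
  have H1 : \forall q \near ray_pt i1 t, forall j : ray, ray_at a j && (j != i1) ->
      counterclockwise d1 (ray_dir j) (q - x0) = (det2 d1 (q - x0) < 0).
    apply: near_all => j; have [/andP[aj ji]|h] := boolP (ray_at a j && (j != i1)); last exact: near_always.
    have := near_shift (near_theta_cut (ray_dir_neq0 i1) (ray_dir_neq0 j) (dist1 aj ji) st).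
    exact: filterS.
  have H2 : \forall q \near ray_pt i1 t, `|x0 - q| < r by apply: near_ball_lt; rewrite pE.
  have s0 : (if sg then d1 else - d1) != 0 by case: sg; rewrite ?oppr_eq0 ray_dir_neq0.
  have [q [Nq [{}H1 [{}H2 [H3 H4 _]]] dq]] :=
    near_side s0 (filterI H1 (filterI H2 (near_ray_pt i1 t01))).
  have dE : det2 d1 (q - x0) = det2 d1 (q - ray_pt i1 t).
    by rewrite pE opprD !det2Dr !det2Nr det2Zr det2xx mulr0 oppr0 addr0.
  have sq : slit q.
    split=> // -[E _]; move: dq; rewrite -dE in H3 H4 *.
    by case: sg {s0}; rewrite ?det2Nl -?dE E ?oppr0 ltxx.
  have /nbhs_singleton Fq := F_slit q sq; exists q; split; first exact: Fq.
    by case: sg {s0} dq => h; [exact: H3|apply: H4; move: h; rewrite det2Nl oppr_gt0].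
  move=> j /H1 ->; rewrite dE; case: sg {s0} dq => h /=; first by rewrite ltNge ltW.
  by move: h; rewrite det2Nl oppr_gt0.
exists w; split.
- have [q [<- <- th]] := eval1 true; rewrite /F big1 ?subr0// => j jP.
  by rewrite th// mulr0n.
- have [q [<- <- th]] := eval1 false; rewrite /F.
  rewrite [X in _ - X + _](eq_bigr ray_jump) ?subrK// => j jP.
  by rewrite th// mulr1n.
- move=> i ai ii1.
  have [t [t01 tr]] := halfpt i; have pE := ray_pt_at t ai; have /andP[t0 _] := t01.
  have pv : ray_pt i t - x0 = t *: ray_dir i by rewrite pE addrAC subrr add0r.
  have sp : slit (ray_pt i t).
    split; first by rewrite pE.
    rewrite pv det2Zr dot2Zr => -[/eqP]; rewrite mulf_eq0 gt_eqF//= => /eqP E.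
    rewrite pmulr_rge0// le_eqVlt => /orP[/eqP E'|E']; last exact: (dist1 ai ii1).
    move/negP: (ray_dir_neq0 i); apply.
    by rewrite (det2_eq0P (ray_dir_neq0 i1) E) -/d1 -E' mul0r scale0r.
  have s0 : - ray_dir i != 0 by rewrite oppr_eq0 ray_dir_neq0.
  have si : same_ray (ray_dir i) (ray_pt i t - x0).
    by rewrite pv; split; rewrite ?det2Zr ?det2xx ?mulr0// dot2Zr mulr_gt0// dot2_gt0// ray_dir_neq0.
  have v0 : ray_pt i t - x0 != 0 by rewrite pv scaler_eq0 negb_or gt_eqF//= ray_dir_neq0.
  have n1 : ~ same_ray d1 (ray_pt i t - x0).
    by case: sp => _ sp [? ?]; apply: sp; split => //; exact: ltW.
  have H1 : \forall q \near ray_pt i t, forall j : ray, ray_at a j && (j != i1) && (j != i) ->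
      counterclockwise d1 (ray_dir j) (q - x0) = counterclockwise d1 (ray_dir j) (ray_dir i).
    apply: near_all => j; have [/andP[/andP[aj ji1] ji]|h] := boolP (_ && _); last exact: near_always.
    have nj : ~ same_ray (ray_dir j) (ray_pt i t - x0).
      rewrite pv => -[]; rewrite det2Zr dot2Zr => /eqP.
      rewrite mulf_eq0 gt_eqF//= => /eqP E; rewrite pmulr_rgt0// => E'.
      exact: (ray_distinct aj ai ji).
    have := near_shift (near_theta (ray_dir_neq0 i1) (ray_dir_neq0 j) (dist1 aj ji1) v0 n1 nj).
    by apply: filterS => q -> _; rewrite pv thetaZ.
  have H2 := near_shift (near_theta_ray (ray_dir_neq0 i1) (ray_dir_neq0 i) (dist1 ai ii1) si).
  have [q [Nq [{}H1 [H2' [Fq [_ H3 _]]]] dq]] :=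
    near_side s0 (filterI H1 (filterI H2 (filterI (F_slit _ sp) (near_ray_pt i t01)))).
  have dq' : det2 (ray_dir i) (q - ray_pt i t) < 0 by move: dq; rewrite det2Nl oppr_gt0.
  have dq0 : det2 (ray_dir i) (q - x0) < 0.
    by move: dq'; rewrite pE opprD !det2Dr !det2Nr det2Zr det2xx mulr0 oppr0 addr0.
  rewrite -(Fq Nq) /F (bigD1 i)/=; last by rewrite ai ii1.
  rewrite H2' [0 < _]ltNge ltW//= mulr0n add0r (H3 dq').
  rewrite [X in _ - X + _](eq_bigr (fun j => ray_jump j *+ counterclockwise d1 (ray_dir j) (ray_dir i))) ?subrK//.
  by move=> j /H1 ->.
Qed.

End FanAt.

(* No ray lies strictly between [i] and [j], so the same region is just
   counterclockwise of [i] and just clockwise of [j]. *)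
Lemma fan_adjacent a i j : ray_at a i -> ray_at a j -> j != i ->
  (forall k, ray_at a k -> k != i -> k != j ->
     ~~ counterclockwise (ray_dir i) (ray_dir k) (ray_dir j)) ->
  ccwv i = cwv j.
Proof.
move=> ai aj ji nk; have [w [-> _ /(_ j aj ji)->]] := fan ai.
by rewrite big1 ?addr0// => k /andP[/andP[ak ki] kj]; rewrite (negbTE (nk k ak ki kj)).
Qed.

(** In a full turn around the corner the jumps add up to zero; an edge that ends there is seen with
    the opposite sign. Both strands of a crossing enter the same sum. *)
Lemma fan_conservation a :
  \sum_(e | shadow (src e) == shadow a) (L e - Rv e) =
  \sum_(e | shadow (tgt e) == shadow a) (L e - Rv e).
Proof.
have H : \sum_(i | ray_at a i) ray_jump i = 0.
  have [/existsP[i1 ai1]|] := boolP [exists i, ray_at a i].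
    have [w [E1 E2 _]] := fan ai1; rewrite (bigD1 i1)//= {1}/ray_jump E1 E2.
    by rewrite opprD addrA subrr add0r addNr.
  by rewrite negb_exists => /forallP h; rewrite big1// => i ai; have := h i; rewrite ai.
have E : \sum_(i | ray_at a i) ray_jump i =
    \sum_(e | shadow (src e) == shadow a) (L e - Rv e) -
    \sum_(e | shadow (tgt e) == shadow a) (L e - Rv e).
  rewrite big_mkcond -(pair_bigA _ (fun e (b : bool) => if ray_at a (e, b) then ray_jump (e, b) else 0)) /=.
  rewrite [X in _ = X - _]big_mkcond [X in _ = _ - X]big_mkcond -sumrB; apply: eq_bigr => e _.
  rewrite big_bool /ray_at /ray_jump /ray_end /ccwv /cwv /=; congr (_ + _).
  by case: ifP => _; rewrite ?oppr0// opprB.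
by apply/eqP; rewrite -subr_eq0 -E H.
Qed.

End Fan.

(** * Jumps with a prescribed conserved value *)

Section Potential.
Variables (R : realType) (D : diagram R).
Hypothesis wfD : wf_diagram D.
Local Notation R2 := (R * R)%type.
Implicit Types (e : edge D) (a b : corner D) (t u : R) (x y p : R2).
Variables (M : zmodType) (beta : edge D -> M).

Definition conserved := forall a : corner D,
  \sum_(e | shadow (src e) == shadow a) beta e =
  \sum_(e | shadow (tgt e) == shadow a) beta e.

Hypothesis cons : conserved.

Lemma conserved_pred (Q : R2 -> bool) :
  \sum_(e | Q (shadow (src e))) beta e = \sum_(e | Q (shadow (tgt e))) beta e.
Proof.
(* [conserved] concerns all corners with a given shadow together, so one representative per shadow
   is chosen in order to count a crossing once. *)
pose rep a := odflt a [pick b | shadow b == shadow a].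
have repE a : shadow (rep a) = shadow a.
  by rewrite /rep; case: pickP => //= b /eqP.
have rep_eq a b : shadow a = shadow b -> rep a = rep b.
  move=> E; rewrite /rep.
  have -> : [pick d : corner D | shadow d == shadow a] = [pick d : corner D | shadow d == shadow b].
    by apply: eq_pick => d; rewrite E.
  by case: pickP => //= /(_ b); rewrite eqxx.
have H (f : edge D -> corner D) : \sum_(e | Q (shadow (f e))) beta e =
    \sum_(a | Q (shadow a) && (rep a == a)) \sum_(e | shadow (f e) == shadow a) beta e.
  rewrite (partition_big (fun e => rep (f e)) (fun a => Q (shadow a) && (rep a == a))) /=.
    apply: eq_bigr => a /andP[Qa /eqP ra]; apply: eq_bigl => e.
    apply/andP/eqP => [[_ /eqP <-]|E]; first by rewrite repE.
    by rewrite E Qa (rep_eq _ _ E) ra.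
  by move=> e Qe; rewrite repE Qe /=; apply/eqP/rep_eq.
by rewrite !H; apply: eq_bigr => a _; exact: cons.
Qed.

Variable c : R2.
Hypothesis gc : forall e, det2 c (dir e) != 0.

(* The value at [x] is obtained by letting the half-line from [x] in direction
   [- c] cross the edges. *)
Let g (y x : R2) : bool := det2 c y <= det2 c x.
Let above e x : bool := 0 < det2 (dir e) (x - shadow (src e)) * det2 (dir e) c.

Definition potential x : M :=
  \sum_e (beta e *+ (g (shadow (tgt e)) x && above e x) -
          beta e *+ (g (shadow (src e)) x && above e x)).

Let c0 e : c != 0.
Proof. by apply: contraNneq (gc e) => ->; rewrite /det2 /= !mul0r subrr. Qed.

Let tgtE e : shadow (tgt e) = shadow (src e) + dir e.
Proof. by rewrite /dir addrC subrK. Qed.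

Let gE y x : g y x = (det2 c (y - x) <= 0).
Proof. by rewrite /g det2Br subr_le0. Qed.

Let near_g y p : det2 c y != det2 c p -> \forall x \near p, g y x = g y p.
Proof.
rewrite /g neq_lt => /orP[] h.
  have h' : 0 < det2 c (p - y) by rewrite det2Br subr_gt0.
  by apply: filterS (near_det2_gt0 h') => x; rewrite det2Br subr_gt0 => /ltW ->; rewrite ltW.
have h' : det2 c (p - y) < 0 by rewrite det2Br subr_lt0.
by apply: filterS (near_det2_lt0 h') => x; rewrite det2Br subr_lt0 !leNgt h => ->.
Qed.

Let near_above e p : det2 (dir e) (p - shadow (src e)) != 0 ->
  \forall x \near p, above e x = above e p.
Proof.
have d0 : det2 (dir e) c != 0 by rewrite det2C oppr_eq0.
rewrite /above neq_lt => /orP[] h.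
  by apply: filterS (near_det2_lt0 h) => x hx; rewrite !nmulr_rgt0.
by apply: filterS (near_det2_gt0 h) => x hx; rewrite !pmulr_rgt0.
Qed.

Let inner e p : Prop := exists t, 0 < t < 1 /\ p = sh e t.

(** The half-line from [p] may run into corners, where single terms of the sum are discontinuous.
    The expansion drops the corners on the line through [p] along [c]; only an edge through [p]
    itself still depends on [x]. *)
Let near_potential p : (forall a, shadow a != p) ->
  \forall x \near p, potential x = \sum_e
    (beta e *+ [&& det2 c (shadow (tgt e)) != det2 c p, g (shadow (tgt e)) p &
                   if `[< inner e p >] then above e x else above e p] -
     beta e *+ [&& det2 c (shadow (src e)) != det2 c p, g (shadow (src e)) p &
                   if `[< inner e p >] then above e x else above e p]).
Proof.
move=> pc.
(* [Z] selects the corners on the half-line. The edges at them switch simultaneously when [x] leaves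
   [p], with total 0 by conservation. *)
pose Z y := (det2 c y == det2 c p) && (0 < dot2 c (p - y)).
have zero (b : bool) : \sum_e (beta e *+ (Z (shadow (tgt e)) && b) -
    beta e *+ (Z (shadow (src e)) && b)) = 0.
  rewrite sumrB; case: b; last by rewrite !big1 ?subr0// => e _; rewrite andbF.
  rewrite (eq_bigr (fun e => if Z (shadow (tgt e)) then beta e else 0)); last first.
    by move=> e _; rewrite andbT; case: (Z _).
  rewrite [X in _ - X](eq_bigr (fun e => if Z (shadow (src e)) then beta e else 0)); last first.
    by move=> e _; rewrite andbT; case: (Z _).
  by rewrite -!big_mkcond /= (conserved_pred Z) subrr.
(* An edge with an end on the line through [p] passes on the far side of [p] or on the half-line
   according to the position of that end. *)
have upE e y : (y = shadow (src e) \/ y = shadow (tgt e)) -> det2 c y = det2 c p ->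
    above e p = (0 < dot2 c (p - y)) /\ det2 (dir e) (p - shadow (src e)) != 0.
  move=> ye yp; have d0 : det2 (dir e) c != 0 by rewrite det2C oppr_eq0.
  have E0 : det2 c (p - y) = 0 by rewrite det2Br yp subrr.
  have E := det2_eq0P (c0 e) E0.
  have E1 : det2 (dir e) (p - shadow (src e)) = det2 (dir e) (p - y).
    by case: ye => ->//; rewrite tgtE opprD addrA [RHS]det2Br det2xx subr0.
  have py : p - y != 0.
    by rewrite subr_eq0; case: ye => ->; rewrite eq_sym.
  have cc : 0 < dot2 c c by exact/dot2_gt0/c0.
  have k0 : dot2 c (p - y) / dot2 c c != 0.
    by apply: contraNneq py => k0; rewrite E k0 scale0r.
  rewrite /above E1 E det2Zr; split; last by rewrite mulf_neq0.
  have dd : 0 < det2 (dir e) c * det2 (dir e) c by rewrite -expr2 exprn_even_gt0.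
  by rewrite -mulrA pmulr_lgt0// pmulr_lgt0 ?invr_gt0// -E.
have lineE e : det2 (dir e) (p - shadow (src e)) = 0 ->
    exists2 t, p = sh e t & forall u, det2 c (sh e u) - det2 c p = (u - t) * det2 c (dir e).
  move=> /(det2_eq0P (dir_neq0 wfD e)) E.
  have pE : p = sh e (dot2 (dir e) (p - shadow (src e)) / dot2 (dir e) (dir e)).
    by rewrite shE -E addrC subrK.
  by eexists; first exact: pE; move=> u; rewrite {1}pE -det2Br shB det2Zr.
have innerP e : inner e p -> det2 (dir e) (p - shadow (src e)) = 0 /\
    (forall y, (y = shadow (src e) \/ y = shadow (tgt e)) -> det2 c y != det2 c p).
  move=> [t [/andP[t0 t1] ->]]; split.
    by rewrite shE addrAC subrr add0r det2Zr det2xx mulr0.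
  move=> y ye; rewrite -subr_eq0 -det2Br.
  case: ye => ->; rewrite -?sh0 -?sh1 shB det2Zr mulf_neq0//.
    by rewrite sub0r oppr_eq0 gt_eqF.
  by rewrite subr_eq0 gt_eqF.
have near_all_terms : \forall x \near p, forall e,
    beta e *+ (g (shadow (tgt e)) x && above e x) - beta e *+ (g (shadow (src e)) x && above e x) =
    (beta e *+ [&& det2 c (shadow (tgt e)) != det2 c p, g (shadow (tgt e)) p &
                   if `[< inner e p >] then above e x else above e p] -
     beta e *+ [&& det2 c (shadow (src e)) != det2 c p, g (shadow (src e)) p &
                   if `[< inner e p >] then above e x else above e p]) +
    (beta e *+ (Z (shadow (tgt e)) && (det2 c p <= det2 c x)) -
    beta e *+ (Z (shadow (src e)) && (det2 c p <= det2 c x))).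
  apply: near_all => e.
  have G y : \forall x \near p, g y x = if det2 c y == det2 c p then det2 c p <= det2 c x
      else g y p.
    have [E|E] := eqVneq (det2 c y) (det2 c p); last exact: near_g.
    by apply: near_always => x; rewrite /g E.
  have [d0|d0] := eqVneq (det2 (dir e) (p - shadow (src e))) 0; last first.
    have ni : `[< inner e p >] = false.
      by apply/asboolP => /innerP[E _]; rewrite E eqxx in d0.
    apply: filterS3 (G (shadow (src e))) (G (shadow (tgt e))) (near_above d0) => x -> -> ->.
    rewrite ni /Z; case: eqVneq => [E|_] /=; case: eqVneq => [E'|_] /=;
      rewrite ?andbF ?mulr0n ?addr0 ?add0r ?subr0 //.
    - rewrite -(@upE e _ (or_intror erefl) E).1 -(@upE e _ (or_introl erefl) E').1.
      by rewrite oppr0 add0r ![_ && above e p]andbC.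
    - by rewrite -(@upE e _ (or_intror erefl) E).1 [RHS]addrC [(det2 c p <= _) && above e p]andbC.
    - by rewrite -(@upE e _ (or_introl erefl) E').1 [(det2 c p <= _) && above e p]andbC.
  have [t pE tP] := lineE e d0.
  have Zs y : (y = shadow (src e) \/ y = shadow (tgt e)) -> det2 c y != det2 c p.
    move=> ye; apply/eqP => E; have [_] := upE e y ye E; rewrite d0 eqxx; exact/negP.
  apply: filterS2 (G (shadow (src e))) (G (shadow (tgt e))) => x -> ->.
  have s0 := Zs _ (or_introl erefl); have t0 := Zs _ (or_intror erefl).
  rewrite /Z (negbTE s0) (negbTE t0) /= subrr addr0.
  case: asboolP => // ni.
  suff -> : g (shadow (tgt e)) p = g (shadow (src e)) p by rewrite !subrr.
  rewrite !gE -sh0 -sh1 !det2Br !tP sub0r.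
  have t_neq0 : t != 0.
    by apply: contra_neq (pc (src e)) => t00; rewrite pE t00 sh0.
  have t_neq1 : t != 1.
    by apply: contra_neq (pc (tgt e)) => t11; rewrite pE t11 sh1.
  have [tl|tl] := ltP 0 t; last first.
    have tl' : t < 0 by rewrite lt_neqAle t_neq0.
    by rewrite !pmulr_rle0 ?oppr_gt0//; lra.
  have [tu|tu] := ltP t 1; first by case: ni; exists t; rewrite tl tu.
  have tu' : 1 < t by rewrite lt_neqAle eq_sym t_neq1.
  by rewrite !nmulr_rle0 ?oppr_lt0//; lra.
apply: filterS near_all_terms => x H; rewrite /potential (eq_bigr _ (fun e _ => H e)).
by rewrite big_split /= zero addr0.
Qed.

Lemma potential_lconst : lconst D potential.
Proof.
move=> p sp; have pc a : shadow a != p.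
  by apply/eqP => E; apply: sp; rewrite -E; exact: shade_shadow.
have ni e : `[< inner e p >] = false.
  apply/asboolP => -[t [/andP[t0 t1] E]]; apply: sp; exists e, t.
  by rewrite !ltW.
have H := near_potential pc; have /nbhs_singleton Hp := H.
by apply: filterS H => x ->; rewrite Hp; apply: eq_bigr => e _; rewrite ni.
Qed.

(** At the midpoint of [e] the terms of all other edges agree on both sides, so the difference of
    the two values is the term of [e]. *)
Lemma potential_jump e l r : side_value potential e (dir e) l ->
  side_value potential e (- dir e) r -> l - r = beta e.
Proof.
move=> hl hr.
have h01 : 0 < (1 / 2 : R) < 1 by rewrite divr_gt0//= ltr_pdivrMr// mul1r ltr1n.
set p := sh e (1 / 2) in hl hr *.
have pc a : shadow a != p by apply/eqP => /esym; exact: inner_neq_shadow.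
have d0 := dir_neq0 wfD e; have d0' : - dir e != 0 by rewrite oppr_eq0.
have [x [_ [Hx /(_ _)Kx] dx]] := near_side wfD d0 (filterI (near_potential pc) (hl _ h01)).
have [y [_ [Hy /(_ _)Ky] dy]] := near_side wfD d0' (filterI (near_potential pc) (hr _ h01)).
rewrite -(Kx dx) -(Ky dy) Hx Hy -sumrB (bigD1 e)//= big1 ?addr0; last first.
  move=> e' e'e; suff -> : `[< inner e' p >] = false by rewrite subrr.
  apply/asboolP => -[t [t01 E]].
  have [|ee _] := inner_unique wfD h01 _ E; first by case/andP: t01 => ? ?; rewrite !ltW.
  by rewrite ee eqxx in e'e.
have -> : `[< inner e p >] by apply/asboolP; exists (1 / 2).
have srcE z : det2 (dir e) (z - shadow (src e)) = det2 (dir e) (z - p).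
  by rewrite /p shE opprD !det2Dr !det2Nr det2Zr det2xx mulr0 oppr0 addr0.
have dc : det2 c (dir e) = - det2 (dir e) c by rewrite det2C.
have d0c : det2 (dir e) c != 0 by rewrite -oppr_eq0 -dc.
have gt : g (shadow (tgt e)) p = (0 < det2 (dir e) c).
  rewrite gE -sh1 shB det2Zr dc mulrN oppr_le0 pmulr_rge0; last by lra.
  by rewrite le_eqVlt eq_sym (negbTE d0c).
have gs : g (shadow (src e)) p = (det2 (dir e) c < 0).
  rewrite gE -sh0 shB det2Zr dc mulrN sub0r mulNr opprK pmulr_rle0; last by lra.
  by rewrite le_eqVlt (negbTE d0c).
have st : (det2 c (shadow (tgt e)) != det2 c p) && (det2 c (shadow (src e)) != det2 c p).
  rewrite -subr_eq0 -[_ == det2 c p]subr_eq0 -!det2Br -sh0 -sh1 !shB !det2Zr.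
  by rewrite !mulf_neq0//; [lra|lra].
have /andP[-> ->] := st; rewrite gt gs /above !srcE /=.
move: dx dy; rewrite det2Nl oppr_gt0 => dx dy.
have nx : (det2 (dir e) (x - p) < 0) = false by rewrite ltNge ltW.
have ny : (0 < det2 (dir e) (y - p)) = false by rewrite ltNge ltW.
case: (ltgtP (det2 (dir e) c) 0) d0c => // h _; rewrite /=.
  by rewrite !nmulr_lgt0// dy nx !mulr0n mulr1n !sub0r oppr0 sub0r opprK.
by rewrite !pmulr_lgt0// dx ny !mulr0n mulr1n !subr0.
Qed.

Lemma shade_bounded : exists B : R, forall x, shade D x -> `|x| <= B.
Proof.
exists (\sum_(a : corner D) `|shadow a| + \sum_(a : corner D) `|shadow a|).
have H a : `|shadow a| <= \sum_(b : corner D) `|shadow b|.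
  by rewrite (bigD1 a)//= lerDl sumr_ge0.
move=> x [e [t [/andP[t0 t1] <-]]].
have -> : sh e t = (1 - t) *: shadow (src e) + t *: shadow (tgt e).
  by rewrite shE /dir scalerBr scalerBl scale1r addrCA addrC -addrA.
apply: le_trans (ler_normD _ _) _; rewrite !normrZ (ger0_norm t0) ger0_norm ?subr_ge0//.
apply: lerD; [apply: le_trans (H (src e))|apply: le_trans (H (tgt e))]; rewrite ler_piMl//.
by lra.
Qed.

(** Outside a ball that contains the shadow, the edges met by the line through [x] along [c] all lie
    on one side of [x]. The half-line meets either none of them or all of them; in the second case
    conservation makes the sum 0. *)
Lemma potential_bounded : exists B : R, forall x, B < `|x| -> potential x = 0.
Proof.
have [B HB] := shade_bounded; exists B => x xB.
have cross e : g (shadow (tgt e)) x != g (shadow (src e)) x ->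
    exists t, 0 <= t <= 1 /\ exists k : R, x = sh e t + k *: c /\ above e x = (0 < k).
  move=> gx; have dc0 := gc e.
  pose t := det2 c (x - shadow (src e)) / det2 c (dir e); exists t.
  have Ec : det2 c (x - sh e t) = 0.
    by rewrite shE opprD addrA det2Br det2Zr /t divfK// subrr.
  split; last first.
    exists (dot2 c (x - sh e t) / dot2 c c); rewrite -(det2_eq0P (c0 e) Ec) addrC subrK.
    split=> //; have E : det2 (dir e) (x - shadow (src e)) = det2 (dir e) (x - sh e t).
      by rewrite shE opprD !det2Dr !det2Nr det2Zr det2xx mulr0 oppr0 addr0.
    rewrite /above E {1}(det2_eq0P (c0 e) Ec) det2Zr -mulrA pmulr_lgt0//.
    by rewrite -expr2 exprn_even_gt0//= det2C oppr_eq0.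
  move: gx; rewrite !gE -opprB det2Nr oppr_le0 -[shadow (src e) - x]opprB det2Nr oppr_le0.
  have -> : x - shadow (tgt e) = x - shadow (src e) - dir e by rewrite tgtE opprD addrA.
  rewrite det2Br /t; set u := det2 c (x - _); set v := det2 c (dir e) in dc0 *.
  case: (ltgtP v 0) dc0 => // v0 _.
    rewrite ler_ndivlMr// ler_ndivrMr// mul0r mul1r subr_ge0.
    by case: (leP v u) => a; case: (leP 0 u) => b //= _; lra.
  rewrite ler_pdivlMr// ler_pdivrMr// mul0r mul1r subr_ge0.
  by case: (leP v u) => a; case: (leP 0 u) => b //= _; lra.
have [/existsP[e1 /andP[e1x e1a]]|] := boolP [exists e,
    (g (shadow (tgt e)) x != g (shadow (src e)) x) && above e x].
  have [/existsP[e2 /andP[e2x e2a]]|] := boolP [exists e,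
      (g (shadow (tgt e)) x != g (shadow (src e)) x) && ~~ above e x].
    exfalso; have [t [t01 [k [xE ak]]]] := cross e1 e1x.
    have [u [u01 [l [xE' al]]]] := cross e2 e2x.
    rewrite e1a in ak; rewrite al -leNgt in e2a; move/esym: ak => k0.
    have kl : 0 < k - l by lra.
    have s1 : `|sh e1 t| <= B by apply: HB; exists e1, t.
    have s2 : `|sh e2 u| <= B by apply: HB; exists e2, u.
    (* [x] is a convex combination of two points of the shadow, hence in the ball. *)
    have E : (k - l) *: x = (- l) *: sh e1 t + k *: sh e2 u.
      move: (sh e1 t) (sh e2 u) xE xE' => y1 y2 xE xE'.
      rewrite scalerBl {1}xE' xE !scalerDr !scalerA [k * l]mulrC opprD.
      by rewrite addrACA subrr addr0 addrC scaleNr.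
    have : (k - l) * `|x| <= (k - l) * B.
      rewrite -{1}(gtr0_norm kl) -normrZ E; apply: le_trans (ler_normD _ _) _.
      rewrite !normrZ normrN (ler0_norm e2a) (gtr0_norm k0) mulrBl addrC.
      by apply: lerD; [rewrite ler_pM2l|rewrite -mulNr ler_wpM2l ?oppr_ge0].
    by rewrite ler_pM2l// leNgt xB.
  rewrite negb_exists => /forallP h.
  rewrite /potential (eq_bigr (fun e => (if g (shadow (tgt e)) x then beta e else 0) -
      (if g (shadow (src e)) x then beta e else 0))); last first.
    move=> e _; have := h e; rewrite negb_and !negbK => /orP[/eqP ->|->].
      by rewrite !subrr.
    by rewrite !andbT; case: (g _ x); case: (g _ x).
  by rewrite sumrB -!big_mkcond /= (conserved_pred (g ^~ x)) subrr.
rewrite negb_exists => /forallP h; rewrite /potential big1// => e _.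
have := h e; rewrite negb_and negbK => /orP[/eqP ->|/negbTE ->]; first by rewrite subrr.
by rewrite !andbF subrr.
Qed.

End Potential.

(** * The bundle of a planar function *)

Section Bundle.
Variables (R : realType) (D : diagram R).
Hypothesis wfD : wf_diagram D.
Local Notation R2 := (R * R)%type.
Local Notation R3 := (R * R * R)%type.
Implicit Types (e : edge D) (a b : corner D) (t u h : R) (x y : R2) (q : R3).

Definition lies_over e t x := 0 <= t <= 1 /\ sh e t = x.

Definition above_spine q := exists e t, lies_over e t q.1 /\ ht e t < q.2.
Definition below_spine q := exists e t, lies_over e t q.1 /\ q.2 < ht e t.

Lemma over_unique e t u x : lies_over e t x -> lies_over e u x -> t = u.
Proof. by move=> [_ <-] [_ /(sh_inj wfD)]. Qed.

Lemma spine_over q : spine D q <-> exists e t, lies_over e t q.1 /\ ht e t = q.2.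
Proof.
split=> [[e [t [t01 ->]]]|[e [t [[t01 E] E']]]].
  by exists e, t; rewrite edge_pointE.
by exists e, t; split=> //; rewrite edge_pointE E E' -surjective_pairing.
Qed.

Lemma over_cases e t x : lies_over e t x ->
  0 < t < 1 \/ exists c, [/\ incident e c, shadow c = x, height c = ht e t & t = 0 \/ t = 1].
Proof.
move=> [/andP[t0 t1] <-].
have [->|t_neq0] := eqVneq t 0.
  by right; exists (src e); rewrite /incident eqxx sh0 ht0; split=> //; left.
have [->|t_neq1] := eqVneq t 1.
  by right; exists (tgt e); rewrite /incident eqxx orbT sh1 ht1; split=> //; right.
by left; rewrite !lt_neqAle t0 t1 eq_sym t_neq0 t_neq1.
Qed.

(** Different edges over the same point of the plane can only have ends there, so a point between
    them lies between the two strands of a crossing, and every edge over it ends at one of the two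
    corners. *)
Lemma between_crossing q : above_spine q -> below_spine q -> exists a b,
  [/\ passes_over a b, shadow a = q.1 /\ shadow b = q.1, height b < q.2 < height a &
      forall e t, lies_over e t q.1 -> exists2 c, incident e c &
        [/\ shadow c = q.1, height c = ht e t, (t = 0 \/ t = 1) & c = a \/ c = b]].
Proof.
move=> [e [t [o hl]]] [e' [t' [o' hr]]].
have ne : e <> e'.
  by move=> ee; rewrite -ee in o' hr; move: (lt_trans hl hr); rewrite (over_unique o o') ltxx.
have [h1 h2] : (t = 0 \/ t = 1) /\ (t' = 0 \/ t' = 1).
  case: wfD => _ _ _ /(_ e e' t t' ne) H _; case: o => t01 E; case: o' => t01' E'.
  by apply: H => //; rewrite -/(sh e t) -/(sh e' t') E E'.
have nin (s : R) : (s = 0 \/ s = 1) -> ~ (0 < s < 1) by case=> -> /andP[]; rewrite ltxx.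
have [/(nin _ h1)//|[b [ib sb hb _]]] := over_cases o.
have [/(nin _ h2)//|[a [ia sa ha _]]] := over_cases o'.
have ab : a <> b by move=> E; move: (lt_trans hl hr); rewrite -ha -hb E ltxx.
have [_ _ _ H] : generic_crossing a b by case: wfD => _ _ _ _; apply=> //; rewrite sa sb.
exists a, b; split=> //.
- by split; rewrite ?sa ?sb// ha hb (lt_trans hl hr).
- by rewrite hb ha hl hr.
move=> f u ou; have [u01|[c [ic sc hc u01]]] := over_cases ou.
  by case: ou => _ E; case: (@inner_neq_shadow _ _ wfD f u a u01); rewrite E sa.
by exists c => //; split=> //; apply: H; rewrite sc sa.
Qed.

(** Heights vary continuously along an edge and [q] is off the spine, so an edge passes on the same
    side of [q] and of a nearby point. *)
Lemma near_over q : ~ spine D q -> \forall q' \near q, forall e t, lies_over e t q'.1 ->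
  exists t0, lies_over e t0 q.1 /\ (ht e t < q'.2) = (ht e t0 < q.2).
Proof.
move=> nq; apply: near_all => e.
have fst_near (P : R2 -> Prop) : (\forall x \near q.1, P x) -> \forall q' \near q, P q'.1.
  exact: (continuous_near (f := fst) (@cvg_fst _ _ _ _ _)).
have snd_near (P : R -> Prop) : (\forall x \near q.2, P x) -> \forall q' \near q, P q'.2.
  exact: (continuous_near (f := snd) (@cvg_snd _ _ _ _ _)).
have [[t0 o0]|no] := pselect (exists t0, lies_over e t0 q.1); last first.
  apply: filterS (fst_near _ (near_sh wfD q.1 (@ltr01 R))) => q' H t [t01 E].
  by have [t0 [? ? _]] := H e t t01 E; case: no; exists t0.
have neq : ht e t0 != q.2.
  by apply/eqP => E; apply: nq; apply/spine_over; exists e, t0.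
pose d := `|ht e t0 - q.2| / 2.
have d0 : 0 < d by rewrite divr_gt0// normr_gt0 subr_eq0.
have Hd : \forall r \near ht e t0, `|ht e t0 - r| < d by apply/near_norm; exists d.
have [eps eps0 He] := (near_norm _ _).1 (continuous_near (@ht_continuous R D e t0) Hd).
have H1 := fst_near _ (near_sh wfD q.1 eps0).
have H2 : \forall q' \near q, `|q.2 - q'.2| < d by apply: (snd_near (fun r => `|q.2 - r| < d)); apply/near_norm; exists d.
apply: filterS2 H1 H2 => q' H1 H2 t [t01 E]; exists t0; split=> //.
have [t1 [t101 E1 tt1]] := H1 e t t01 E.
have t1E : t1 = t0 by apply: over_unique o0; split; [exact: t101|exact: E1].
rewrite t1E distrC in tt1; have {He}H3 := He _ tt1.
have /andP[h1 h2] : - d < q.2 - q'.2 < d by rewrite -ltr_norml; exact: H2.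
have /andP[h3 h4] : - d < ht e t0 - ht e t < d by rewrite -ltr_norml; exact: H3.
move: neq; rewrite neq_lt => /orP[] hq.
  have dE : d = (q.2 - ht e t0) / 2 by rewrite /d ltr0_norm ?subr_lt0// opprB.
  by rewrite hq; lra.
have dE : d = (ht e t0 - q.2) / 2 by rewrite /d gtr0_norm ?subr_gt0.
by rewrite [RHS]ltNge (ltW hq); apply/negbTE; rewrite -leNgt; lra.
Qed.

Lemma near_corner_unique x : \forall y \near x, forall a, shadow a = y -> y = x.
Proof.
apply: near_all => a; have [E|E] := eqVneq (shadow a) x.
  by apply: near_always => y <-.
have : 0 < `|x - shadow a| by rewrite normr_gt0 subr_eq0 eq_sym.
move=> d0; apply/near_norm; exists `|x - shadow a| => // y + E'.
by rewrite E' ltxx.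
Qed.

Variables (G : groupType) (K : R2 -> G) (L Rv : edge D -> G).
Hypothesis lK : lconst D K.
Hypothesis KL : forall e, side_value K e (dir e) (L e).
Hypothesis KR : forall e, side_value K e (- dir e) (Rv e).

Definition edge_jump e : G := ((Rv e)^-1 * L e)%g.

Definition under_compatible := forall a b e e', passes_over a b ->
  tgt e = b -> src e' = b -> edge_jump e = edge_jump e'.

Hypothesis Kunder : under_compatible.

Definition is_inner x e := `[< exists t, 0 < t < 1 /\ x = sh e t >].
Definition is_under x e := `[< exists a, [/\ passes_over a (tgt e) & shadow (tgt e) = x] >].

(* On the edges, [K] is redefined to be the value on their left. *)
Definition Kbar x : G := if [pick e | is_inner x e] is Some e then L e else K x.

(** Between the strands of a crossing at [x0] only the wall over the lower strand is present: its
    jump is collected on the left of that strand. The incoming edge can stand for both lower edges,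
    which have the same direction up to scale and, by [Kunder], the same jump. *)
Definition side_fun x0 x : G :=
  if [pick e | is_under x0 e] is Some e then
    if 0 <= det2 (dir e) (x - x0) then edge_jump e else 1%g
  else 1%g.

(* Monodromy is picked up when crossing the walls that rise from the edges. *)
Definition local_section q x : G :=
  if `[< above_spine q >] then
    if `[< below_spine q >] then side_fun q.1 x else Kbar x
  else 1%g.

Definition bundle q q' : G := ((local_section q q.1)^-1 * local_section q q'.1)%g.

Lemma Kbar_inner e t : 0 < t < 1 -> Kbar (sh e t) = L e.
Proof.
move=> t01; rewrite /Kbar; case: pickP => [e' /asboolP[u [u01 E]]|/(_ e)].
  by have [|-> _] := inner_unique wfD t01 _ E; first by case/andP: u01 => ? ?; rewrite !ltW.
by move/negP; case; apply/asboolP; exists t.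
Qed.

Lemma Kbar_outer x : ~ shade D x -> Kbar x = K x.
Proof.
move=> nx; rewrite /Kbar; case: pickP => // e /asboolP[t [/andP[? ?] E]].
by case: nx; exists e, t; rewrite !ltW.
Qed.

Lemma near_Kbar_outer x : ~ shade D x -> \forall y \near x, Kbar y = Kbar x.
Proof.
move=> nx; have ny : \forall y \near x, ~ shade D y.
  by apply: open_nbhs_nbhs; split => //; exact: shadeC_open.
by apply: filterS2 ny (lK nx) => y ny E; rewrite !Kbar_outer.
Qed.

Lemma near_Kbar_inner e t : 0 < t < 1 -> \forall x \near sh e t,
  Kbar x = (Rv e * if 0 <= det2 (dir e) (x - sh e t) then edge_jump e else 1)%g.
Proof.
move=> t01; apply: filterS (filterI (KL e t01) (filterI (KR e t01) (near_inner wfD e t01))).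
move=> x [hl [hr [hs h0]]].
have ns : det2 (dir e) (x - sh e t) != 0 -> Kbar x = K x.
  move=> d0; apply: Kbar_outer => -[e' [u [u01 E]]].
  have [ee u01'] := hs e' u u01 E.
  by move/negP: d0; apply; rewrite -E ee shB det2Zr det2xx mulr0.
have [d0|d0|d0] := ltgtP 0 (det2 (dir e) (x - sh e t)).
- by rewrite ns ?gt_eqF// hl// /edge_jump mulVKg.
- by rewrite ns ?lt_eqF// hr ?mulg1// det2Nl oppr_gt0.
- by have [u u01 ->] := h0 (esym d0); rewrite Kbar_inner// /edge_jump mulVKg.
Qed.

Lemma crossing_under a b x : passes_over a b -> shadow b = x -> exists e0,
  [/\ [pick e | is_under x e] = Some e0, tgt e0 = b,
      exists2 e1, src e1 = b & exists2 k : R, 0 < k & dir e1 = k *: dir e0 &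
      forall f, incident f b -> edge_jump f = edge_jump e0 /\
        exists2 k : R, 0 < k & dir f = k *: dir e0].
Proof.
move=> ab bx; have [sab hab] := ab.
have ne : b <> a by move=> E; rewrite E ltxx in hab.
have [bb bcol _ bab] : generic_crossing b a by case: wfD => _ _ _ _; apply.
have [bi bo] := bb.
have [e0 te0] : exists e, tgt e = b.
  have : (0 < indegree b)%N by rewrite bi.
  by rewrite /indegree card_gt0 => /set0Pn[e]; rewrite inE => /eqP; exists e.
have uniq_in e : tgt e = b -> e = e0.
  move/eqP: bi; rewrite /indegree => /cards1P[e1 E].
  have H f : tgt f = b -> f = e1.
    by move=> tf; apply/set1P; rewrite -E inE tf.
  by move=> /H ->; rewrite (H e0).
have [e1 se1] : exists e, src e = b.
  have : (0 < outdegree b)%N by rewrite bo.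
  by rewrite /outdegree card_gt0 => /set0Pn[e]; rewrite inE => /eqP; exists e.
exists e0; split=> //.
  case: pickP => [e /asboolP[a' [[sa' ha'] se]]|/(_ e0)/negP[]].
    congr Some; apply: uniq_in; have [//|E] : tgt e = b \/ tgt e = a by apply: bab; rewrite se bx.
    have : a' = b \/ a' = a by apply: bab; rewrite sa' se bx.
    by case=> E'; move: ha'; rewrite E E' ?ltxx// ltNge ltW.
  by apply/asboolP; exists a; rewrite te0.
  by exists e1 => //; exact: bcol.
move=> f /orP[/eqP sf|/eqP tf]; last first.
  by rewrite (uniq_in f tf); split=> //; exists 1; rewrite ?scale1r.
split; first by apply/esym; apply: (Kunder ab).
exact: bcol.
Qed.

Let fst_near q (P : R2 -> Prop) : (\forall x \near q.1, P x) -> \forall q' \near q, P q'.1.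
Proof. exact: (continuous_near (f := fst) (@cvg_fst _ _ _ _ _)). Qed.

Lemma below_spineN q : ~ spine D q -> (below_spine q <-> exists e t, lies_over e t q.1 /\ ~~ (ht e t < q.2)).
Proof.
move=> nq; split=> -[e [t [o h]]]; exists e, t; split=> //; first by rewrite -leNgt ltW.
rewrite lt_neqAle leNgt h andbT; apply/eqP => E; apply: nq.
by apply/spine_over; exists e, t.
Qed.

(** [bundle q] is a quotient of values of one section, so the cocycle rule follows once the sections
    at [q] and at a nearby [q'] differ by a constant left factor near [q']. *)
Lemma bundle_cocycle : local_cocycle (~` spine D) bundle.
Proof.
move=> q nq.
suff : \forall q' \near q, exists A : G, \forall q'' \near q',
    local_section q q''.1 = (A * local_section q' q''.1)%g.
  apply: filterS => q' [A H]; have /nbhs_singleton H' := H.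
  apply: filterS H => q'' E; rewrite /bundle E H'.
  by rewrite !mulgA mulgK.
have N1 : \forall q' \near q, ~ spine D q'.
  by apply: open_nbhs_nbhs; split => //; exact: spineC_open.
have N2 := near_over nq.
have N3 := fst_near (near_corner_unique q.1).
have N4 : \forall q' \near q, shade D q'.1 -> forall e t, lies_over e t q'.1 ->
    exists t0, lies_over e t0 q.1 /\ q'.1 = q.1 + (t - t0) *: dir e.
  have := fst_near (near_sh wfD q.1 (@ltr01 R)); apply: filterS => q' H _ e t [t01 E].
  have [t0 [t001 E0 _]] := H e t t01 E; exists t0; split=> //.
  by rewrite -E -E0 -shB addrC subrK.
have N5 : \forall q' \near q, above_spine q -> below_spine q -> forall e0,
    [pick e | is_under q.1 e] = Some e0 -> det2 (dir e0) (q'.1 - q.1) = 0 -> shade D q'.1.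
  have [aq|naq] := pselect (above_spine q); last exact: near_always.
  have [bq|nbq] := pselect (below_spine q); last exact: near_always.
  have [a [b [ab [sa sb] _ _]]] := between_crossing aq bq.
  have [e0 [pe0 te0 [e1 se1 [k k0 ke1]] _]] := crossing_under ab sb.
  have := near_corner_rays wfD b; rewrite sb => H.
  apply: filterS (fst_near H) => q' [_ Hr] _ _ e; rewrite pe0 => -[<-{e}] d0.
  have raysh (i : edge D * bool) t : 0 < t < 1 -> q'.1 = ray_pt i t -> shade D q'.1.
    move=> /(ray_param01 i)/andP[? ?] ->; exists i.1, (ray_param i t); split=> //.
    by rewrite !ltW.
  have [v0|v0] := eqVneq (q'.1 - q.1) 0.
    by move/eqP: v0; rewrite subr_eq0 -sb => /eqP ->; exact: shade_shadow.
  have [sr|nsr] := pselect (same_ray (dir e0) (q'.1 - q.1)).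
    have [||t t01 E] := Hr (e1, true); last exact: raysh t01 E.
      by rewrite /ray_at /ray_end /= se1 sb eqxx.
    case: sr => _ sp; split; rewrite /ray_dir /= ke1; first by rewrite det2Zl d0 mulr0.
    by rewrite dot2C dot2Zr mulr_gt0// dot2C.
  have [j j0 E] := ray_param_opp (dir_neq0 wfD e0) v0 d0 nsr.
  have [||t t01 E'] := Hr (e0, false).
  - by rewrite /ray_at /ray_end /= te0 sb eqxx.
  - rewrite E -[ray_dir _]/(- dir e0) /same_ray det2Nl det2Zr det2xx mulr0 oppr0; split=> //.
    by rewrite scaleNr -scalerN dot2Zr mulr_gt0// dot2_gt0// oppr_eq0 dir_neq0.
  exact: raysh t01 E'.
apply: filterS (filterI N1 (filterI N2 (filterI N3 (filterI N4 N5)))).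
move=> q' {N1 N2 N3 N4 N5} [N1 [N2 [N3 [N4 N5]]]].
have [sq'|nsq'] := pselect (shade D q'.1); last first.
  have ls y : local_section q' y = 1%g.
    rewrite /local_section; case: asboolP => // -[e [t [[t01 E] _]]].
    by case: nsq'; exists e, t.
  suff H : \forall q'' \near q', local_section q q''.1 = local_section q q'.1.
    by exists (local_section q q'.1); apply: filterS H => q'' ->; rewrite ls mulg1.
  rewrite /local_section; case: asboolP => aq; last exact: near_always.
  case: asboolP => bq; last exact: (fst_near (near_Kbar_outer nsq')).
  have [a [b [ab [sa sb] _ _]]] := between_crossing aq bq.
  have [e0 [pe0 te0 [e1 se1 [k k0 ke1]] _]] := crossing_under ab sb.
  rewrite /side_fun pe0.
  have d0 : det2 (dir e0) (q'.1 - q.1) != 0.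
    by apply/eqP => E; apply: nsq'; apply: N5 pe0 E.
  move: d0; rewrite neq_lt => /orP[] d0.
    have := fst_near (near_det2_lt0 d0); apply: filterS => q'' d0'.
    by rewrite !leNgt d0 d0'.
  have := fst_near (near_det2_gt0 d0); apply: filterS => q'' d0'.
  by rewrite !ltW.
(* The point [q'] lies over a corner or over an inner point of a single edge. In the first case it
   is on the vertical of [q] and both points have the same section. *)
have [[e [t [t01 E]]]|[c E]] := shade_cases sq'; last first.
  have E' : q'.1 = q.1 by apply: N3; exact: esym E.
  exists 1%g; apply: near_always => q''; rewrite mul1g /local_section E'.
  have lev e t : lies_over e t q.1 -> (ht e t < q'.2) = (ht e t < q.2).
    by move=> o; have [t0 [o0]] := N2 e t (eq_ind_r (lies_over e t) o E'); rewrite (over_unique o0 o).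
  have aE : above_spine q = above_spine q'.
    apply/propext; split=> -[e [t [o h]]].
      by exists e, t; rewrite E'; split=> //; rewrite lev.
    by rewrite E' in o; exists e, t; split=> //; rewrite -lev.
  have bE : below_spine q = below_spine q'.
    apply/propext; split.
      move=> /(below_spineN nq)[e [t [o h]]]; apply/(below_spineN N1).
      by exists e, t; rewrite E'; split=> //; rewrite lev.
    move=> /(below_spineN N1)[e [t [o h]]]; apply/(below_spineN nq).
    by rewrite E' in o; exists e, t; split=> //; rewrite -lev.
  by rewrite aE bE.
have [t0 t1] := andP t01.
have o' : lies_over e t q'.1 by rewrite /lies_over E !ltW.
have only f u : lies_over f u q'.1 -> f = e /\ u = t.
  case=> u01; rewrite E => Eu.
  by have [-> ->] := inner_unique wfD t01 u01 (esym Eu).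
have ls' y : local_section q' y = if ht e t < q'.2 then Kbar y else 1%g.
  rewrite /local_section.
  have [h|h] := boolP (ht e t < q'.2).
    rewrite asboolT; last by exists e, t.
    by rewrite asboolF// => /(below_spineN N1)[f [u [/only[-> ->]]]]; rewrite h.
  by rewrite asboolF// => -[f [u [/only[-> ->]]]]; exact/negP.
have [s [os qq']] := N4 sq' e t o'.
have [s' [os' lev]] := N2 e t o'.
rewrite -(over_unique os os') {s' os'} in lev.
have goal_iff : (exists A, \forall q'' \near q', local_section q q''.1 =
    (A * if ht e t < q'.2 then Kbar q''.1 else 1)%g) ->
  exists A, \forall q'' \near q', local_section q q''.1 = (A * local_section q' q''.1)%g.
  by move=> [A H]; exists A; apply: filterS H => q'' ->; rewrite ls'.
apply: goal_iff; rewrite lev /local_section.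
case: asboolP => aq; last first.
  have -> : (ht e s < q.2) = false by apply/negbTE/negP => h; apply: aq; exists e, s.
  by exists 1%g; apply: near_always => q''; rewrite mulg1.
case: asboolP => bq; last first.
  have -> : (ht e s < q.2) = true.
    by apply/negPn/negP => h; apply: bq; apply/(below_spineN nq); exists e, s.
  by exists 1%g; apply: near_always => q''; rewrite mul1g.
have [a [b [ab [sa sb] hab all_ends]]] := between_crossing aq bq.
have [e0 [pe0 te0 _ He0]] := crossing_under ab sb.
have [c ic [sc hc s01 cab]] := all_ends e s os.
have ts : t != s by case: s01 => ->; [rewrite gt_eqF|rewrite lt_eqF].
have [hb ha] := andP hab.
rewrite /side_fun pe0; case: cab => cE.
  (* Along the upper strand there is no wall at the height of [q], and the lower strand is
     transverse to it, so the section of [q] is constant near [q']. *)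
  have -> : (ht e s < q.2) = false by rewrite -hc cE; apply/negbTE; rewrite -leNgt ltW.
  have ne : a <> b by move=> ee; move: hb; rewrite -ee ltNge (ltW ha).
  have [_ _ tr _] : generic_crossing a b by case: wfD => _ _ _ _; apply=> //; case: ab.
  have d0 : det2 (dir e0) (q'.1 - q.1) != 0.
    rewrite qq' addrAC subrr add0r det2Zr; apply: mulf_neq0; first by rewrite subr_eq0.
    rewrite det2C oppr_eq0; apply: tr; first by rewrite -cE.
    by rewrite /incident te0 eqxx orbT.
  exists (if 0 <= det2 (dir e0) (q'.1 - q.1) then edge_jump e0 else 1%g).
  move: d0; rewrite neq_lt => /orP[] d0.
    have := fst_near (near_det2_lt0 d0); apply: filterS => q'' d0'.
    by rewrite !leNgt d0 d0' mulg1.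
  have := fst_near (near_det2_gt0 d0); apply: filterS => q'' d0'.
  by rewrite !ltW// mulg1.
(* Along the lower strand both sections change by the jump of [e0], whichever of the two lower edges
   [e] is. *)
rewrite -hc cE hb; rewrite cE in ic.
have [je [k k0 de]] := He0 e ic.
exists ((Rv e)^-1)%g; have := near_Kbar_inner e t01.
rewrite -E => H; apply: filterS (fst_near H) => q'' ->.
rewrite mulKg -je; suff -> : (0 <= det2 (dir e) (q''.1 - q'.1)) = (0 <= det2 (dir e0) (q''.1 - q.1)) by [].
rewrite qq' opprD addrA de det2Zl pmulr_rge0// det2Br !det2Zr det2xx !mulr0 subr0.
by [].
Qed.

Lemma bundle_low q q' : ~ above_spine q -> bundle q q' = 1%g.
Proof. by move=> aq; rewrite /bundle /local_section asboolF// invg1 mul1g. Qed.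

Lemma bundle_outer q q' : ~ shade D q.1 -> bundle q q' = 1%g.
Proof. by move=> nq; apply: bundle_low => -[e [t [[t01 E] _]]]; apply: nq; exists e, t. Qed.

Lemma bundle_high q : ~ below_spine q -> ~ spine D q ->
  \forall q' \near q, bundle q q' = ((Kbar q.1)^-1 * Kbar q'.1)%g.
Proof.
move=> bq nq; have [sq|nsq] := pselect (shade D q.1); last first.
  apply: filterS (fst_near (near_Kbar_outer nsq)) => q' ->.
  by rewrite bundle_outer// mulVg.
have aq : above_spine q.
  have [e [t [t01 E]]] := sq; exists e, t; split=> //.
  by apply/negPn/negP => h; apply: bq; apply/(below_spineN nq); exists e, t.
apply: near_always => q'; rewrite /bundle /local_section.
by rewrite asboolT// asboolF.
Qed.

Lemma height_bounded : exists M : R, 0 <= M /\ forall e t, 0 <= t <= 1 -> `|ht e t| <= M.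
Proof.
exists (\sum_(a : corner D) `|height a| + \sum_(a : corner D) `|height a|).
have H a : `|height a| <= \sum_(b : corner D) `|height b|.
  by rewrite (bigD1 a)//= lerDl sumr_ge0.
split; first by rewrite addr_ge0// sumr_ge0.
move=> e t /andP[t0 t1]; rewrite htE.
apply: le_trans (ler_normD _ _) _; rewrite !normrM (ger0_norm t0) ger0_norm ?subr_ge0//.
apply: lerD; [apply: le_trans (H (src e))|apply: le_trans (H (tgt e))]; rewrite ler_piMl//.
by lra.
Qed.

Lemma norm_pair (q : R3) : `|q| = Num.max `|q.1| `|q.2|.
Proof. by []. Qed.

(** As [K] is 1 far away, the bundle is trivial outside a ball: [Kbar] trivializes it above the
    height [M] and the constant 1 elsewhere. *)
Lemma bundle_infinity (B : R) : (forall x, B < `|x| -> K x = 1%g) ->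
  exists M : R, exists F : R3 -> G, forall q, M < `|q| ->
    \forall q' \near q, bundle q q' = ((F q)^-1 * F q')%g.
Proof.
move=> KB; have [M1 HM1] := shade_bounded D; have [M2 [M20 HM2]] := height_bounded.
pose M := Num.max B (Num.max M1 M2); exists M.
have [BM M1M M2M] : [/\ B <= M, M1 <= M & M2 <= M].
  by rewrite /M !le_max !lexx ?orbT.
exists (fun q => if M < q.2 then Kbar q.1 else 1%g) => q Mq.
have nspine : ~ spine D q.
  move=> /spine_over[e [t [[t01 E] E']]]; move: Mq; rewrite norm_pair ltNge ge_max.
  by rewrite (le_trans (HM1 _ _) M1M) ?(le_trans _ M2M)// -?E' ?HM2//; exists e, t.
have [hq|hq] := ltP M q.2.
  have nb : ~ below_spine q.
    move=> [e [t [[t01 E] h]]]; have := HM2 e t t01; have := ler_norm (ht e t); lra.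
  have H2 : \forall q' \near q, M < q'.2.
    exact: (continuous_near (f := snd) (P := fun r => M < r) (@cvg_snd _ _ _ _ _) (lt_nbhsr hq)).
  by apply: filterS2 (bundle_high nb nspine) H2 => q' -> ->.
have [xq|xq] := ltP M `|q.1|.
  have nsh : ~ shade D q.1 by move=> /HM1; lra.
  have H1 : \forall q' \near q, M < `|q'.1|.
    have c1 : {for q, continuous (fun q : R3 => `|q.1|)}.
      by apply: (continuous_comp (g := fun x : R2 => `|x|)); [exact: cvg_fst|exact: norm_continuous].
    exact: (continuous_near (P := fun r : R => M < r) c1 (lt_nbhsr xq)).
  apply: filterS H1 => q' H1; rewrite bundle_outer// invg1 mul1g.
  case: ifP => // _; rewrite Kbar_outer; last by move=> /HM1; lra.
  by rewrite KB//; lra.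
have lq : q.2 < - M.
  move: Mq; rewrite norm_pair lt_max ltNge xq /= ltr_normr => /orP[|]; first by rewrite ltNge hq.
  by rewrite ltrNr.
have H2 : \forall q' \near q, q'.2 < - M.
  exact: (continuous_near (f := snd) (P := fun r => r < - M) (@cvg_snd _ _ _ _ _) (lt_nbhsl lq)).
apply: filterS H2 => q' H2; rewrite bundle_low; last first.
  move=> [e [t [[t01 E] h]]]; have := HM2 e t t01; rewrite ler_norml => /andP[]; lra.
by rewrite invg1 mul1g ifF//; apply/negbTE; rewrite -leNgt; lra.
Qed.

End Bundle.

Lemma lipschitz_continuous (R : realType) (V W : normedModType R) (f : V -> W) (C : R) q :
  0 < C -> (forall p, `|f q - f p| <= C * `|q - p|) -> {for q, continuous f}.
Proof.
move=> C0 HC; apply/cvgrPdist_lt => eps eps0.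
apply/near_norm; exists (eps / C); first by rewrite divr_gt0.
move=> p; rewrite ltr_pdivlMr// mulrC => h.
exact: le_lt_trans (HC p) h.
Qed.

Lemma fin_lower_bound (R : realType) (I : finType) (r : I -> R) :
  (forall i, 0 < r i) -> exists2 s : R, 0 < s & forall i, s <= r i.
Proof.
move=> r0; have S0 : 0 < 1 + \sum_i (r i)^-1.
  by rewrite ltr_pwDl// sumr_ge0// => i _; rewrite invr_ge0 ltW.
(* The reciprocal of a sum of reciprocals bounds each term from below; the summand 1 keeps it
   positive on an empty type. *)
exists (1 + \sum_i (r i)^-1)^-1; first by rewrite invr_gt0.
move=> i; rewrite -[r i]invrK lef_pV2 ?posrE ?invr_gt0//.
rewrite (bigD1 i)//= addrCA lerDl addr_ge0// sumr_ge0// => j _.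
by rewrite invr_ge0 ltW.
Qed.

(** * Retraction away from a tube *)

Section Retraction.
Variables (R : realType) (D : diagram R).
Hypothesis wfD : wf_diagram D.
Local Notation R2 := (R * R)%type.
Local Notation R3 := (R * R * R)%type.
Implicit Types (e : edge D) (a b : corner D) (t u : R) (p q y : R3).

Definition tube (d : R) : set R3 := neighborhood d (spine D).

Lemma tube0 : tube 0 = spine D.
Proof.
apply/seteqP; split=> q; last by exists q => //; rewrite subrr normr0.
by case=> a sa; rewrite normr_le0 subr_eq0 => /eqP ->.
Qed.

Lemma edge_pointB e t u : edge_point e t - edge_point e u = (t - u) *: (pos (tgt e) - pos (src e)).
Proof.
have E v : edge_point e v = pos (src e) + v *: (pos (tgt e) - pos (src e)).
  by rewrite /edge_point scalerBl scale1r -addrA [- _ + _]addrC -scalerBr.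
by rewrite !E opprD addrACA subrr add0r -scalerBl.
Qed.

Lemma edge_point_segment e t u (s : R) :
  edge_point e t + s *: (edge_point e u - edge_point e t) = edge_point e (t + s * (u - t)).
Proof.
rewrite -[RHS](subrK (edge_point e t)) !edge_pointB scalerA addrC.
by congr (_ *: _ + _); ring.
Qed.

(** The distance to each of the finitely many edges is attained, so off the tube it exceeds [d] by a
    positive amount. *)
Lemma tubeC_open d : open (~` tube d).
Proof.
rewrite openE => q nq.
have : \forall q' \near q, forall e, ~ exists2 t, 0 <= t <= 1 & `|q' - edge_point e t| <= d.
  apply: near_all => e.
  have c : {within `[0, 1], continuous (fun t : R => `|q - edge_point e t|)}%classic.
    apply: continuous_subspaceT => t.
    by apply: cvg_norm; apply: cvgB; [exact: cvg_cst|exact: edge_point_continuous].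
  have [t0] := EVT_min (@ler01 R) c; rewrite in_itv /= => t001 Hmin.
  have d0 : d < `|q - edge_point e t0|.
    rewrite ltNge; apply/negP => h; apply: nq; exists (edge_point e t0) => //.
    by exists e, t0.
  apply/near_norm; exists (`|q - edge_point e t0| - d); first by rewrite subr_gt0.
  move=> q' qq' [t t01 h].
  have := Hmin t; rewrite in_itv /= => /(_ t01); apply/negP; rewrite -ltNge.
  apply: le_lt_trans (ler_distD q' q (edge_point e t)) _.
  by apply: le_lt_trans (lerD (lexx _) h) _; rewrite -ltrBrDr.
apply: filterS => q' H [p [e [t [t01 ->]]] h]; by apply: (H e); exists t.
Qed.

(* The projection to the line of [e] along the directions whose shadow is
   orthogonal to that of [e], followed by the clamping to [e]. *)
Definition edge_param e q : R := dot2 (dir e) (q.1 - shadow (src e)) / dot2 (dir e) (dir e).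
Definition clamp (t : R) : R := Num.max 0 (Num.min 1 t).
Definition edge_proj e q : R3 := edge_point e (clamp (edge_param e q)).

Lemma clamp01 t : 0 <= clamp t <= 1.
Proof. by rewrite /clamp le_max lexx /= ge_max ler01 ge_min lexx. Qed.

Lemma clamp_id t : 0 <= t <= 1 -> clamp t = t.
Proof. by move=> /andP[t0 t1]; rewrite /clamp min_r// max_r. Qed.

Lemma clamp_lip t u : `|clamp t - clamp u| <= `|t - u|.
Proof.
have : clamp t - clamp u <= `|t - u| /\ clamp u - clamp t <= `|t - u|; last first.
  by move=> [? ?]; rewrite ler_norml; apply/andP; split; lra.
have E v : clamp v = if v <= 0 then 0 else if 1 <= v then 1 else v.
  rewrite /clamp; case: (leP v 0) => v0; last by case: (leP 1 v) => v1; rewrite max_r// ltW.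
  by rewrite min_r ?max_l//; lra.
rewrite !E; have := ler_norm (t - u); have := ler_norm (u - t); rewrite distrC => h1 h2.
have := normr_ge0 (t - u).
by case: (leP t 0) => a1; case: (leP u 0) => a2;
  case: (leP 1 t) => a3; case: (leP 1 u) => a4; lra.
Qed.

Lemma edge_param_point e t : edge_param e (edge_point e t) = t.
Proof.
have := sh_param wfD e t 0; rewrite sh0 add0r => E.
by rewrite /edge_param -/(sh e t) -E.
Qed.

Lemma edge_proj_point e t : 0 <= t <= 1 -> edge_proj e (edge_point e t) = edge_point e t.
Proof. by move=> t01; rewrite /edge_proj edge_param_point clamp_id. Qed.

Lemma dot2_le (d x : R2) : `|dot2 d x| <= 2 * `|d| * `|x|.
Proof.
have h1 (z : R2) : `|z.1| <= `|z| by rewrite [`|z|]/(Num.max _ _) le_max lexx.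
have h2 (z : R2) : `|z.2| <= `|z| by rewrite [`|z|]/(Num.max _ _) le_max lexx orbT.
apply: le_trans (ler_normD _ _) _; rewrite !normrM.
have -> : 2 * `|d| * `|x| = `|d| * `|x| + `|d| * `|x| by ring.
by apply: lerD; apply: ler_pM.
Qed.

Lemma fst_norm q : `|q.1| <= `|q|.
Proof. by rewrite [X in _ <= X](_ : _ = Num.max `|q.1| `|q.2|)// le_max lexx. Qed.

Lemma edge_proj_lip : exists2 C : R, 1 <= C & forall e q p,
  `|edge_proj e q - edge_proj e p| <= C * `|q - p|.
Proof.
pose c e := 2 * `|dir e| / dot2 (dir e) (dir e) * `|pos (tgt e) - pos (src e)|.
have c0 e : 0 <= c e.
  by rewrite /c !mulr_ge0// invr_ge0 ltW// dot2_gt0// dir_neq0.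
exists (1 + \sum_e c e); first by rewrite lerDl sumr_ge0.
move=> e q p; rewrite /edge_proj edge_pointB normrZ.
have ce : c e <= 1 + \sum_e c e.
  by rewrite (bigD1 e)//= addrCA lerDl addr_ge0// sumr_ge0.
apply: le_trans (ler_wpM2r (normr_ge0 _) ce).
rewrite /c mulrAC; apply: ler_wpM2r => //.
apply: le_trans (clamp_lip _ _) _.
have dd : 0 < dot2 (dir e) (dir e) by rewrite dot2_gt0// dir_neq0.
rewrite /edge_param -mulrBl normrM normfV (gtr0_norm dd) mulrAC.
rewrite ler_pM2r ?invr_gt0//.
have -> : dot2 (dir e) (q.1 - shadow (src e)) - dot2 (dir e) (p.1 - shadow (src e)) =
   dot2 (dir e) (q - p).1 by rewrite /dot2 /=; ring.
by apply: le_trans (dot2_le _ _) _; rewrite ler_wpM2l ?mulr_ge0// fst_norm.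
Qed.

Lemma edge_proj_continuous e : continuous (edge_proj e).
Proof.
have [C C1 HC] := edge_proj_lip; move=> q.
by apply: (@lipschitz_continuous _ _ _ _ C) => //; lra.
Qed.

(** The projection fixes the points of the edge and is Lipschitz, so it is a nearest point up to the
    factor $1+C$. It replaces nearest points, which the max norm does not determine uniquely. *)
Lemma edge_proj_dist (C : R) : (forall e q p, `|edge_proj e q - edge_proj e p| <= C * `|q - p|) ->
  forall e t q, 0 <= t <= 1 -> `|q - edge_proj e q| <= (1 + C) * `|q - edge_point e t|.
Proof.
move=> HC e t q t01; have := HC e q (edge_point e t); rewrite edge_proj_point//.
have := ler_distD (edge_point e t) q (edge_proj e q).
rewrite (distrC (edge_point e t)) mulrDl mul1r => h1 h2.
by apply: le_trans h1 _; rewrite lerD2l.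
Qed.

(** Within this radius the spine is a cone from each corner. The factor 2 makes the open balls of
    radius [rho] disjoint and leaves room for a tube around the spine. *)
Lemma corner_radius : exists2 rho : R, 0 < rho &
  (forall a p (s : R), spine D p -> `|pos a - p| <= 2 * rho -> 0 <= s <= 1 ->
     spine D (pos a + s *: (p - pos a))) /\
  (forall a b, a != b -> 2 * rho <= `|pos a - pos b|).
Proof.
have Ha a : exists2 r : R, 0 < r & forall p (s : R), spine D p -> `|pos a - p| < r ->
    0 <= s <= 1 -> spine D (pos a + s *: (p - pos a)).
  have [r r0 H] := (near_norm _ _).1 (near_spine wfD (pos a) (@ltr01 R)).
  exists r => // p s [e [t [t01 pE]]] pr s01.
  have [t0 [t001 E0 _]] := H p pr e t t01 (esym pE).
  exists e, (t0 + s * (t - t0)); rewrite pE -E0 edge_point_segment; split=> //.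
  by move: t01 t001 s01 => /andP[? ?] /andP[? ?] /andP[? ?]; apply/andP; split; nra.
have /choice[r rP] a : exists r : R, 0 < r /\ forall p (s : R), spine D p -> `|pos a - p| < r ->
    0 <= s <= 1 -> spine D (pos a + s *: (p - pos a)).
  by have [r r0 H] := Ha a; exists r.
pose dist (ab : corner D * corner D) : R :=
  if ab.1 == ab.2 then 1 else `|pos ab.1 - pos ab.2|.
have dist0 ab : 0 < dist ab.
  rewrite /dist; case: eqVneq => // ne; rewrite normr_gt0 subr_eq0.
  by apply: contra_neq ne; case: wfD => inj _ _ _ _; exact: inj.
have [s1 s10 H1] := fin_lower_bound (fun a => (rP a).1).
have [s2 s20 H2] := fin_lower_bound dist0.
pose rho := Num.min s1 s2 / 3; have m0 : 0 < Num.min s1 s2 by rewrite lt_min s10.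
have : Num.min s1 s2 <= s1 /\ Num.min s1 s2 <= s2 by rewrite !ge_min !lexx orbT.
move=> [m1 m2]; exists rho; first by rewrite divr_gt0.
split=> [a p s sp ap s01|a b ab].
  apply: (rP a).2 => //; apply: (le_lt_trans ap); apply: lt_le_trans (H1 a).
  by rewrite /rho; lra.
have := H2 (a, b); rewrite /dist /= (negbTE ab); apply: le_trans.
by rewrite /rho; lra.
Qed.

Lemma edge_radius (rho : R) : 0 < rho -> exists2 eta : R, 0 < eta & forall e t,
  0 <= t <= 1 -> (forall a, rho / 2 <= `|edge_point e t - pos a|) ->
  forall p, spine D p -> `|edge_point e t - p| <= eta ->
    exists2 u, 0 <= u <= 1 & p = edge_point e u.
Proof.
move=> rho0; have [C C1 HC] := edge_proj_lip.
have Hee (ee : edge D * edge D) : exists m : R, 0 < m /\ (ee.1 != ee.2 -> forall t, 0 <= t <= 1 ->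
    (forall a, rho / 2 <= `|edge_point ee.1 t - pos a|) ->
    m <= `|edge_point ee.1 t - edge_proj ee.2 (edge_point ee.1 t)|).
  case: ee => e e' /=; have [_|ne] := eqVneq e e'; first by exists 1.
  (* [h a] penalises the neighbourhood of a corner: two edges may meet there, and without the
     penalty the minimum over [e] could be 0. *)
  pose h a t : R := Num.max 0 (rho / 2 - `|edge_point e t - pos a|).
  pose f t : R := `|edge_point e t - edge_proj e' (edge_point e t)|.
  have cn a : continuous (fun t => `|edge_point e t - pos a|).
    by move=> t; apply: cvg_norm; apply: cvgB; [exact: edge_point_continuous|exact: cvg_cst].
  have cf : continuous f.
    move=> t; apply: cvg_norm; apply: cvgB; first exact: edge_point_continuous.
    apply: (@continuous_comp _ _ _ (edge_point e) (edge_proj e')); first exact: edge_point_continuous.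
    exact: edge_proj_continuous.
  have ch a : continuous (h a).
    move=> t; apply: (@continuous_max _ _ (fun=> 0) (fun t => rho / 2 - `|edge_point e t - pos a|)).
      exact: cvg_cst.
    by apply: cvgB; [exact: cvg_cst|exact: cn].
  have c : {within `[0, 1], continuous (fun t => f t + (h (src e) t + h (tgt e) t))}%classic.
    apply: continuous_subspaceT => t.
    by apply: cvgD; [exact: cf|apply: cvgD; exact: ch].
  have [t0] := EVT_min (@ler01 R) c; rewrite in_itv /= => t001 Hmin.
  have h0 a t : 0 <= h a t by rewrite /h le_max lexx.
  exists (f t0 + (h (src e) t0 + h (tgt e) t0)); split; last first.
    move=> _ t t01 far; have := Hmin t; rewrite in_itv /= => /(_ t01) Ht.
    apply: le_trans Ht _; rewrite /h !max_l ?addr0// subr_le0; exact: far.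
  have s0 : 0 <= f t0 + (h (src e) t0 + h (tgt e) t0).
    by apply: addr_ge0; [exact: normr_ge0|apply: addr_ge0].
  rewrite lt_neqAle eq_sym s0 andbT; apply/eqP => z.
  have fz : f t0 = 0.
    have := h0 (src e) t0; have := h0 (tgt e) t0; have := normr_ge0 _ : 0 <= f t0; lra.
  have fz' : edge_point e t0 = edge_proj e' (edge_point e t0).
    by move/eqP: fz; rewrite /f normr_eq0 subr_eq0 => /eqP.
  have [] : (t0 = 0 \/ t0 = 1) /\ (clamp (edge_param e' (edge_point e t0)) = 0 \/
      clamp (edge_param e' (edge_point e t0)) = 1).
    case: wfD => _ _ _ /(_ e e' t0 _ (elimN eqP ne)) H _; apply: H => //; first exact: clamp01.
    by rewrite {1}fz'.
  case=> t0E _; move: z; rewrite fz add0r.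
    have -> : h (src e) t0 = rho / 2.
      rewrite /h t0E /edge_point subr0 scale1r scale0r addr0 subrr normr0 subr0 max_r//.
      by rewrite divr_ge0// ltW.
    by have := h0 (tgt e) t0; lra.
  have -> : h (tgt e) t0 = rho / 2.
    rewrite /h t0E /edge_point subrr scale1r scale0r add0r subrr normr0 subr0 max_r//.
    by rewrite divr_ge0// ltW.
  by have := h0 (src e) t0; lra.
have /choice[m mP] := Hee.
have [s s0 Hs] := fin_lower_bound (fun ee => (mP ee).1).
have C2 : 0 < 2 * (1 + C) by lra.
exists (s / (2 * (1 + C))); first by rewrite divr_gt0.
move=> e t t01 far p [e' [u [u01 ->]]] pd.
have [<-|ne] := eqVneq e e'; first by exists u.
have := (mP (e, e')).2 ne t t01 far => /= h.
have := edge_proj_dist HC e' (edge_point e t) u01.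
have := Hs (e, e'); move: pd; rewrite ler_pdivlMr//.
have := normr_ge0 (edge_point e t - edge_point e' u); nra.
Qed.

End Retraction.

(** * Radial pushing *)

Section Push.
Variables (R : realType) (V : normedModType R).
Implicit Types (q y p : V) (c d lam t : R) (S : set V).

(* Moves [q] radially away from [y] to distance [c] if it is closer; equal to 0
   at [q = y], where [c / 0 = 0]. *)
Definition push c y q : V := (Num.max 1 (c / `|q - y|) - 1) *: (q - y).

Lemma separation_far p q y c : `|q - p| = c -> 2 * c <= `|p - y| -> c <= `|q - y|.
Proof.
move=> pq py; have : `|p - y| <= `|q - p| + `|q - y| by rewrite (distrC q p) ler_distD.
by rewrite pq => h; lra.
Qed.

Lemma push0 c y q : 0 <= c -> c <= `|q - y| -> push c y q = 0.
Proof.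
move=> c0 le; rewrite /push max_l ?subrr ?scale0r//.
have [->|n0] := eqVneq (`|q - y|) 0; first by rewrite invr0 mulr0.
by rewrite ler_pdivrMr ?mul1r// lt_neqAle eq_sym n0 normr_ge0.
Qed.

Lemma push_norm c y q : q != y -> `|q - y| <= c -> `|q + push c y q - y| = c.
Proof.
move=> qy le; have n0 : 0 < `|q - y| by rewrite normr_gt0 subr_eq0.
have -> : q + push c y q - y = Num.max 1 (c / `|q - y|) *: (q - y).
  by rewrite /push scalerBl scale1r addrAC addrC subrK.
rewrite max_r.
  by rewrite normrZ ger0_norm ?divr_ge0 ?(le_trans _ le)// divfK// gt_eqF.
by rewrite ler_pdivlMr// mul1r.
Qed.

Lemma push_segment c y q t : 0 <= t <= 1 -> 0 <= c -> exists2 lam, 1 <= lam &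
  q + t *: push c y q = y + lam *: (q - y) /\
  `|lam *: (q - y)| <= Num.max c `|q - y|.
Proof.
move=> /andP[t0 t1] c0; pose m := Num.max 1 (c / `|q - y|).
have m1 : 1 <= m by rewrite /m le_max lexx.
exists (1 + t * (m - 1)); first by rewrite lerDl mulr_ge0// subr_ge0.
split.
  rewrite scalerDl scale1r addrA -[y + (q - y)]addrC subrK; congr (_ + _).
  by rewrite /push -/m scalerA.
have le : 1 + t * (m - 1) <= m.
  by rewrite addrC -lerBrDr ler_piMl// subr_ge0.
rewrite normrZ ger0_norm; last by rewrite addr_ge0// mulr_ge0// subr_ge0.
apply: le_trans (ler_wpM2r (normr_ge0 _) le) _.
rewrite /m maxr_pMl// mul1r ge_max le_max lexx orbT /=.
have [->|n0] := eqVneq (`|q - y|) 0; first by rewrite mulr0 le_max c0.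
by rewrite divfK// le_max lexx.
Qed.

(** Scaling by [lam^-1] towards the centre [y] keeps nearby points of [S] in [S] and shrinks
    distances, so a dilated point within [d] of [S] would have started within [d] of it. *)
Lemma star_avoid S y c d q lam : 0 <= d ->
  (forall p (u : R), S p -> `|y - p| <= c + d -> 0 <= u <= 1 -> S (y + u *: (p - y))) ->
  ~ (exists2 p, S p & `|q - p| <= d) -> 1 <= lam -> `|lam *: (q - y)| <= c ->
  ~ (exists2 p, S p & `|y + lam *: (q - y) - p| <= d).
Proof.
move=> d0 star nq l1 lc [p Sp pd]; apply: nq; exists (y + lam^-1 *: (p - y)).
  apply: star => //; last by rewrite invr_ge0 invf_le1; lra.
  apply: le_trans (ler_distD (y + lam *: (q - y)) _ _) _.
  by rewrite opprD addrA subrr add0r normrN lerD.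
have l0 : 0 < lam by lra.
have -> : q - (y + lam^-1 *: (p - y)) = lam^-1 *: (y + lam *: (q - y) - p).
  have -> : y + lam *: (q - y) - p = lam *: (q - (y + lam^-1 *: (p - y))).
    rewrite [in RHS]opprD [in RHS]addrA [RHS]scalerBr scalerA divff ?gt_eqF//.
    by rewrite scale1r opprB addrA [y + _]addrC.
  by rewrite scalerA mulVf ?scale1r// gt_eqF.
rewrite normrZ (ger0_norm (_ : 0 <= lam^-1)) ?invr_ge0 ?(ltW l0)//.
by apply: (le_trans _ pd); rewrite ler_piMl// invf_le1.
Qed.

Lemma push_continuous c (y : V -> V) q : 0 <= c -> q != y q -> {for q, continuous y} ->
  {for q, continuous (fun q => push c (y q) q)}.
Proof.
move=> c0 qy cy; have n0 : `|q - y q| != 0 by rewrite normr_eq0 subr_eq0.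
have cB : {for q, continuous (fun q => q - y q)} by apply: cvgB => //; exact: cvg_id.
apply: cvgZ => //; apply: (@cvgB _ R^o); last exact: cvg_cst.
apply: (@continuous_max _ _ (fun=> 1) (fun q => c / `|q - y q|)); first exact: cvg_cst.
apply: (@cvgM _ _ _ _ (fun=> c)); first exact: cvg_cst.
by apply: (@continuousV _ _ (fun q => `|q - y q|)) => //; apply: cvg_norm.
Qed.

Lemma sum_continuous (T : topologicalType) (I : finType) (f : I -> T -> V) x :
  (forall i, {for x, continuous (f i)}) -> {for x, continuous (fun z => \sum_i f i z)}.
Proof.
move=> cf; elim: (index_enum I) => [|i l IH].
  have -> : (fun z => \sum_(i <- [::]) f i z) = fun=> 0.
    by apply/funext => z; rewrite big_nil.
  exact: cvg_cst.
have -> : (fun z => \sum_(j <- i :: l) f j z) = fun z => f i z + \sum_(j <- l) f j z.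
  by apply/funext => z; rewrite big_cons.
exact: cvgD (cf i) IH.
Qed.

Lemma homotopy_continuous (f : V -> V) q t : {for q, continuous f} ->
  {for (q, t), continuous (fun qt : V * R => qt.1 + (1 - qt.2) *: f qt.1)}.
Proof.
move=> cf; apply: cvgD; first exact: cvg_fst.
apply: cvgZ; first by apply: (@cvgB _ R^o); [exact: cvg_cst|exact: cvg_snd].
by apply: continuous_comp => //; exact: cvg_fst.
Qed.
End Push.

Section Retract.
Variables (R : realType) (D : diagram R).
Hypothesis wfD : wf_diagram D.
Local Notation R2 := (R * R)%type.
Local Notation R3 := (R * R * R)%type.
Implicit Types (e : edge D) (a b : corner D) (t u d : R) (p q y : R3).

Lemma spine_corner a : spine D (pos a).
Proof.
have [e ea] := corner_edge wfD a; have [t t01 <-] := incident_sh ea.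
by exists e, t; split=> //; case: t01 => ->; rewrite lexx ler01.
Qed.

Lemma clamp_inner t : 0 < clamp t < 1 -> clamp t = t.
Proof.
rewrite /clamp; case: (leP 1 t) => t1; first by rewrite max_r ?ler01// ltxx andbF.
by case: (leP 0 t) => // t0; rewrite ltxx.
Qed.

Lemma edge_param_affine e p q t :
  edge_param e (p + t *: (q - p)) = edge_param e p + t * (edge_param e q - edge_param e p).
Proof.
rewrite /edge_param -mulrBl mulrA -mulrDl; congr (_ / _).
by move: (dir e) (shadow (src e)) => d c; rewrite /dot2 /= /GRing.scale /=; ring.
Qed.

(** [f1] pushes points out of the balls of radius [rho] around the corners, then [f2] pushes them
    out of the [eta]-neighbourhoods of the edges. The balls are disjoint, and off them so are these
    neighbourhoods, so at most one term of each sum is nonzero. Pushes are dilations from points of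
    the spine, which is star-shaped around them locally, and therefore never lead into a thin
    tube. *)
Lemma retraction_maps : exists2 d0 : R, 0 < d0 & exists f1 f2 : R3 -> R3,
  [/\ forall q, ~ spine D q -> {for q, continuous f1},
      forall q, ~ spine D q -> {for q, continuous f2},
      forall d q t, 0 <= d <= d0 -> 0 <= t <= 1 -> ~ tube D d q -> ~ tube D d (q + t *: f1 q),
      forall d q t, 0 <= d <= d0 -> 0 <= t <= 1 -> ~ tube D d (q + f1 q) -> ~ spine D q ->
        ~ tube D d (q + f1 q + t *: f2 (q + f1 q)) &
      forall d q, 0 <= d <= d0 -> ~ spine D q -> ~ tube D d (q + f1 q + f2 (q + f1 q))].
Proof.
have [rho rho0 [star sep]] := corner_radius wfD.
have [eta0 eta00 Heta] := edge_radius wfD rho0.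
have [C C1 HC] := edge_proj_lip wfD.
have HP := edge_proj_dist wfD HC.
pose eta := Num.min (rho / 2) (eta0 / 2).
have [etar etae] : eta <= rho / 2 /\ eta <= eta0 / 2 by rewrite !ge_min !lexx orbT.
have eta_gt0 : 0 < eta by rewrite lt_min !divr_gt0.
have CC : 0 < 2 * (1 + C) by lra.
(* By [edge_proj_dist], a point at distance [eta] from its projection is then more than [d0] away
   from the edge. *)
pose d0 := eta / (2 * (1 + C)).
have d00 : 0 < d0 by rewrite divr_gt0.
have d0C : (1 + C) * d0 = eta / 2.
  by rewrite /d0; field; rewrite gt_eqF//; lra.
have d0e : d0 <= eta / 2 by nra.
pose f1 q : R3 := \sum_(a : corner D) push rho (pos a) q.
pose f2 q : R3 := \sum_(e : edge D) push eta (edge_proj e q) q.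
have f1E q : (forall a : corner D, rho <= `|q - pos a|) /\ f1 q = 0 \/
    exists2 a : corner D, `|q - pos a| < rho & f1 q = push rho (pos a) q.
  have [[a qa]|nex] := pselect (exists a : corner D, `|q - pos a| < rho); [right|left].
    exists a => //; rewrite /f1 (bigD1 a)//= big1 ?addr0// => b ba.
    apply: push0; first exact: ltW.
    have := sep _ _ ba; have := ler_distD q (pos b) (pos a).
    by move: qa; rewrite (distrC (pos b) q); move: (`|_ - _|) (`|_ - _|) (`|_ - _|) => *; lra.
  have far a : rho <= `|q - pos a|.
    by rewrite leNgt; apply/negP => qa; apply: nex; exists a.
  by split=> //; rewrite /f1 big1// => a _; apply: push0 => //; exact: ltW.
have f1far q b : ~ spine D q -> rho <= `|q + f1 q - pos b|.
  move=> nq; case: (f1E q) => [[far ->]|[a qa ->]]; first by rewrite addr0.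
  have pn : `|q + push rho (pos a) q - pos a| = rho.
    apply: push_norm (ltW qa); apply/eqP => qE; apply: nq; rewrite qE.
    exact: spine_corner.
  have [<-|ab] := eqVneq a b; first by rewrite pn.
  exact: separation_far pn (sep _ _ ab).
have proj_far e q a : (forall a, rho <= `|q - pos a|) -> `|q - edge_proj e q| < eta ->
    rho / 2 <= `|edge_proj e q - pos a|.
  move=> /(_ a) far qe; have := ler_distD (edge_proj e q) q (pos a).
  by move: far qe; move: (`|_ - _|) (`|_ - _|) (`|_ - _|) => *; lra.
have proj_in e q : exists2 t, 0 <= t <= 1 & edge_proj e q = edge_point e t.
  by exists (clamp (edge_param e q)) => //; exact: clamp01.
have f2E q : (forall a, rho <= `|q - pos a|) ->
    (forall e, eta <= `|q - edge_proj e q|) /\ f2 q = 0 \/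
    exists2 e : edge D, `|q - edge_proj e q| < eta & f2 q = push eta (edge_proj e q) q.
  move=> far; have [[e qe]|nex] := pselect (exists e : edge D, `|q - edge_proj e q| < eta); [right|left].
    exists e => //; rewrite /f2 (bigD1 e)//= big1 ?addr0// => e' ee'.
    apply: push0; first exact: ltW.
    rewrite leNgt; apply/negP => qe'.
    have [t t01 tE] := proj_in e q; have [t' t'01 t'E] := proj_in e' q.
    have tfar a : rho / 2 <= `|edge_point e t - pos a| by rewrite -tE; exact: proj_far.
    have [||u u01 uE] := Heta e t t01 tfar (edge_point e' t').
    - by exists e', t'.
    - rewrite -tE -t'E; have := ler_distD q (edge_proj e q) (edge_proj e' q).
      move: qe qe'; rewrite (distrC (edge_proj e q) q).
      by move: (`|_ - _|) (`|_ - _|) (`|_ - _|) => *; lra.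
    have [_ [] u0] : (t' = 0 \/ t' = 1) /\ (u = 0 \/ u = 1).
      case: wfD => _ _ _ H _; apply: (H e' e) => //; first exact/eqP.
      by rewrite uE.
    + have := proj_far e' q (src e) far qe'; rewrite t'E uE u0 /edge_point subr0 scale1r.
      by rewrite scale0r addr0 subrr normr0; lra.
    + have := proj_far e' q (tgt e) far qe'; rewrite t'E uE u0 /edge_point subrr scale1r.
      by rewrite scale0r add0r subrr normr0; lra.
  have efar e : eta <= `|q - edge_proj e q|.
    by rewrite leNgt; apply/negP => qe; apply: nex; exists e.
  by split=> //; rewrite /f2 big1// => e _; apply: push0 => //; exact: ltW.
have A1 d q t : 0 <= d <= d0 -> 0 <= t <= 1 -> ~ tube D d q -> ~ tube D d (q + t *: f1 q).
  move=> /andP[dge0 dd] t01 nq; case: (f1E q) => [[_ ->]|[a qa ->]].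
    by rewrite scaler0 addr0.
  have [lam l1 [-> le]] := push_segment (pos a) q t01 (ltW rho0).
  apply: (@star_avoid _ _ _ _ rho) => //; last first.
    by apply: le_trans le _; rewrite ge_max lexx ltW.
  by move=> p u sp pp u01; apply: star => //; apply: le_trans pp _; lra.
exists d0 => //; exists f1, f2; split.
- move=> q nq; apply: sum_continuous => a; apply: (@push_continuous _ _ _ (fun=> pos a)).
  + exact: ltW.
  + apply/eqP => qE; apply: nq; rewrite qE.
    exact: spine_corner.
  + exact: cvg_cst.
- move=> q nq; apply: sum_continuous => e; apply: push_continuous; first exact: ltW.
  + apply/eqP => qE; apply: nq; have [t t01 tE] := proj_in e q.
    by exists e, t; split=> //; rewrite -tE.
  + exact: edge_proj_continuous.
- exact: A1.
- move=> d q t /andP[dge0 dd] t01 nq nqs; set q1 := q + f1 q in nq *.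
  have far a : rho <= `|q1 - pos a| by exact: f1far.
  case: (f2E q1 far) => [[_ ->]|[e qe ->]]; first by rewrite scaler0 addr0.
  have [lam l1 [-> le]] := push_segment (edge_proj e q1) q1 t01 (ltW eta_gt0).
  apply: (@star_avoid _ _ _ _ eta) => //; last first.
    by apply: le_trans le _; rewrite ge_max lexx ltW.
  move=> p u sp pp u01; have [v v01 vE] := proj_in e q1.
  have [|||w w01 wE] := Heta e v v01 _ p => //.
  + by move=> a; rewrite -vE; exact: proj_far.
  + by rewrite -vE; apply: le_trans pp _; lra.
  rewrite vE wE edge_point_segment; exists e, (v + u * (w - v)); split=> //.
  by move: v01 w01 u01 => /andP[? ?] /andP[? ?] /andP[? ?]; apply/andP; split; nra.
- move=> d q /andP[dge0 dd] nq; set q1 := q + f1 q.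
  have far a : rho <= `|q1 - pos a| by exact: f1far.
  have dC : (1 + C) * d < eta by nra.
  have nq1 : ~ spine D q1.
    rewrite -tube0 /q1 -[f1 q]scale1r; apply: A1; rewrite ?lexx ?ler01 ?tube0//.
    exact: ltW.
  case: (f2E q1 far) => [[efar ->]|[e qe ->]].
    rewrite addr0 => -[p [e [t [t01 ->]]] pd].
    have := efar e; have := HP e t q1 t01; have := normr_ge0 (q1 - edge_point e t).
    by move: pd; move: (`|_ - _|) (`|_ - _|) => *; nra.
  have [t t01 tE] := proj_in e q1.
  have ne : q1 != edge_proj e q1.
    by apply/eqP => qE; apply: nq1; exists e, t; split=> //; rewrite -tE.
  have pn := push_norm ne (ltW qe).
  have tfar a : rho / 2 <= `|edge_point e t - pos a| by rewrite -tE; exact: proj_far.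
  have t_in : 0 < t < 1.
    rewrite !lt_neqAle; move: (t01) => /andP[-> ->]; rewrite !andbT.
    apply/andP; split; apply/eqP => tz.
      have := tfar (src e); rewrite -tz /edge_point subr0 scale1r.
      by rewrite scale0r addr0 subrr normr0; lra.
    have := tfar (tgt e); rewrite tz /edge_point subrr scale1r.
    by rewrite scale0r add0r subrr normr0; lra.
  (* The parameter is not clamped here, so the push runs along a fibre of the projection to the line
     and leaves [edge_proj e] unchanged. *)
  have tp : t = edge_param e q1.
    have ct : clamp (edge_param e q1) = t.
      by rewrite -[RHS](edge_param_point wfD e) -tE edge_param_point.
    by rewrite -ct in t_in *; exact: clamp_inner.
  have o01 : 0 <= (1 : R) <= 1 by rewrite ler01 lexx.
  have [lam l1 [q2E _]] := push_segment (edge_proj e q1) q1 o01 (ltW eta_gt0).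
  rewrite scale1r in q2E; set q2 := q1 + _ in pn q2E *.
  have q2p : edge_proj e q2 = edge_proj e q1.
    have pt : edge_param e (edge_proj e q1) = edge_param e q1.
      by rewrite -tp tE edge_param_point.
    have : edge_param e q2 = edge_param e q1.
      by rewrite q2E edge_param_affine pt subrr mulr0 addr0.
    by rewrite /edge_proj => ->.
  move=> [p sp pd].
  have [|u u01 uE] := Heta e t t01 tfar p sp.
    rewrite -tE; apply: le_trans (ler_distD q2 _ _) _.
    by rewrite distrC pn; lra.
  have := HP e u q2 u01; rewrite q2p pn -uE.
  by move: pd (normr_ge0 (q2 - p)); move: (`|_ - _|) => *; nra.
Qed.
(** The bundle is pulled back along a retraction [r] that is homotopic to the identity outside the
    tube. The two stages [g2] and [g1] of the homotopy bring a reduction of the pullback back to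
    [tau]. *)
Lemma tube_reduction (G : groupType) : exists2 d0 : R, 0 < d0 & forall d tau, 0 < d <= d0 ->
  local_cocycle (~` tube D d) tau -> exists2 tau' : R3 -> R3 -> G,
    local_cocycle (~` spine D) tau' & forall S F', subgroup S ->
      reduction S (~` spine D) tau' F' -> exists F, reduction S (~` tube D d) tau F.
Proof.
have [d0 d00 [f1 [f2 [c1 c2 A1 A2 far]]]] := retraction_maps.
exists d0 => // d tau /andP[dgt0 dd] ltau.
have d01 : 0 <= d <= d0 by rewrite ltW.
have d0d : 0 <= (0 : R) <= d0 by rewrite lexx ltW.
have one : 0 <= (1 : R) <= 1 by rewrite ler01 lexx.
have sub q : ~ tube D d q -> ~ spine D q.
  by move=> nq sq; apply: nq; exists q => //; rewrite subrr normr0 ltW.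
pose r1 q : R3 := q + f1 q; pose r q : R3 := r1 q + f2 (r1 q).
have r1s q : ~ spine D q -> ~ spine D (r1 q).
  by move=> nq; rewrite -tube0 /r1 -[f1 q]scale1r; apply: A1 => //; rewrite tube0.
have cr1 q : ~ spine D q -> {for q, continuous r1}.
  by move=> nq; apply: cvgD; [exact: cvg_id|exact: c1].
have cr q : ~ spine D q -> {for q, continuous r}.
  move=> nq; apply: cvgD; first exact: cr1.
  by apply: continuous_comp; [exact: cr1|apply: c2; exact: r1s].
exists (fun x y => tau (r x) (r y)).
  apply: (local_cocycle_comp (spineC_open wfD) cr) ltau => q nq; exact: far.
move=> S F' sS red.
pose g2 (qt : R3 * R) : R3 := r1 qt.1 + (1 - qt.2) *: f2 (r1 qt.1).
pose g1 (qt : R3 * R) : R3 := qt.1 + (1 - qt.2) *: f1 qt.1.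
have flip t : 0 <= t <= 1 -> 0 <= 1 - t <= 1.
  by move=> /andP[? ?]; apply/andP; split; lra.
have [F2 red2] : exists F, reduction S (~` tube D d) (fun x y => tau (g2 (x, 1)) (g2 (y, 1))) F.
  apply: (@reduction_homotopy G R R3 R3 S _ _ tau g2 F' sS (@tubeC_open R D d) _ _ ltau).
  - move=> x t /sub nx.
    apply: (@continuous_comp _ _ _ (fun qt : R3 * R => (r1 qt.1, qt.2))
       (fun qt : R3 * R => qt.1 + (1 - qt.2) *: f2 qt.1)).
      apply: (@continuous_pair _ _ _ (fun qt : R3 * R => r1 qt.1) snd); last exact: cvg_snd.
      by apply: continuous_comp; [exact: cvg_fst|exact: cr1].
    by apply: homotopy_continuous; apply: c2; exact: r1s.
  - move=> x t nx t01; apply: A2 => //; [exact: flip| |exact: sub].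
    by rewrite -[f1 x]scale1r; apply: A1.
  - have E x : g2 (x, 0) = r x by rewrite /g2 /= subr0 scale1r.
    by move=> x /sub nx; have := red x nx; apply: filterS => y; rewrite !E.
have [F1 red1] : exists F, reduction S (~` tube D d) (fun x y => tau (g1 (x, 1)) (g1 (y, 1))) F.
  apply: (@reduction_homotopy G R R3 R3 S _ _ tau g1 F2 sS (@tubeC_open R D d) _ _ ltau).
  - by move=> x t /sub nx; apply: homotopy_continuous; exact: c1.
  - by move=> x t nx t01; apply: A1 => //; exact: flip.
  - have E x : g1 (x, 0) = g2 (x, 1) by rewrite /g1 /g2 /= subrr subr0 scale0r scale1r addr0.
    by move=> x nx; have := red2 x nx; apply: filterS => y; rewrite !E.
exists F1 => x nx; have := red1 x nx; apply: filterS => y.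
by rewrite /g1 /= subrr !scale0r !addr0.
Qed.
End Retract.

(** * Every bundle comes from a planar function *)

Section Monodromy.
Variables (R : realType) (D : diagram R).
Hypothesis wfD : wf_diagram D.
Local Notation R2 := (R * R)%type.
Local Notation R3 := (R * R * R)%type.
Implicit Types (e : edge D) (a b : corner D) (t u h z : R) (x y : R2) (p q : R3).
Variables (G : groupType) (tau : R3 -> R3 -> G).
Hypothesis ltau : local_cocycle (~` spine D) tau.

(** Sliding vertically to the height [z] carries the region into the slab [W], which is convex and
    beyond the whole spine, so that the bundle is trivial there. *)
Lemma column_reduction (A : set R3) (M z : R) :
  (forall e t, 0 <= t <= 1 -> `|ht e t| <= M) -> M + 1 <= `|z| -> open A ->
  (forall q t, A q -> 0 <= t <= 1 -> ~ spine D (q.1, z + t * (q.2 - z))) ->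
  exists F, reduction (@trivial_subgroup G) A tau F.
Proof.
move=> HM Mz oA col; pose W : set R3 := [set p | `|p.2 - z| < 1].
have Wsp p : W p -> ~ spine D p.
  move=> Wp /spine_over [e [t [[t01 _] E]]].
  have := HM e t t01; rewrite E; have := ler_distD p.2 z 0; rewrite !subr0 distrC.
  by move: Wp; rewrite /W /=; lra.
have oW : open W.
  rewrite openE => p Wp.
  suff : \forall q \near p, W q by [].
  apply/near_norm; exists (1 - `|p.2 - z|); first by rewrite subr_gt0.
  move=> q pq; have tri : `|q.2 - z| <= `|p.2 - q.2| + `|p.2 - z|.
    by rewrite (distrC p.2 q.2) ler_distD.
  have h : `|p.2 - q.2| <= `|p - q| by rewrite (norm_pair (p - q)) le_max lexx orbT.
  by apply: le_lt_trans tri _; rewrite -ltrBrDr; exact: le_lt_trans h pq.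
have [F0 red0] : exists F, reduction (@trivial_subgroup G) W tau F.
  apply: (reduction_star (o := (0, z)) oW _ ltau) => p t Wp /andP[t0 t1].
  apply: Wsp; rewrite /W /= [X in `|X|](_ : _ = t * (p.2 - z)); last first.
    by rewrite /GRing.scale /=; ring.
  rewrite normrM ger0_norm//; have := normr_ge0 (p.2 - z); move: Wp; rewrite /W /=; nra.
pose gam (qt : R3 * R) : R3 := (qt.1.1, z + qt.2 * (qt.1.2 - z)).
have cg : continuous gam.
  move=> qt; apply: (@continuous_pair _ _ _ (fun qt : R3 * R => qt.1.1)
     (fun qt : R3 * R => z + qt.2 * (qt.1.2 - z))).
    by apply: (@continuous_comp _ _ _ (fst : R3 * R -> R3) (fst : R3 -> R2)); exact: cvg_fst.
  apply: (@cvgD _ R^o); first exact: cvg_cst.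
  apply: (@cvgM R); first exact: cvg_snd.
  apply: (@cvgB _ R^o); last exact: cvg_cst.
  apply: (@continuous_comp _ _ _ (fst : R3 * R -> R3) (snd : R3 -> R)).
    exact: cvg_fst.
  exact: cvg_snd.
have [F red] : exists F, reduction (@trivial_subgroup G) A
    (fun p p' : R3 => tau (gam (p, 1)) (gam (p', 1))) F.
  apply: (@reduction_homotopy G R R3 R3 _ A _ tau gam (fun q => F0 (gam (q, 0)))
    (@trivial_subgroupP G) oA _ _ ltau).
  - by move=> x t _; exact: cg.
  - by move=> q t Aq t01; exact: col.
  - move=> q Aq; have Wq : W (gam (q, 0)) by rewrite /W /gam /= mul0r addr0 subrr normr0.
    have c0 : {for q, continuous (fun q => gam (q, 0))}.
      apply: (@continuous_comp _ _ _ (fun q : R3 => (q, 0)) gam); last exact: cg.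
      by apply: continuous_pair; [exact: cvg_id|exact: cvg_cst].
    exact: (continuous_near c0 (red0 _ Wq)).
have E q : gam (q, 1) = q by rewrite /gam /= mul1r addrC subrK -surjective_pairing.
by exists F => q /red; apply: filterS => q'; rewrite !E.
Qed.

Definition under_region : set R3 := [set q | ~ spine D q /\ ~ above_spine D q].
Definition over_region : set R3 := [set q | ~ spine D q /\ ~ below_spine D q].

Lemma under_region_open : open under_region.
Proof.
rewrite openE => q [nsq naq].
have H1 := near_over wfD nsq.
have H2 : \forall q' \near q, ~ spine D q' by move: (spineC_open wfD); rewrite openE; exact.
apply: filterS2 H1 H2 => q' H nsq'; split=> // -[e [t [ov lt]]].
by apply: naq; have [t0 [ov0 E]] := H e t ov; exists e, t0; rewrite -E.
Qed.

Lemma over_region_open : open over_region.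
Proof.
rewrite openE => q [nsq naq].
have H1 := near_over wfD nsq.
have H2 : \forall q' \near q, ~ spine D q' by move: (spineC_open wfD); rewrite openE; exact.
apply: filterS2 H1 H2 => q' H nsq'; split=> // -[e [t [ov lt]]].
apply: naq; have [t0 [ov0 E]] := H e t ov.
exists e, t0; split=> //; rewrite lt_neqAle leNgt -E -leNgt (ltW lt) andbT.
by apply/eqP => E'; apply: nsq; apply/spine_over; exists e, t0.
Qed.

(** A point without spine below it can slide down to the height [- (M + 1)], one without spine above
    it can slide up to [M + 1]. *)
Lemma region_reductions : exists FB FP : R3 -> G,
  (forall q, under_region q -> \forall q' \near q, tau q q' = (FB q)^-1 * FB q')%g /\
  (forall q, over_region q -> \forall q' \near q, tau q q' = (FP q)^-1 * FP q')%g.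
Proof.
have triv A F : reduction (@trivial_subgroup G) A tau F ->
    (forall q, A q -> \forall q' \near q, tau q q' = (F q)^-1 * F q')%g.
  move=> red q Aq; apply: filterS (red q Aq) => q' /eqP.
  by rewrite /trivial_subgroup mulg_eq1 invgK => /eqP <-; rewrite mulKg.
have [M [M0 HM]] := height_bounded D.
have Mz : M + 1 <= `|M + 1| by exact: ler_norm.
have bd e t q : lies_over e t q.1 -> `|ht e t| <= M by move=> [t01 _]; exact: HM.
have [|||FB redB] := @column_reduction under_region M (- (M + 1)) HM.
- by rewrite normrN.
- exact: under_region_open.
- move=> q t [nsq na] /andP[t0 t1] /spine_over [e [u [ov /= E]]].
  have := bd e u q ov; rewrite ler_norml => /andP[l1 l2].
  have [lt|gt|eq] := ltgtP (ht e u) q.2.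
  + by apply: na; exists e, u.
  + by have [h|h] := leP 0 (q.2 + (M + 1)); move: E; nra.
  + by apply: nsq; apply/spine_over; exists e, u.
have [|||FP redP] := @column_reduction over_region M (M + 1) HM.
- by [].
- exact: over_region_open.
- move=> q t [nsq na] /andP[t0 t1] /spine_over [e [u [ov /= E]]].
  have := bd e u q ov; rewrite ler_norml => /andP[l1 l2].
  have [lt|gt|eq] := ltgtP (ht e u) q.2.
  + by have [h|h] := leP 0 (M + 1 - q.2); move: E; nra.
  + by apply: na; exists e, u.
  + by apply: nsq; apply/spine_over; exists e, u.
by exists FB, FP; split; exact: triv.
Qed.

Variables FB FP : R3 -> G.
Hypothesis HB : forall q, under_region q -> \forall q' \near q, (tau q q' = (FB q)^-1 * FB q')%g.
Hypothesis HP : forall q, over_region q -> \forall q' \near q, (tau q q' = (FP q)^-1 * FP q')%g.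

(* The monodromy from far below to far above, which over the complement of the
   shadow does not depend on the height. *)
Definition monodromy x : G := (FP (x, 0) * (FB (x, 0))^-1)%g.

Lemma region_outer q : ~ shade D q.1 -> under_region q /\ over_region q.
Proof.
move=> nx; split; split.
- by move=> /spine_over [e [t [[t01 E] _]]]; apply: nx; exists e, t.
- by move=> [e [t [[t01 E] _]]]; apply: nx; exists e, t.
- by move=> /spine_over [e [t [[t01 E] _]]]; apply: nx; exists e, t.
- by move=> [e [t [[t01 E] _]]]; apply: nx; exists e, t.
Qed.

Lemma gauge_quotient q : under_region q -> over_region q ->
  \forall q' \near q, (FP q' * (FB q')^-1 = FP q * (FB q)^-1)%g.
Proof.
move=> uq oq; apply: filterS2 (HB uq) (HP oq) => q' -> /(congr1 (fun g => FP q * g)%g).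
by rewrite mulVKg => <-; rewrite !mulgA mulgK.
Qed.

Lemma monodromyE q : ~ shade D q.1 -> (FP q * (FB q)^-1)%g = monodromy q.1.
Proof.
move=> nx; pose P p := (FP p * (FB p)^-1 = monodromy q.1)%g.
apply: (@line_induction R _ (q.1, 0) q P) => // t t01 /=.
set p := (q.1, 0) + _; have px : p.1 = q.1.
  by rewrite /p /= subrr scaler0 addr0.
have [up op] := @region_outer p ltac:(by rewrite px).
by apply: filterS (gauge_quotient up op) => p'; rewrite /P => ->.
Qed.

Lemma monodromy_lconst : lconst D monodromy.
Proof.
move=> x nx; have [ux ox] := @region_outer (x, 0) nx.
have c : {for x, continuous (fun y : R2 => (y, 0 : R))}.
  by apply: continuous_pair; [exact: cvg_id|exact: cvg_cst].
exact: (continuous_near c (gauge_quotient ux ox)).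
Qed.

(* As a function of [p] near [q] this is locally constant on the under region;
   its jumps across a wall are those of [monodromy]. *)
Definition relative q p : G := (tau q p * (FB p)^-1)%g.

Lemma relative_const q : ~ spine D q -> \forall p \near q, under_region p ->
  \forall p' \near p, relative q p' = relative q p.
Proof.
move=> nq; apply: filterS (ltau nq) => p H up.
by apply: filterS2 H (HB up) => p' E E'; rewrite /relative E E' !mulgA mulgK.
Qed.

Lemma relative_change q : ~ spine D q -> \forall q1 \near q, \forall p \near q1,
  relative q p = (tau q q1 * relative q1 p)%g.
Proof.
move=> nq; apply: filterS (ltau nq) => q1; apply: filterS => p E.
by rewrite /relative E mulgA.
Qed.

Lemma relative_over q : over_region q -> \forall p \near q, ~ shade D p.1 ->
  relative q p = ((FP q)^-1 * monodromy p.1)%g.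
Proof.
move=> oq; apply: filterS (HP oq) => p E np.
by rewrite /relative E -mulgA monodromyE.
Qed.

End Monodromy.

Section Cosets.
Variables (R : realType) (D : diagram R).
Hypothesis wfD : wf_diagram D.
Local Notation R2 := (R * R)%type.
Local Notation R3 := (R * R * R)%type.
Implicit Types (e : edge D) (a b : corner D) (t u h z : R) (x y : R2) (p q : R3).
Variables (G : groupType) (K : R2 -> G) (L Rv : edge D -> G) (S : G -> Prop).
Hypothesis lK : lconst D K.
Hypothesis KL : forall e, side_value K e (dir e) (L e).
Hypothesis KR : forall e, side_value K e (- dir e) (Rv e).
Hypothesis sS : subgroup S.
Hypothesis SJ : forall e, S (edge_jump L Rv e).

Lemma segment_avoids (x0 x y : R2) s : det2 (x - x0) (y - x0) != 0 ->
  x + s *: (y - x) != x0.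
Proof.
move=> d0; apply: contra_neq d0 => E.
have -> : x - x0 = - (s *: (y - x)) by rewrite -E opprD addrA subrr add0r.
have -> : y - x0 = (1 - s) *: (y - x).
  by rewrite -E opprD addrA scalerBl scale1r.
by rewrite det2Nl det2Zl det2Zr det2xx !mulr0 oppr0.
Qed.

Definition coset_near x0 := exists w : G, \forall x \near x0, ~ shade D x -> S (w * K x)%g.

Lemma coset_near_regular x : (forall a, x <> shadow a) -> coset_near x.
Proof.
move=> nc; have [sx|nx] := pselect (shade D x); last first.
  exists (K x)^-1%g; apply: filterS (lK nx) => y -> _; rewrite mulVg; exact: sub1.
have [[e [t [t01 xE]]]|[a xE]] := shade_cases sx; last by case: (nc a).
exists (Rv e)^-1%g; rewrite xE.
have H1 := near_inner wfD e t01; have H2 := KL e t01; have H3 := KR e t01.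
apply: filterS (filterI H1 (filterI H2 H3)) => y [[_ line] [l r]] ny.
have [d|d|d] := ltgtP (det2 (dir e) (y - sh e t)) 0.
- by rewrite r ?det2Nl ?oppr_gt0// mulVg; exact: sub1.
- by rewrite l//; exact: SJ.
- have [u /andP[u0 u1] yE] := line d; case: ny; exists e, u.
  by rewrite yE !ltW.
Qed.

(** A disc without its centre is connected: segments that avoid the centre link any two points, with
    a perpendicular detour when they are collinear with it. The coset of [K] is recorded as the set
    [F] of admissible factors, which is locally constant there. *)
Lemma coset_near_all x0 : coset_near x0.
Proof.
have [[a xE]|nc] := pselect (exists a : corner D, x0 = shadow a); last first.
  by apply: coset_near_regular => a xE; apply: nc; exists a.
have [d d0 Hd] := (near_norm _ _).1 (near_corner_unique D x0).
pose F x : set G := [set w | S (w * K x)%g].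
have F_near x : `|x0 - x| < d -> x != x0 -> exists W, \forall y \near x, ~ shade D y -> F y = W.
  move=> xd xn; have [|w Hw] := @coset_near_regular x.
    by move=> c xE'; have := Hd x xd c (esym xE') => /eqP; rewrite (negbTE xn).
  exists [set v | S (v * w^-1)%g]; apply: filterS Hw => y Hy ny; have Sy := Hy ny.
  apply/seteqP; split=> v /=; rewrite /F /=.
    by rewrite -{1}[v](mulgVK w) -mulgA => /(subMr sS _ Sy).
  by rewrite -{2}[v](mulgVK w) -mulgA => h; apply/(subMr sS _ Sy).
have conn1 x y W : `|x0 - x| < d -> `|x0 - y| < d -> det2 (x - x0) (y - x0) != 0 ->
    (\forall q \near x, ~ shade D q -> F q = W) -> \forall q \near y, ~ shade D q -> F q = W.
  move=> xd yd n0; apply: (generic_induction (@shade_generic_dense _ _ wfD)) => s s01.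
  apply: F_near; last exact: segment_avoids.
  exact: ball_convex.
have conn x y W : `|x0 - x| < d -> `|x0 - y| < d -> x != x0 -> y != x0 ->
    (\forall q \near x, ~ shade D q -> F q = W) -> \forall q \near y, ~ shade D q -> F q = W.
  move=> xd yd xn yn H.
  have [z0|] := eqVneq (det2 (x - x0) (y - x0)) 0; last by move=> n0; exact: (conn1 x).
  have xx0 : x - x0 != 0 by rewrite subr_eq0.
  have [k k0 Hk] : exists2 k : R, 0 < k & `|x0 - (x0 + k *: rot2 (x - x0))| < d.
    have Hb : \forall y \near x0, `|x0 - y| < d by apply: near_ball_lt; rewrite subrr normr0.
    have [k k0 Hk] := near_push (rot2 (x - x0)) Hb; exists k => //; apply: Hk.
    by rewrite k0 lexx.
  have zz : (x0 + k *: rot2 (x - x0)) - x0 = k *: rot2 (x - x0) by rewrite addrC addKr.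
  have xz : det2 (x - x0) ((x0 + k *: rot2 (x - x0)) - x0) != 0.
    by rewrite zz det2Zr det2_rot2 mulf_neq0 ?gt_eqF// dot2_gt0.
  apply: (conn1 (x0 + k *: rot2 (x - x0))) => //; last exact: (conn1 x).
  have [c yE] : exists c, y - x0 = c *: (x - x0).
    by exists (dot2 (x - x0) (y - x0) / dot2 (x - x0) (x - x0)); exact: det2_eq0P.
  have c0 : c != 0.
    by apply: contra_neq yn => c0; apply/eqP; rewrite -subr_eq0 yE c0 scale0r.
  by rewrite det2C oppr_eq0 yE det2Zl mulf_neq0.
have Hx0 : \forall y \near x0, `|x0 - y| < d by apply: near_ball_lt; rewrite subrr normr0.
have [r nr rd] := shade_generic_dense wfD Hx0.
have x0n y : ~ shade D y -> y != x0.
  by move=> ny; apply/eqP => yE; apply: ny; rewrite yE xE; exact: shade_shadow.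
have [W HW] := F_near r rd (x0n _ nr).
exists (K r)^-1%g; apply: filterS Hx0 => x xd nx.
have HWx := conn r x W rd xd (x0n _ nr) (x0n _ nx) HW.
have : F x (K r)^-1%g.
  rewrite (nbhs_singleton HWx nx) -(nbhs_singleton HW nr) /F /= mulVg; exact: sub1.
by [].
Qed.

End Cosets.

Lemma convex_comb_gt0 (R : realType) (s a b u : R) : 0 <= u <= 1 -> 0 < s * a -> 0 < s * b ->
  0 < s * ((1 - u) * a + u * b).
Proof.
move=> /andP[u0 u1] sa sb.
have -> : s * ((1 - u) * a + u * b) = (1 - u) * (s * a) + u * (s * b) by ring.
have [u00|ugt] := leP u 0.
  by rewrite (_ : u = 0) ?subr0 ?mul1r ?mul0r ?addr0//; lra.
have h1 : 0 <= (1 - u) * (s * a) by rewrite mulr_ge0 ?subr_ge0 ?(ltW sa).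
have h2 : 0 < u * (s * b) by rewrite mulr_gt0.
exact: ltr_wpDl h1 h2.
Qed.

Section UnderStrand.
Variables (R : realType) (D : diagram R).
Hypothesis wfD : wf_diagram D.
Implicit Types (e f : edge D) (a b : corner D).

Lemma crossing_corners a b c : passes_over a b -> shadow c = shadow b -> c = a \/ c = b.
Proof.
move=> [sab hab] sc; have ne : a <> b by move=> E; rewrite E ltxx in hab.
have [_ _ _ H] : generic_crossing a b by case: wfD => _ _ _ _; apply.
by apply: H; rewrite sab.
Qed.

Lemma crossing_strand a b : passes_over a b -> exists e0, [/\ tgt e0 = b,
  exists e1, src e1 = b & forall f, incident f b -> exists2 k : R, 0 < k & dir f = k *: dir e0].
Proof.
move=> ab; have [sab hab] := ab.
have ne : b <> a by move=> E; rewrite E ltxx in hab.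
have [[bi bo] bcol _ _] : generic_crossing b a by case: wfD => _ _ _ _; apply.
have [e0 te0] : exists e, tgt e = b.
  have : (0 < indegree b)%N by rewrite bi.
  by rewrite /indegree card_gt0 => /set0Pn[e]; rewrite inE => /eqP; exists e.
have uniq_in e : tgt e = b -> e = e0.
  move/eqP: bi; rewrite /indegree => /cards1P[e1 E].
  have H f : tgt f = b -> f = e1.
    by move=> tf; apply/set1P; rewrite -E inE tf.
  by move=> /H ->; rewrite (H e0).
have [e1 se1] : exists e, src e = b.
  have : (0 < outdegree b)%N by rewrite bo.
  by rewrite /outdegree card_gt0 => /set0Pn[e]; rewrite inE => /eqP; exists e.
exists e0; split=> //; first by exists e1.
move=> f /orP[/eqP sf|/eqP tf]; first exact: bcol.
by rewrite (uniq_in f tf); exists 1; rewrite ?scale1r.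
Qed.

End UnderStrand.

Section MonodromyReduction.
Variables (R : realType) (D : diagram R).
Hypothesis wfD : wf_diagram D.
Local Notation R2 := (R * R)%type.
Local Notation R3 := (R * R * R)%type.
Implicit Types (e f : edge D) (a b : corner D) (t u h z : R) (x y : R2) (p q : R3).
Variables (G : groupType) (tau : R3 -> R3 -> G).
Hypothesis ltau : local_cocycle (~` spine D) tau.
Variables FB FP : R3 -> G.
Hypothesis HB : forall q, under_region D q -> \forall q' \near q, (tau q q' = (FB q)^-1 * FB q')%g.
Hypothesis HP : forall q, over_region D q -> \forall q' \near q, (tau q q' = (FP q)^-1 * FP q')%g.
Local Notation K := (monodromy FB FP).
Local Notation relative := (relative tau FB).
Variables (L Rv : edge D -> G).
Hypothesis KL : forall e, side_value K e (dir e) (L e).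
Hypothesis KR : forall e, side_value K e (- dir e) (Rv e).

Section Between.
Variables (a b : corner D) (h : R).
Hypothesis ab : passes_over a b.
Hypothesis hab : height b < h < height a.
Local Notation q := (shadow b, h).

Lemma between_over e t : lies_over e t (shadow b) -> ht e t != h /\
  (ht e t < h -> incident e b /\ sh e t = shadow b).
Proof.
move=> ov; have [t01 E] := ov; move: hab => /andP[hb ha].
have [t0|[c [ec sc hc _]]] := over_cases ov; first by case: (inner_neq_shadow wfD t0 E).
rewrite -hc; case: (crossing_corners wfD ab sc) => cE; rewrite cE.
  by rewrite gt_eqF//; split=> // lt; have := lt_trans lt ha; rewrite ltxx.
by split; [rewrite lt_eqF|move=> _; split; rewrite // -cE].
Qed.

Lemma between_spine : ~ spine D q.
Proof. by move=> /spine_over [e [t [/between_over[/eqP H _] E]]]. Qed.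

(** At a height strictly between the strands, [relative q] can change only across the lower strand.
    Both edges of that strand see the same change, and this forces the monodromy to have the same
    jump along them. *)
Lemma between_jump : exists d : R2, d != 0 /\ exists cl cr : G,
  (forall f, incident f b -> (cr^-1 * cl)%g = edge_jump L Rv f) /\
  \forall p \near q, 0 < det2 d (p.1 - shadow b) /\ relative q p = cl \/
    det2 d (p.1 - shadow b) < 0 /\ relative q p = cr \/ det2 d (p.1 - shadow b) = 0.
Proof.
have [e0 [te0 _ par]] := crossing_strand wfD ab.
have nsq := between_spine; exists (dir e0); split; first exact: dir_neq0.
have offline : \forall p \near q, det2 (dir e0) (p.1 - shadow b) != 0 -> under_region D p.
  have H1 := near_over wfD nsq.
  have H2 : \forall q' \near q, ~ spine D q' by move: (spineC_open wfD); rewrite openE; exact.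
  apply: filterS2 H1 H2 => p H np d0; split=> // -[e [t [ov lt]]].
  have [t0 [ov0 E]] := H e t ov; rewrite lt in E.
  have [eb s0] := (between_over ov0).2 (esym E).
  have [k k0 dE] := par e eb; move/eqP: d0; apply.
  by rewrite -s0 -(proj2 ov) shB dE det2Zr det2Zr det2xx !mulr0.
have rc := relative_const ltau HB nsq.
have ch := relative_change ltau FB nsq.
have [r r0 Hr] := (near_norm _ _).1 (filterI offline (filterI rc ch)).
have half (s : R) p p' : s != 0 -> `|q - p| < r -> `|q - p'| < r -> 0 < s * det2 (dir e0) (p.1 - shadow b) ->
    0 < s * det2 (dir e0) (p'.1 - shadow b) -> relative q p = relative q p'.
  move=> s0 pr pr' dp dp'.
  pose C : set R3 := [set p | `|q - p| < r /\ 0 < s * det2 (dir e0) (p.1 - shadow b)].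
  apply: (@convex_induction R _ C (fun p => relative q p = relative q p') p' p) => //.
  - move=> p1 p2 u [a1 b1] [a2 b2] u01; split; first exact: ball_convex.
    have -> : det2 (dir e0) ((p1 + u *: (p2 - p1)).1 - shadow b) =
        (1 - u) * det2 (dir e0) (p1.1 - shadow b) + u * det2 (dir e0) (p2.1 - shadow b).
      by move: (dir e0) (shadow b) => d c; rewrite /det2 /= /GRing.scale /=; ring.
    exact: convex_comb_gt0.
  - move=> p1 [a1 b1]; have [H1 [H2 _]] := Hr p1 a1.
    have : under_region D p1 by apply: H1; apply: contraTneq b1 => ->; rewrite mulr0 ltxx.
    by move=> /H2; apply: filterS => p2 ->.
(* After a small step along [f] at constant height, [f] is the only edge on the vertical and lies
   below. There [relative] is the monodromy up to a left factor [T], which depends on [f] but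
   cancels in the jump. *)
have edge_near f : incident f b -> exists T : G, exists pl pr : R3,
   [/\ `|q - pl| < r, `|q - pr| < r, 0 < det2 (dir e0) (pl.1 - shadow b),
       det2 (dir e0) (pr.1 - shadow b) < 0 & relative q pl = T * L f /\ relative q pr = T * Rv f]%g.
  move=> fb; have [k k0 kE] := par f fb.
  have [t0 t001 ft0] := incident_sh fb.
  have sht0 : sh f t0 = shadow b by rewrite /sh ft0.
  have [t t01 [qt lt]] : exists2 t, 0 < t < 1 & `|q - (sh f t, h)| < r /\ ht f t < h.
    have c1 : {for t0, continuous (fun t => (sh f t, h))}.
      by apply: continuous_pair; [exact: sh_continuous|exact: cvg_cst].
    have N1 : \forall p \near (sh f t0, h), `|q - p| < r.
      by apply: near_ball_lt; rewrite sht0 subrr normr0.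
    have N2 : \forall v \near ht f t0, v < h.
      by apply: lt_nbhsl; rewrite /ht ft0; case/andP: hab.
    have N3 : \forall t \near t0, `|q - (sh f t, h)| < r /\ ht f t < h.
      exact: (filterI (continuous_near c1 N1) (continuous_near (@ht_continuous _ _ f t0) N2)).
    have [d d0 Hd] := (near_norm _ _).1 N3; pose v := Num.min (d / 2) (1 / 2).
    have [v1 v2] : v <= d / 2 /\ v <= 1 / 2 by rewrite !ge_min !lexx orbT.
    have v0 : 0 < v by rewrite lt_min !divr_gt0.
    case: t001 => t0E.
      exists v; first by apply/andP; split; lra.
      by apply: Hd; rewrite t0E sub0r normrN gtr0_norm//; lra.
    exists (1 - v); first by apply/andP; split; lra.
    by apply: Hd; rewrite t0E opprB addrC subrK gtr0_norm//; lra.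
  pose q1 : R3 := (sh f t, h).
  have only e u : lies_over e u (sh f t) -> ht e u = ht f t.
    by move=> [u01 E]; have [<- <-] := inner_unique wfD t01 u01 (esym E).
  have oq1 : over_region D q1.
    split; first by move=> /spine_over [e [u [/only -> E]]]; rewrite E ltxx in lt.
    by move=> [e [u [/only -> gt]]]; have := lt_trans lt gt; rewrite ltxx.
  have cx : {for sh f t, continuous (fun x : R2 => (x, h))}.
    by apply: continuous_pair; [exact: cvg_id|exact: cvg_cst].
  have N1 : \forall p \near q1, relative q p = (tau q q1 * relative q1 p)%g := (Hr q1 qt).2.2.
  have N2 := relative_over HB HP oq1.
  have N3 : \forall p \near q1, `|q - p| < r by exact: near_ball_lt.
  have N : \forall x \near sh f t,
      (relative q (x, h) = tau q q1 * relative q1 (x, h) /\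
       ((~ shade D x -> relative q1 (x, h) = (FP q1)^-1 * K x) /\ (`|q - (x, h)| < r)%R))%g /\
      ((0 < det2 (dir f) (x - sh f t) -> K x = L f) /\
       (0 < det2 (- dir f) (x - sh f t) -> K x = Rv f)).
    exact: (filterI (continuous_near cx (filterI N1 (filterI N2 N3))) (filterI (KL f t01) (KR f t01))).
  have detE x : det2 (dir f) (x - sh f t) = k * det2 (dir e0) (x - shadow b).
    have -> : x - shadow b = (x - sh f t) + (t - t0) *: dir f.
      by rewrite -shB sht0 addrA subrK.
    by rewrite [in RHS]det2Dr det2Zr kE det2Zl det2Zr det2xx !mulr0 addr0.
  have [xl [nl [[H1 [H2 H3]] [H4 _]] dl]] := near_side wfD (dir_neq0 wfD f) N.
  have nd : - dir f != 0 by rewrite oppr_eq0 dir_neq0.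
  have [xr [nr [[H5 [H6 H7]] [_ H8]] dr]] := near_side wfD nd N.
  exists (tau q q1 * (FP q1)^-1)%g, (xl, h), (xr, h); split=> //=.
  - by move: dl; rewrite detE pmulr_rgt0.
  - by move: dr; rewrite det2Nl detE oppr_gt0 pmulr_rlt0.
  - split; first by rewrite H1 H2//= H4// mulgA.
    by rewrite H5 H6//= H8// mulgA.
have [|T [pl0 [pr0 [l0r r0r dl0 dr0 [El Er]]]]] := edge_near e0; first by rewrite /incident te0 eqxx orbT.
exists (T * L e0)%g, (T * Rv e0)%g; split.
  move=> f /edge_near[T' [pl [pr [lr rr dl dr [El' Er']]]]].
  rewrite -El -Er (half 1 pl0 pl) ?oner_neq0 ?mul1r// (half (-1) pr0 pr) ?mulN1r ?oppr_gt0//.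
    by rewrite El' Er' /edge_jump invgM -mulgA mulKg.
  by rewrite oppr_eq0 oner_neq0.
apply/near_norm; exists r => // p pr.
have [d|d|d] := ltgtP (det2 (dir e0) (p.1 - shadow b)) 0; last by right; right.
- right; left; split=> //; rewrite -Er; apply: (half (-1)); rewrite ?mulN1r ?oppr_gt0//.
  by rewrite oppr_eq0 oner_neq0.
- by left; split=> //; rewrite -El; apply: (half 1); rewrite ?mul1r// oner_neq0.
Qed.

End Between.

Hypothesis lK : lconst D K.

Lemma monodromy_under_compatible : under_compatible L Rv.
Proof.
move=> a b e e' ab te se; have [_ hab] := ab.
have h : height b < (height b + height a) / 2 < height a by apply/andP; split; lra.
have [d [_ [cl [cr [H _]]]]] := between_jump ab h.
by rewrite -!H /incident ?te ?se ?eqxx ?orbT.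
Qed.

Variable S : G -> Prop.
Hypothesis sS : subgroup S.
Hypothesis SJ : forall e, S (edge_jump L Rv e).

(** Where no spine lies below, [relative] is constant; where none lies above, it is the monodromy up
    to a factor; between two strands it takes two values that differ by a jump. *)
Lemma relative_coset q : ~ spine D q -> exists w : G, \forall p \near q,
  ~ shade D p.1 -> S (w * relative q p)%g.
Proof.
move=> nsq; have [aq|naq] := pselect (above_spine D q); last first.
  exists (FB q); have uq : under_region D q by [].
  apply: filterS (HB uq) => p E _; rewrite /relative E mulgK mulgV; exact: sub1.
have [bq|nbq] := pselect (below_spine D q); last first.
  have oq : over_region D q by [].
  have [w Hw] := coset_near_all wfD lK KL KR sS SJ q.1.
  exists (w * FP q)%g; have N1 := relative_over HB HP oq.
  have N2 : \forall p \near q, ~ shade D p.1 -> S (w * K p.1)%g.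
    exact: (continuous_near (f := fst) (@cvg_fst _ _ _ _ _) Hw).
  apply: filterS2 N1 N2 => p E Hp np.
  by rewrite E// mulgA mulgK; exact: Hp.
have [a [b [ab [_ sb] hab _]]] := between_crossing wfD aq bq.
have [d [d0 [cl [cr [HJ Hn]]]]] := between_jump ab hab.
have [e0 [te0 _ _]] := crossing_strand wfD ab.
have SJ0 : S (cr^-1 * cl)%g by rewrite (HJ e0) ?/incident ?te0 ?eqxx ?orbT.
have qE : (shadow b, q.2) = q by rewrite sb -surjective_pairing.
rewrite qE in Hn; exists cr^-1%g.
have rc := relative_const ltau HB nsq.
have [r r0 Hr] := (near_norm _ _).1 (filterI Hn rc).
apply/near_norm; exists r => // p pr np.
have ok p' : `|q - p'| < r -> det2 d (p'.1 - shadow b) != 0 -> S (cr^-1 * relative q p')%g.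
  move=> pr' dn; have [H _] := Hr p' pr'; case: H => [[_ ->//]|[[_ ->]|E]].
    by rewrite mulVg; exact: sub1.
  by rewrite E eqxx in dn.
have [dz|dn] := eqVneq (det2 d (p.1 - shadow b)) 0; last exact: ok.
have [up _] := region_outer np; have [_ /(_ up) Hp] := Hr p pr.
have cx : {for p.1, continuous (fun x : R2 => (x, p.2))}.
  by apply: continuous_pair; [exact: cvg_id|exact: cvg_cst].
have Hp' : \forall p' \near (p.1, p.2), relative q p' = relative q p /\ `|q - p'| < r.
  by rewrite -surjective_pairing; exact: (filterI Hp (near_ball_lt pr)).
have [x [_ [<- xr] dx]] := near_side wfD d0 (continuous_near cx Hp').
apply: ok => //=; have -> : x - shadow b = (x - p.1) + (p.1 - shadow b).
  by rewrite addrA subrK.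
by rewrite det2Dr dz addr0 gt_eqF.
Qed.

(** [F] picks the factor of [relative_coset] at each point; two neighbouring choices are compared at
    a common nearby point off the shadow. *)
Lemma monodromy_reduction : exists F, reduction S (~` spine D) tau F.
Proof.
have /choice[F HF] q : exists w : G, ~ spine D q -> \forall p \near q,
    ~ shade D p.1 -> S (w * relative q p)%g.
  by have [sq|/relative_coset[w Hw]] := pselect (spine D q); [exists 1%g|exists w].
exists F => q nq.
have N2 : \forall q' \near q, ~ spine D q' by move: (spineC_open wfD); rewrite openE; exact.
have N1 := relative_change ltau FB nq.
have [r r0 Hr] := (near_norm _ _).1 (filterI (HF q nq) (filterI N1 N2)).
apply/near_norm; exists r => // q' qr.
have [_ [H1 nq']] := Hr q' qr.
have Hp : \forall p \near (q'.1, q'.2), relative q p = (tau q q' * relative q' p)%g /\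
    (`|q - p| < r /\ (~ shade D p.1 -> S (F q' * relative q' p)%g)).
  rewrite -surjective_pairing.
  exact: (filterI H1 (filterI (near_ball_lt qr) (HF q' nq'))).
have cx : {for q'.1, continuous (fun x : R2 => (x, q'.2))}.
  by apply: continuous_pair; [exact: cvg_id|exact: cvg_cst].
have [x nx [E [xr H]]] := shade_generic_dense wfD (continuous_near cx Hp).
have [H3 _] := Hr _ xr; have := H3 nx; rewrite E => S1.
have := H nx => S2.
have := subM sS S1 (subV sS S2); move: (relative q' _) => v.
by rewrite invgM !mulgA mulgK.
Qed.
End MonodromyReduction.

Theorem monodromy_exists (R : realType) (D : diagram R) (G : groupType)
    (tau : R * R * R -> R * R * R -> G) : wf_diagram D ->
  local_cocycle (~` spine D) tau -> exists (K : R * R -> G) (L Rv : edge D -> G),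
  [/\ lconst D K, forall e, side_value K e (dir e) (L e) /\ side_value K e (- dir e) (Rv e),
      under_compatible L Rv &
      forall S, subgroup S -> (forall e, S (edge_jump L Rv e)) ->
        exists F, reduction S (~` spine D) tau F].
Proof.
move=> wfD ltau; have [FB [FP [HB HP]]] := region_reductions wfD ltau.
have lK := monodromy_lconst HB HP.
have /choice[L KL] e := side_value_exists wfD lK (or_introl erefl : dir e = dir e \/ dir e = - dir e).
have /choice[Rv KR] e := side_value_exists wfD lK (or_intror erefl : - dir e = dir e \/ - dir e = - dir e).
exists (monodromy FB FP), L, Rv; split=> //.
  exact: (monodromy_under_compatible wfD ltau HB HP KL KR).
move=> S sS SJ; exact: (monodromy_reduction wfD ltau HB HP KL KR lK sS SJ).
Qed.

(** * Neighbourhoods of infinity in the sphere *)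

Section Sphere.
Variable R : realType.
Local Notation R2 := (R * R)%type.
Local Notation R3 := (R * R * R)%type.
Implicit Types (p q : R3).

Lemma near_some q (P : S3 R -> Prop) :
  (\forall y \near (Some q : S3 R), P y) <-> \forall q' \near q, P (Some q').
Proof. by []. Qed.

Lemma ball_compact (M : R) : compact [set q : R3 | `|q| <= M].
Proof.
have -> : [set q : R3 | `|q| <= M] = `[- M, M] `*` `[- M, M] `*` `[- M, M].
  apply/seteqP; split=> [[[x y] h]|[[x y] h]] /=; rewrite norm_pair.
    by rewrite !ge_max /= !in_itv /= -!ler_norml => /andP[/andP[]].
  by rewrite !in_itv /= -!ler_norml !ge_max /= => -[[-> ->] ->].
by do 2?apply: compact_setX; exact: segment_compact.
Qed.

Lemma near_infinity (P : S3 R -> Prop) :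
  (\forall y \near (None : S3 R), P y) <->
  P None /\ exists M : R, forall q, M < `|q| -> P (Some q).
Proof.
split.
  case=> W [cW _] H; split; first by apply: H; right.
  have [M [_ HM]] := compact_bounded cW; exists (M + 1) => q qM.
  apply: H; left; exists q => // Wq.
  have := HM (M + 1) _ q Wq; rewrite ltrDl ltr01 => /(_ isT).
  by rewrite /= leNgt qM.
case=> P0 [M HM]; exists [set q : R3 | `|q| <= M].
  have cM := @ball_compact M; split=> //.
  by apply: compact_closed cM; exact: norm_hausdorff.
move=> y [[q /= /negP]|-> //]; rewrite -ltNge => qM <-; exact: HM.
Qed.

Lemma norm_plane (x : R2) : `|x| = Num.max `|x.1| `|x.2|.
Proof. by []. Qed.

(** For the max norm the outside of a ball is a union of six half-spaces, which are convex. Three of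
    them contain [o]; the points [u] and [v] link the three others to it. *)
Lemma outside_ball_connected (M : R) (P : R3 -> Prop) :
  (forall q, M < `|q| -> \forall q' \near q, P q <-> P q') ->
  forall p q, M < `|p| -> M < `|q| -> P p -> P q.
Proof.
move=> loc.
have half (f : R3 -> R) : (forall q, M < f q -> M < `|q|) ->
    (forall p q (s : R), f (p + s *: (q - p)) = f p + s * (f q - f p)) ->
    forall p q, M < f p -> M < f q -> P p -> P q.
  move=> fM fl p q Mp Mq; apply: (@convex_induction R _ [set q | M < f q] P) => //.
    move=> p1 p2 s /= h1 h2 /andP[s0 s1]; rewrite fl.
    have -> : f p1 + s * (f p2 - f p1) = M + ((1 - s) * (f p1 - M) + s * (f p2 - M)) by ring.
    have := @convex_comb_gt0 R 1 (f p1 - M) (f p2 - M) s; rewrite !mul1r s0 s1 !subr_gt0.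
    by move=> /(_ isT h1 h2); lra.
  by move=> p1 /fM /loc.
have n3 q : [/\ q.1.1 <= `|q| /\ - q.1.1 <= `|q|, q.1.2 <= `|q| /\ - q.1.2 <= `|q| &
    q.2 <= `|q| /\ - q.2 <= `|q|].
  by rewrite (norm_pair q) norm_plane; split; split; rewrite !le_max !ler_normr !lexx ?orbT.
pose N := Num.max 0 M + 1; have N1 : M < N.
  by rewrite /N ltr_pwDr// le_max lexx orbT.
have N0 : M < - - N by rewrite opprK.
pose o : R3 := (N, N, N).
have E1 : forall p q (s : R), (p + s *: (q - p)).1.1 = p.1.1 + s * (q.1.1 - p.1.1) by [].
have E2 : forall p q (s : R), (p + s *: (q - p)).1.2 = p.1.2 + s * (q.1.2 - p.1.2) by [].
have E3 : forall p q (s : R), (p + s *: (q - p)).2 = p.2 + s * (q.2 - p.2) by [].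
have M1 q : M < q.1.1 -> M < `|q| by move=> /lt_le_trans; apply; case: (n3 q) => -[].
have M2 q : M < q.1.2 -> M < `|q| by move=> /lt_le_trans; apply; case: (n3 q) => _ [].
have M3 q : M < q.2 -> M < `|q| by move=> /lt_le_trans; apply; case: (n3 q) => _ _ [].
have M4 q : M < - q.1.1 -> M < `|q| by move=> /lt_le_trans; apply; case: (n3 q) => -[].
have M5 q : M < - q.1.2 -> M < `|q| by move=> /lt_le_trans; apply; case: (n3 q) => _ [].
have M6 q : M < - q.2 -> M < `|q| by move=> /lt_le_trans; apply; case: (n3 q) => _ _ [].
have E4 : forall p q (s : R), - (p + s *: (q - p)).1.1 = - p.1.1 + s * (- q.1.1 - - p.1.1).
  by move=> p q s; rewrite E1; ring.
have E5 : forall p q (s : R), - (p + s *: (q - p)).1.2 = - p.1.2 + s * (- q.1.2 - - p.1.2).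
  by move=> p q s; rewrite E2; ring.
have E6 : forall p q (s : R), - (p + s *: (q - p)).2 = - p.2 + s * (- q.2 - - p.2).
  by move=> p q s; rewrite E3; ring.
have H1 := half (fun q => q.1.1) M1 E1; have H2 := half (fun q => q.1.2) M2 E2.
have H3 := half (fun q => q.2) M3 E3; have H4 := half (fun q => - q.1.1) M4 E4.
have H5 := half (fun q => - q.1.2) M5 E5; have H6 := half (fun q => - q.2) M6 E6.
have all p : M < `|p| -> P p <-> P o.
  pose u : R3 := (- N, - N, N); pose v : R3 := (N, N, - N).
  have uo : P u <-> P o by split; apply: H3.
  have vo : P v <-> P o by split; apply: H1.
  rewrite (norm_pair p) norm_plane !lt_max !(ltr_normr M).
  move=> /orP[/orP[]|] /orP[] h.
  - by split; apply: H1.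
  - by rewrite -uo; split; apply: H4; rewrite /= ?opprK.
  - by split; apply: H2.
  - by rewrite -uo; split; apply: H5; rewrite /= ?opprK.
  - by split; apply: H3.
  - by rewrite -vo; split; apply: H6; rewrite /= ?opprK.
by move=> p q /all -> /all ->.
Qed.

End Sphere.

(** * Transport by homeomorphisms of the sphere *)

Section Extension.
Variables (R : realType) (G : groupType).
Local Notation R3 := (R * R * R)%type.
Implicit Types (p q : R3).

(** [F q] compares the fibre at infinity with that over [q]. The value from a finite point to
    infinity is a default, as infinity is never close to a finite point. *)
Definition extend (tau : R3 -> R3 -> G) (F : R3 -> G) (y z : S3 R) : G :=
  match y, z with
  | Some q, Some q' => tau q q'
  | None, Some q' => F q'
  | _, None => 1%g
  end.

(** A homeomorphism of the sphere may move infinity, so the bundle has to be defined there before it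
    can be transported. *)
Lemma extend_cocycle (A : set R3) tau F (M : R) : local_cocycle A tau ->
  (forall q, M < `|q| -> \forall q' \near q, tau q q' = ((F q)^-1 * F q')%g) ->
  local_cocycle [set y : S3 R | forall q, y = Some q -> A q] (extend tau F).
Proof.
move=> ltau HF [q|] Uq; first exact: (ltau q (Uq q erefl)).
apply/near_infinity; split; first by apply: near_always => z; rewrite mul1g.
exists M => q /HF; apply: filterS => q' E.
by rewrite /= E mulVKg.
Qed.

(** [b] is the given reduction measured against the fibre at infinity. The outside of a large ball
    is connected, so [b] stays there in a single coset of [S], and [b q0] serves at infinity. *)
Lemma reduction_infinity (S : G -> Prop) (U : set (S3 R)) (tau : S3 R -> S3 R -> G) F :
  subgroup S -> open U -> U None -> local_cocycle U tau ->
  reduction S [set q : R3 | U (Some q)] (fun q q' => tau (Some q) (Some q')) F ->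
  exists c, reduction S U tau (fun y : S3 R => if y is Some q then F q else c).
Proof.
move=> sS oU U0 ltau red; pose a q := tau None (Some q); pose b q := (F q * (a q)^-1)%g.
have NU : \forall y \near (None : S3 R), U y by exact: open_nbhs_nbhs (conj oU U0).
have [_ [M HM]] := (near_infinity _).1 (filterI NU (ltau None U0)).
have step q : M < `|q| -> \forall q' \near q, S (b q * (b q')^-1)%g.
  move=> qM; have [Uq /near_some H] := HM q qM.
  apply: filterS2 H (red q Uq) => q' E.
  by rewrite /b /a E invgF !mulgA mulgVK.
pose q0 : R3 := (0, `|M| + 1).
have q0M : M < `|q0|.
  rewrite norm_pair lt_max; apply/orP; right; apply: lt_le_trans (ler_norm _).
  by apply: le_lt_trans (ler_norm M) _; rewrite ltrDl.
have all q : M < `|q| -> S (b q0 * (b q)^-1)%g.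
  move=> qM; apply: (outside_ball_connected (M := M) (P := fun q => S (b q0 * (b q)^-1)%g) _ q0M qM).
    move=> p /step; apply: filterS => p' Sp.
    have -> : (b q0 * (b p')^-1 = (b q0 * (b p)^-1) * (b p * (b p')^-1))%g.
      by rewrite mulgA mulgVK.
    by split=> /(subMr sS _ Sp).
  by rewrite mulgV; exact: sub1.
exists (b q0) => -[q|] Uq; first exact: (red q Uq).
apply/near_infinity; split.
  by rewrite (local_cocycle1 ltau U0) mulg1 mulgV; exact: sub1.
exists M => q qM; have := all q qM; rewrite /b invgM invgK !mulgA.
by rewrite /a.
Qed.

End Extension.

Section Meridians.
Variables (R : realType) (D : diagram R).
Hypothesis wfD : wf_diagram D.
Local Notation R2 := (R * R)%type.
Local Notation R3 := (R * R * R)%type.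
Implicit Types (e f : edge D) (a b : corner D) (t u h z d : R) (x y : R2) (p q : R3).
Variables (G : groupType) (K : R2 -> G) (L Rv : edge D -> G).
Hypothesis lK : lconst D K.
(** The loop that rises over [x], crosses to [y] above the spine, descends there and returns below
    the spine has holonomy [(K x)^-1 * K y]. It lies in [S] after conjugation by the value of [F] at
    a base point, which serves all [x] and [y]. *)
Lemma meridian_reduction S d F : subgroup S -> 0 < d ->
  reduction S (~` tube D d) (bundle K L Rv) F ->
  exists f : G, forall x y, (forall w, shade D w -> d < `|x - w|) ->
    (forall w, shade D w -> d < `|y - w|) -> S (f * (K x)^-1 * K y * f^-1)%g.
Proof.
move=> sS d0 red; have [M [M0 HM]] := height_bounded D.
pose h := M + d + 1.
have out q : h <= `|q.2| -> ~ tube D d q.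
  move=> qh [_ [e [t [t01 ->]]] le]; have := HM e t t01.
  have : `|q.2 - ht e t| <= d.
    by apply: le_trans le; rewrite (norm_pair (q - _)) le_max lexx orbT.
  have := ler_distD (ht e t) q.2 0; rewrite !subr0; move: qh; rewrite /h; lra.
have outx x q : (forall w, shade D w -> d < `|x - w|) -> q.1 = x -> ~ tube D d q.
  move=> xd qx [_ [e [t [t01 ->]]] le]; have sht : shade D (sh e t) by exists e, t.
  have := xd _ sht; rewrite ltNge => /negP; apply.
  by apply: le_trans le; rewrite (norm_pair (q - _)) -qx le_max lexx.
have sp q : ~ tube D d q -> ~ spine D q.
  by move=> nq sq; apply: nq; exists q => //; rewrite subrr normr0 ltW.
have h0 : 0 <= h by rewrite /h; lra.
have absh : `|h| = h by rewrite ger0_norm.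
(* [E] trivializes the bundle along the segment from [p] to [q], and there [F] divided by [E] stays
   in one coset of [S]. *)
have walk (E : R3 -> G) p q : (forall t, 0 <= t <= 1 -> let r := p + t *: (q - p) in
     ~ tube D d r /\ \forall r' \near r, bundle K L Rv r r' = ((E r)^-1 * E r')%g) ->
   S (F p * (E p)^-1 * (F q * (E q)^-1)^-1)%g.
  move=> H; apply: (@line_induction R _ p q (fun r => S (F p * (E p)^-1 * (F r * (E r)^-1)^-1)%g)).
    move=> t /H /= [nr Hr]; apply: filterS2 Hr (red _ nr) => r' -> Sr.
    set r := p + _ in Sr *.
    have -> : (F p * (E p)^-1 * (F r' * (E r')^-1)^-1 =
        F p * (E p)^-1 * (F r * (E r)^-1)^-1 * (F r * ((E r)^-1 * E r') * (F r')^-1))%g.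
      by rewrite !invgF !mulgA mulgVK mulgK.
    by split=> /(subMr sS _ Sr).
  by rewrite mulgV; exact: sub1.
pose o : R3 := (0, - h).
have low x : S (F (x, - h) * (F o)^-1)%g.
  have := @walk (fun=> 1%g) (x, - h) o; rewrite !invg1 !mulg1; apply => t t01 /=.
  set r := _ + _; have r2 : r.2 = - h by rewrite /r /= subrr scaler0 addr0.
  split; first by apply: out; rewrite r2 normrN absh.
  apply: near_always => r'; rewrite bundle_low ?mulg1 ?invg1//.
  move=> [e [u [[u01 _]]]]; rewrite r2 => lt.
  by have := HM e u u01; rewrite ler_norml => /andP[]; move: lt; rewrite /h; lra.
have vert x : (forall w, shade D w -> d < `|x - w|) -> S (F (x, h) * (F (x, - h))^-1)%g.
  move=> xd; have := @walk (fun=> 1%g) (x, h) (x, - h); rewrite !invg1 !mulg1; apply => t t01 /=.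
  set r := _ + _; have r1 : r.1 = x by rewrite /r /= subrr scaler0 addr0.
  split; first exact: (outx x).
  apply: near_always => r'; rewrite bundle_outer ?mulg1 ?invg1//.
  by rewrite r1 => sx; have := xd x sx; rewrite subrr normr0 ltNge ltW.
have high x y : S (F (x, h) * (Kbar K L x)^-1 * (F (y, h) * (Kbar K L y)^-1)^-1)%g.
  apply: (@walk (fun q => Kbar K L q.1) (x, h) (y, h)) => t t01 /=.
  set r := _ + _; have r2 : r.2 = h by rewrite /r /= subrr scaler0 addr0.
  have nr : ~ tube D d r by apply: out; rewrite r2 absh.
  split=> //; rewrite -[x + t *: (y - x)]/(r.1).
  apply: (bundle_high wfD L Rv lK) => //; last exact: sp.
  move=> [e [u [[u01 _]]]]; rewrite r2 => lt.
  by have := HM e u u01; rewrite ler_norml => /andP[]; move: lt; rewrite /h; lra.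
exists (F o) => x y xd yd.
have nsh x' : (forall w, shade D w -> d < `|x' - w|) -> ~ shade D x'.
  by move=> zd sz; have := zd x' sz; rewrite subrr normr0 ltNge ltW.
have := high x y; rewrite !Kbar_outer//; try exact: nsh.
have T x' : (forall w, shade D w -> d < `|x' - w|) -> S (F (x', h) * (F o)^-1)%g.
  by move=> zd; have := subM sS (vert x' zd) (low x'); rewrite mulgA mulgVK.
move=> H; have := subM sS (subM sS (subV sS (T x xd)) H) (T y yd).
by rewrite !invgF !mulgA !mulgVK.
Qed.

End Meridians.

Section Transfer.
Variable R : realType.
Local Notation R2 := (R * R)%type.
Local Notation R3 := (R * R * R)%type.
Implicit Types (D : diagram R) (H : set (S3 R)) (p q : R3) (y z : S3 R).

Definition represents D H := wf_diagram D /\ exists2 e0 : R, 0 < e0 & forall e, 0 < e < e0 ->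
  exists h : S3 R -> S3 R,
    homeomorphism_S3 h /\ [set h q | q in in_S3 (neighborhood e (spine D))] = H.

Definition generated (G : groupType) (I : Type) (j : I -> G) (x : G) :=
  forall S, subgroup S -> (forall i, S (j i)) -> S x.

Lemma generated_subgroup (G : groupType) (I : Type) (j : I -> G) : subgroup (generated j).
Proof.
split=> [S [S1 _] _ //|x x' Sx Sx' S sS Sj]; have [_] := sS; apply.
  exact: Sx.
exact: Sx'.
Qed.

Lemma conj_subgroup (G : groupType) (S : G -> Prop) (f : G) : subgroup S ->
  subgroup (fun x => S (f^-1 * x * f)%g).
Proof.
move=> sS; split; first by rewrite mulg1 mulVg; exact: sub1.
move=> x x' Sx Sx'; have := subM sS (subV sS Sx) Sx'.
by rewrite !invgM invgK !mulgA mulgK.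
Qed.

Lemma tube_bounded D d : exists M : R, forall q, tube D d q -> `|q| <= M.
Proof.
have [B HB] := shade_bounded D; have [M [M0 HM]] := height_bounded D.
exists (Num.max B M + d) => q [_ [e [t [t01 ->]]] le].
rewrite -[q](subrK (edge_point e t)); apply: le_trans (ler_normD _ _) _.
rewrite addrC; apply: lerD le; rewrite norm_pair ge_max !le_max (HM e t t01) HB ?orbT//.
by exists e, t.
Qed.

Lemma tubeC_S3_open D d : open (~` in_S3 (tube D d)).
Proof.
rewrite openE => -[q|] nq.
  have nt : ~ tube D d q by move=> tq; apply: nq; exists q.
  have : \forall q' \near q, ~ tube D d q' by exact: open_nbhs_nbhs (conj (@tubeC_open R D d) nt).
  by apply: filterS => q' nt' [p tp [pq]]; apply: nt'; rewrite -pq.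
suff : \forall z \near (None : S3 R), (~` in_S3 (tube D d)) z by [].
apply/near_infinity; split=> //; have [M HM] := tube_bounded D d.
by exists M => q qM [p tp [pq]]; have := HM p tp; rewrite pq leNgt qM.
Qed.

Variables (G : groupType) (D1 D2 : diagram R) (H : set (S3 R)).
Variables (K1 : R2 -> G) (L1 Rv1 : edge D1 -> G).
Hypotheses (rep1 : represents D1 H) (rep2 : represents D2 H).
Hypothesis lK1 : lconst D1 K1.
Hypothesis KL1 : forall e, side_value K1 e (dir e) (L1 e).
Hypothesis KR1 : forall e, side_value K1 e (- dir e) (Rv1 e).
Hypothesis Kunder1 : under_compatible L1 Rv1.
Variable B : R.
Hypothesis bK1 : forall x, B < `|x| -> K1 x = 1%g.

(** Test points beside all edges, with a common lower bound for their distance to the shadow, so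
    that a thin enough tube misses the verticals over them. *)
Lemma side_points : exists2 r : R, 0 < r & forall e, exists xl xr : R2,
  [/\ K1 xl = L1 e, K1 xr = Rv1 e, forall w, shade D1 w -> r <= `|xl - w| &
      forall w, shade D1 w -> r <= `|xr - w| ].
Proof.
have [wfD _] := rep1.
have pt e (b : bool) : exists2 r : R, 0 < r & exists x : R2, (K1 x = if b then L1 e else Rv1 e) /\
    forall w, shade D1 w -> r <= `|x - w|.
  have h01 : 0 < (1 / 2 : R) < 1 by apply/andP; split; lra.
  have [x nx xE] : exists2 x, ~ shade D1 x & K1 x = if b then L1 e else Rv1 e.
    have dn := dir_neq0 wfD e; case: b.
      by have [x [nx xE dx]] := near_side wfD dn (KL1 e h01); exists x => //; exact: xE.
    have ndn : - dir e != 0 by rewrite oppr_eq0.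
    by have [x [nx xE dx]] := near_side wfD ndn (KR1 e h01); exists x => //; exact: xE.
  have N : \forall y \near x, ~ shade D1 y.
    exact: open_nbhs_nbhs (conj (shadeC_open wfD) nx).
  have [r r0 Hr] := (near_norm _ _).1 N; exists r => //; exists x; split=> // w sw.
  by rewrite leNgt; apply/negP => /Hr.
have /choice[r rP] (eb : edge D1 * bool) : exists r : R, 0 < r /\
    exists x : R2, (K1 x = if eb.2 then L1 eb.1 else Rv1 eb.1) /\
    forall w, shade D1 w -> r <= `|x - w|.
  by have [r r0 Hr] := pt eb.1 eb.2; exists r.
have [s s0 Hs] := fin_lower_bound (fun eb => (rP eb).1).
exists s => // e; have [_ [xl [El Hl]]] := rP (e, true).
have [_ [xr [Er Hr]]] := rP (e, false); exists xl, xr; split=> // w sw.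
  exact: le_trans (Hs _) (Hl w sw).
exact: le_trans (Hs _) (Hr w sw).
Qed.

(** The bundle of [K1], extended to infinity, is carried to the complement of a tube of [D2] and
    from there to the complement of its spine. There it comes from a planar function and reduces to
    the subgroup generated by the jumps of that function. The reduction travels back to [D1], where
    meridians turn it into membership of the jumps. *)
Theorem jump_transfer : exists (K2 : R2 -> G) (L2 Rv2 : edge D2 -> G),
  [/\ lconst D2 K2,
      forall e, side_value K2 e (dir e) (L2 e) /\ side_value K2 e (- dir e) (Rv2 e),
      under_compatible L2 Rv2 &
      forall S, subgroup S -> (forall e, S (edge_jump L2 Rv2 e)) ->
        forall e, S (edge_jump L1 Rv1 e)].
Proof.
have [wf1 [e01 e010 Hh1]] := rep1; have [wf2 [e02 e020 Hh2]] := rep2.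
have [r r0 pts] := side_points; have [d0 d00 Htube] := tube_reduction wf2 G.
have half (u v : R) : 0 < u -> 0 < v -> exists2 w, 0 < w < u & w < v.
  move=> u0 v0; have m0 : 0 < Num.min u v by rewrite lt_min u0.
  have : Num.min u v <= u /\ Num.min u v <= v by rewrite !ge_min !lexx orbT.
  by move=> [? ?]; exists (Num.min u v / 2); [apply/andP; split|]; lra.
(* [e1 < r] keeps the verticals over the test points off the first tube; [e2 < d0] makes the
   retraction available for the second. *)
have [e1 e1u e1r] := half e01 r e010 r0; have [e2 e2u e2d] := half e02 d0 e020 d00.
have e1p : 0 < e1 by case/andP: e1u.
have e2p : 0 < e2 by case/andP: e2u.
have [h1 [[ch1 [k1 [ck1 h1K k1K]]] E1]] := Hh1 e1 e1u.
have [h2 [[ch2 [k2 [ck2 h2K k2K]]] E2]] := Hh2 e2 e2u.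
pose g y := k2 (h1 y); pose gi y := k1 (h2 y).
have cg : continuous g.
  by move=> y; apply: continuous_comp; [exact: ch1|exact: ck2].
have cgi : continuous gi.
  by move=> y; apply: continuous_comp; [exact: ch2|exact: ck1].
have gK : cancel g gi by move=> y; rewrite /gi /g k2K h1K.
pose T1 := in_S3 (tube D1 e1); pose T2 := in_S3 (tube D2 e2).
have gT y : T2 (g y) -> T1 y.
  move=> Ty; have : H (h1 y) by rewrite -E2; exists (g y) => //; rewrite /g k2K.
  by rewrite -E1 => -[z Tz /(can_inj h1K) <-].
have giT y : T1 (gi y) -> T2 y.
  move=> Ty; have : H (h2 y) by rewrite -E1; exists (gi y) => //; rewrite /gi k1K.
  by rewrite -E2 => -[z Tz /(can_inj h2K) <-].
have [M [F HF]] := bundle_infinity wf1 L1 Rv1 lK1 bK1.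
have lc1 := bundle_cocycle wf1 lK1 KL1 KR1 Kunder1.
have lhat := extend_cocycle lc1 HF; set U1 := [set y | _] in lhat.
pose tau2 y z := extend (bundle K1 L1 Rv1) F (gi y) (gi z).
have oU2 : open (~` T2) by exact: tubeC_S3_open.
have lc2 : local_cocycle (~` T2) tau2.
  apply: (local_cocycle_comp oU2 _ _ lhat); first by move=> y _; exact: cgi.
  move=> y nT q yq sq; apply: nT; apply: giT; rewrite yq; exists q => //.
  by exists q => //; rewrite subrr normr0 ltW.
have lc2' : local_cocycle (~` tube D2 e2) (fun q q' => tau2 (Some q) (Some q')).
  apply: (@local_cocycle_comp G (S3 R) R3 (~` T2) _ (Some : R3 -> S3 R) tau2
    (@tubeC_open R D2 e2) _ _ lc2).
    by move=> q _; exact: one_point_compactification_some_continuous.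
  by move=> q nq [p tp [pq]]; apply: nq; rewrite -pq.
have e2ud : 0 < e2 <= d0 by rewrite e2p ltW.
have [tau' ltau' Hred] := Htube e2 _ e2ud lc2'.
have [K2 [L2 [Rv2 [lK2 KLR2 under2 red2]]]] := monodromy_exists wf2 ltau'.
have sS0 := generated_subgroup (edge_jump L2 Rv2).
have [F' redF'] := red2 _ sS0 (fun e => fun S sS Sj => Sj e).
have [F2 redF2] := Hred _ _ sS0 redF'.
have [c redc] : exists c, reduction (generated (edge_jump L2 Rv2)) (~` T2) tau2
    (fun y : S3 R => if y is Some q then F2 q else c).
  apply: reduction_infinity => //; first by case.
  move=> q nq; apply: redF2 => tq; apply: nq; by exists q.
pose F1 q := if g (Some q) is Some q' then F2 q' else c.
have red1 : reduction (generated (edge_jump L2 Rv2)) (~` tube D1 e1) (bundle K1 L1 Rv1) F1.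
  move=> q nq; have nT : (~` T2) (g (Some q)).
    by move=> /gT [p tp [pq]]; apply: nq; rewrite -pq.
  have cq : {for q, continuous (fun q => g (Some q))}.
    apply: (@continuous_comp _ _ _ (Some : R3 -> S3 R) g); last exact: cg.
    exact: one_point_compactification_some_continuous.
  have := continuous_near cq (redc _ nT); apply: filterS => q'.
  by rewrite /tau2 !gK.
have [f Hf] := meridian_reduction wf1 lK1 sS0 e1p red1.
(* The jumps of [K1] lie in the subgroup only after conjugation by [f]; multiplying by [f] on the
   right conjugates the jumps of [K2] accordingly. *)
exists (fun x => K2 x * f)%g, (fun e => L2 e * f)%g, (fun e => Rv2 e * f)%g.
have jE e : edge_jump (fun e => L2 e * f)%g (fun e => Rv2 e * f)%g e = (f^-1 * edge_jump L2 Rv2 e * f)%g.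
  by rewrite /edge_jump invgM !mulgA.
split.
- by move=> x /lK2; apply: filterS => x' ->.
- move=> e; have [HL HR] := KLR2 e; split=> t t01.
    by apply: filterS (HL t t01) => x Hx /Hx ->.
  by apply: filterS (HR t t01) => x Hx /Hx ->.
- by move=> a b e e' ab te se; rewrite !jE (under2 a b e e').
move=> S sS Sj e; have [xl [xr [El Er Hl Hr]]] := pts e.
have far x : (forall w, shade D1 w -> r <= `|x - w|) -> forall w, shade D1 w -> e1 < `|x - w|.
  by move=> Hx w /Hx; exact: lt_le_trans.
have := Hf xr xl (far _ Hr) (far _ Hl); rewrite El Er => /(_ _ (conj_subgroup f sS)).
have Sj' i : S (f^-1 * edge_jump L2 Rv2 i * f)%g by rewrite -jE.
move=> /(_ Sj'); rewrite -!mulgA mulVg mulg1 mulKg.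
by [].
Qed.

End Transfer.

(** * Crossings and vertices *)

Section LocalStructure.
Variables (R : realType) (D : diagram R).
Hypothesis wfD : wf_diagram D.
Local Notation R2 := (R * R)%type.
Implicit Types (e f : edge D) (a b c : corner D).

Lemma bivalent_edges a : bivalent a -> exists i o : edge D,
  (forall e, (tgt e == a) = (e == i)) /\ (forall e, (src e == a) = (e == o)).
Proof.
move=> [/eqP/cards1P[i Ei] /eqP/cards1P[o Eo]]; exists i, o; split=> e.
  by move/setP/(_ e): Ei; rewrite !inE.
by move/setP/(_ e): Eo; rewrite !inE.
Qed.

(** [ia] and [oa] enter and leave [a], [ib] and [ob] do so at [b]. Which strand is over is left
    open, so that the strands can be exchanged when the determinant is negative. *)
Definition crossing_frame a b (ia oa ib ob : edge D) : Prop :=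
  [/\ shadow a = shadow b /\ (forall c, shadow c = shadow b -> c = a \/ c = b),
      (forall e, (tgt e == a) = (e == ia)) /\ (forall e, (src e == a) = (e == oa)),
      (forall e, (tgt e == b) = (e == ib)) /\ (forall e, (src e == b) = (e == ob)),
      (exists2 k : R, 0 < k & dir oa = k *: dir ia) /\
      (exists2 k : R, 0 < k & dir ob = k *: dir ib) &
      det2 (dir ia) (dir ib) != 0].

Lemma crossing_frame_swap a b ia oa ib ob :
  crossing_frame a b ia oa ib ob -> crossing_frame b a ib ob ia oa.
Proof.
move=> [[sab H] Ha Hb [ka kb] d0]; split=> //; last by rewrite det2C oppr_eq0.
by split=> // c; rewrite sab => /H[]; [right|left].
Qed.

Lemma crossing_frame_exists a b : a <> b -> shadow a = shadow b ->
  exists ia oa ib ob, crossing_frame a b ia oa ib ob.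
Proof.
move=> ab sab; have gen : forall a b : corner D, a <> b -> shadow a = shadow b ->
  generic_crossing a b by case: wfD.
have [biva cola tr only] := gen a b ab sab.
have [bivb colb _ _] := gen b a (nesym ab) (esym sab).
have [ia [oa [Eia Eoa]]] := bivalent_edges biva.
have [ib [ob [Eib Eob]]] := bivalent_edges bivb.
have ta : tgt ia = a by apply/eqP; rewrite Eia.
have sa : src oa = a by apply/eqP; rewrite Eoa.
have tb : tgt ib = b by apply/eqP; rewrite Eib.
have sb : src ob = b by apply/eqP; rewrite Eob.
exists ia, oa, ib, ob; split=> //.
- by split=> // c; rewrite -sab; exact: only.
- by split; [exact: cola|exact: colb].
- by apply: tr; rewrite /incident ?ta ?tb ?eqxx ?orbT.
Qed.

Lemma passes_over_neq a b : passes_over a b -> a <> b.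
Proof. by move=> [_ h] E; rewrite E ltxx in h. Qed.

Lemma passes_over_asym a b c : passes_over a b -> ~ passes_over c a.
Proof.
move=> ab [sca hca]; have [sab hab] := ab.
case: (crossing_corners wfD ab (_ : shadow c = _)); first by rewrite sca.
  by move=> E; rewrite E ltxx in hca.
by move=> E; rewrite E in hca; have := lt_trans hca hab; rewrite ltxx.
Qed.

Lemma passes_over_unique a a' b : passes_over a b -> passes_over a' b -> a = a'.
Proof.
move=> ab [sab' hab']; case: (crossing_corners wfD ab sab') => // E.
by rewrite E ltxx in hab'.
Qed.

Lemma shadow_alone a : (forall b, ~ passes_over a b) -> (forall b, ~ passes_over b a) ->
  forall c, shadow c = shadow a -> c = a.
Proof.
move=> na nb c sca; have [lt|gt|eq] := ltgtP (height c) (height a).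
- by case: (na c).
- by case: (nb c).
- case: wfD => inj _ _ _ _; apply: inj.
  by rewrite [LHS]surjective_pairing [RHS]surjective_pairing; congr pair.
Qed.

Lemma counterclockwise_scale (k1 k2 k3 : R) (x y z : R2) : 0 < k1 -> 0 < k2 -> 0 < k3 ->
  counterclockwise (k1 *: x) (k2 *: y) (k3 *: z) = counterclockwise x y z.
Proof.
by move=> k10 k20 k30; rewrite /counterclockwise !det2Zl !det2Zr !pmulr_rgt0.
Qed.

Variables (M : zmodType) (K : R2 -> M) (L Rv : edge D -> M).
Hypothesis lK : lconst D K.
Hypothesis KL : forall e, side_value K e (dir e) (L e).
Hypothesis KR : forall e, side_value K e (- dir e) (Rv e).

(** With this sign the rays of [oa], [ob], [ia], [ib] leave the crossing in counterclockwise order;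
    each equality belongs to one of the four regions between neighbours. *)
Lemma crossing_sides a b ia oa ib ob : crossing_frame a b ia oa ib ob ->
  0 < det2 (dir ia) (dir ib) -> [/\ L oa = Rv ob, L ob = L ia, Rv ia = L ib & Rv ib = Rv oa].
Proof.
move=> [[sab only] [Eia Eoa] [Eib Eob] [[ka ka0 dka] [kb kb0 dkb]] _] d0.
have ta : tgt ia = a by apply/eqP; rewrite Eia.
have sa : src oa = a by apply/eqP; rewrite Eoa.
have tb : tgt ib = b by apply/eqP; rewrite Eib.
have sb : src ob = b by apply/eqP; rewrite Eob.
pose p := dir ia; pose q := dir ib.
have rays k : ray_at b k -> [\/ k = (oa, true), k = (ob, true), k = (ia, false) | k = (ib, false)].
  case: k => e [] /eqP /= /only []; rewrite /ray_end /= => /eqP.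
  - by rewrite Eoa => /eqP ->; apply: Or41.
  - by rewrite Eob => /eqP ->; apply: Or42.
  - by rewrite Eia => /eqP ->; apply: Or43.
  - by rewrite Eib => /eqP ->; apply: Or44.
have roa : ray_at b (oa, true) by rewrite /ray_at /ray_end /= sa sab.
have rob : ray_at b (ob, true) by rewrite /ray_at /ray_end /= sb.
have ria : ray_at b (ia, false) by rewrite /ray_at /ray_end /= ta sab.
have rib : ray_at b (ib, false) by rewrite /ray_at /ray_end /= tb.
have qp : det2 q p = - det2 p q by rewrite det2C.
have pq0 : 0 < det2 p q by [].
have npq : (0 < - det2 p q) = false by rewrite oppr_gt0 lt_gtF.
have doa : ray_dir (oa, true) = ka *: p by [].
have dob : ray_dir (ob, true) = kb *: q by [].
have dia : ray_dir (ia, false) = 1 *: - p by rewrite scale1r.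
have dib : ray_dir (ib, false) = 1 *: - q by rewrite scale1r.
have dets := (@det2Nl R, @det2Nr R, @opprK R, qp, @det2xx R, @oppr0 R, npq, @ltxx _ R).
have ne e f : (e, true) != (f, false) by rewrite xpair_eqE andbF.
have ne' e f : (e, false) != (f, true) by rewrite xpair_eqE andbF.
have oab : oa != ob.
  apply/eqP => E; have ab : a = b by rewrite -sa -sb E.
  have : tgt ia == b by rewrite -ab Eia.
  by rewrite Eib => /eqP Ei; move: pq0; rewrite /p /q Ei det2xx ltxx.
have iab : ia != ib by apply/eqP => E; move: pq0; rewrite /p /q E det2xx ltxx.
have neo : (oa, true) != (ob, true) by rewrite xpair_eqE negb_and oab.
have nei : (ia, false) != (ib, false) by rewrite xpair_eqE negb_and iab.
split.
- apply: (fan_adjacent wfD lK KL KR roa rob); first by rewrite eq_sym.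
  by move=> k /rays[] -> //; rewrite ?eqxx//= => _ _; rewrite ?doa ?dob ?dia ?dib
      counterclockwise_scale// /counterclockwise !dets ?andbF.
- apply: (fan_adjacent wfD lK KL KR rob ria); first exact: ne'.
  by move=> k /rays[] -> //; rewrite ?eqxx//= => _ _; rewrite ?doa ?dob ?dia ?dib
      counterclockwise_scale// /counterclockwise !dets ?andbF.
- apply: (fan_adjacent wfD lK KL KR ria rib); first by rewrite eq_sym.
  by move=> k /rays[] -> //; rewrite ?eqxx//= => _ _; rewrite ?doa ?dob ?dia ?dib
      counterclockwise_scale// /counterclockwise !dets ?andbF.
- apply: (fan_adjacent wfD lK KL KR rib roa); first exact: ne.
  by move=> k /rays[] -> //; rewrite ?eqxx//= => _ _; rewrite ?doa ?dob ?dia ?dib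
      counterclockwise_scale// /counterclockwise !dets ?andbF.
Qed.

Lemma ray_dir_outward c i : ray_end i = c -> ray_dir i = outward c i.1.
Proof.
case: i => e []; rewrite /ray_end /ray_dir /outward /= => <-; first by rewrite eqxx.
case: eqP => // E; case: wfD => _ _ /(_ e) ne _ _; by case: ne; rewrite E.
Qed.

Lemma bend_sides c i o : (forall c', shadow c' = shadow c -> c' = c) ->
  (forall e, (tgt e == c) = (e == i)) -> (forall e, (src e == c) = (e == o)) ->
  L o = L i /\ Rv o = Rv i.
Proof.
move=> alone Ei Eo.
have rays k : ray_at c k -> k = (o, true) \/ k = (i, false).
  case: k => e [] /eqP /alone; rewrite /ray_end /= => /eqP.
    by rewrite Eo => /eqP ->; left.
  by rewrite Ei => /eqP ->; right.
have ro : ray_at c (o, true).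
  by rewrite /ray_at /ray_end /= (eqP (_ : src o == c)) ?Eo.
have ri : ray_at c (i, false).
  by rewrite /ray_at /ray_end /= (eqP (_ : tgt i == c)) ?Ei.
split; last apply: esym.
  apply: (fan_adjacent wfD lK KL KR ro ri); first by rewrite xpair_eqE andbF.
  by move=> k /rays[] ->; rewrite eqxx.
apply: (fan_adjacent wfD lK KL KR ri ro); first by rewrite xpair_eqE andbF.
by move=> k /rays[] ->; rewrite eqxx.
Qed.

Lemma vertex_sides c i j k : (forall c', shadow c' = shadow c -> c' = c) ->
  ray_end i = c -> ray_end j = c -> ray_end k = c -> uniq [:: i; j; k] ->
  (forall r, ray_end r = c -> r \in [:: i; j; k]) ->
  counterclockwise (ray_dir i) (ray_dir j) (ray_dir k) ->
  [/\ ccwv L Rv i = cwv L Rv j, ccwv L Rv j = cwv L Rv k & ccwv L Rv k = cwv L Rv i].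
Proof.
move=> alone ei ej ek un all cc.
have at_c r : ray_at c r -> r \in [:: i; j; k] by move=> /eqP/alone/all.
have ri : ray_at c i by rewrite /ray_at ei.
have rj : ray_at c j by rewrite /ray_at ej.
have rk : ray_at c k by rewrite /ray_at ek.
move: un; rewrite /= !inE !negb_or => /andP[/andP[ij ik] /andP[jk _]].
split.
- apply: (fan_adjacent wfD lK KL KR ri rj); first by rewrite eq_sym.
  move=> r /at_c; rewrite !inE => /or3P[] /eqP->; rewrite ?eqxx// => _ _.
  exact: counterclockwise_swap.
- apply: (fan_adjacent wfD lK KL KR rj rk); first by rewrite eq_sym.
  move=> r /at_c; rewrite !inE => /or3P[] /eqP->; rewrite ?eqxx// => _ _.
  by apply: counterclockwise_swap; rewrite -counterclockwise_rot.
- apply: (fan_adjacent wfD lK KL KR rk ri); first exact: ik.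
  move=> r /at_c; rewrite !inE => /or3P[] /eqP->; rewrite ?eqxx// => _ _.
  by apply: counterclockwise_swap; rewrite counterclockwise_rot.
Qed.

End LocalStructure.

(** * The twisted incidence matrix *)

Section Twisted.
Variables (Z : zmodType) (X : fieldType) (k : nat) (chi : Z -> X).
Definition character_to := chi 0 = 1 /\ forall x y, chi (x + y) = chi x * chi y.
Hypothesis chiP : character_to.

(** The semidirect product of [Z] and $X^k$, on which [Z] acts by scalars through [chi]. The proof
    of multiplicativity is an argument of the type so that the group structure can be attached to
    it. *)
Definition twisted (chiP : character_to) : Type := (Z * 'cV[X]_k)%type.
Local Notation T := (twisted chiP).
HB.instance Definition _ := Choice.on T.

Definition twisted_one : T := (0, 0).
Definition twisted_inv (x : T) : T := (- x.1, - (chi (- x.1) *: x.2)).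
Definition twisted_mul (x y : T) : T := (x.1 + y.1, x.2 + chi x.1 *: y.2).

Lemma twisted_mulA : associative twisted_mul.
Proof.
move=> [r1 b1] [r2 b2] [r3 b3]; rewrite /twisted_mul /= addrA; congr pair.
by rewrite scalerDr scalerA -chiP.2 addrA.
Qed.

Lemma twisted_mul1 : left_id twisted_one twisted_mul.
Proof. by move=> [r b]; rewrite /twisted_mul /= !add0r chiP.1 scale1r. Qed.

Lemma twisted_mulr1 : right_id twisted_one twisted_mul.
Proof. by move=> [r b]; rewrite /twisted_mul /= addr0 scaler0 addr0. Qed.

Lemma twisted_mulV : left_inverse twisted_one twisted_inv twisted_mul.
Proof. by move=> [r b]; rewrite /twisted_mul /= !addNr. Qed.

Lemma twisted_mulrV : right_inverse twisted_one twisted_inv twisted_mul.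
Proof.
move=> [r b]; rewrite /twisted_mul /= addrN scalerN scalerA -chiP.2 addrN chiP.1.
by rewrite scale1r addrN.
Qed.

HB.instance Definition _ := isGroup.Build T twisted_mulA twisted_mul1 twisted_mulr1
  twisted_mulV twisted_mulrV.

Lemma twisted_jump (x y : T) :
  (x^-1 * y)%g = (y.1 - x.1, chi (- x.1) *: (y.2 - x.2)) :> T.
Proof.
rewrite [LHS]/(twisted_mul (twisted_inv x) y) /twisted_mul /= addrC; congr pair.
by rewrite addrC -scalerBr.
Qed.

(** [Z] acts by scalars, so the vectors killed by [u] form an invariant subspace. *)
Lemma annihilator_subgroup (u : 'rV[X]_k) : subgroup (fun x : T => u *m x.2 = 0).
Proof.
split; first by rewrite mulmx0.
move=> x y ux uy; rewrite twisted_jump /= -scalemxAr mulmxBr ux uy subrr.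
by rewrite scaler0.
Qed.

End Twisted.

Section Incidence.
Variables (R : realType) (D : diagram R).
Implicit Types (e f : edge D) (a b c : corner D).

Definition is_under_corner c : bool := `[< exists a, passes_over a c >].

Section Weights.
Variable X : fieldType.
Variable w : corner D -> X.

(* The column of a corner that is not under expresses conservation at all the
   corners with the same shadow, that of an under corner the twisted equality of
   its two edges. *)
Definition incidence_coef e c : X :=
  if is_under_corner c then (src e == c)%:R - w c * (tgt e == c)%:R
  else (shadow (src e) == shadow c)%:R - (shadow (tgt e) == shadow c)%:R.

Definition incidence : 'M[X]_(#|edge D|, #|corner D|) :=
  \matrix_(i, j) incidence_coef (enum_val i) (enum_val j).

Definition nullity : nat := \rank (kermx incidence).

Definition twisted_flow (V : lmodType X) (beta : edge D -> V) : Prop := forall c,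
  if is_under_corner c then
    \sum_(e | src e == c) beta e = w c *: \sum_(e | tgt e == c) beta e
  else \sum_(e | shadow (src e) == shadow c) beta e =
       \sum_(e | shadow (tgt e) == shadow c) beta e.

Lemma twisted_flowP (V : lmodType X) (beta : edge D -> V) :
  twisted_flow beta <-> forall c, \sum_e incidence_coef e c *: beta e = 0.
Proof.
have sel (P : pred (edge D)) : \sum_e (P e)%:R *: beta e = \sum_(e | P e) beta e.
  rewrite [RHS]big_mkcond; apply: eq_bigr => e _.
  by case: (P e); rewrite ?scale1r ?scale0r.
split=> H c; have := H c; rewrite /incidence_coef; case: (is_under_corner c) => E.
- under eq_bigr do rewrite scalerBl -scalerA.
  by rewrite sumrB -scaler_sumr !sel E subrr.
- under eq_bigr do rewrite scalerBl.
  by rewrite sumrB !sel E subrr.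
- move: E; under eq_bigr do rewrite scalerBl -scalerA.
  by rewrite sumrB -scaler_sumr !sel => /eqP; rewrite subr_eq0 => /eqP.
- move: E; under eq_bigr do rewrite scalerBl.
  by rewrite sumrB !sel => /eqP; rewrite subr_eq0 => /eqP.
Qed.

Definition columns k (A : 'M[X]_(k, #|edge D|)) e : 'cV[X]_k := col (enum_rank e) A.

Lemma columns_flow k (A : 'M[X]_(k, #|edge D|)) :
  A *m incidence = 0 <-> twisted_flow (columns A).
Proof.
have E i c : (A *m incidence) i (enum_rank c) =
    (\sum_e incidence_coef e c *: columns A e) i 0.
  rewrite mxE summxE (reindex _ (onW_bij _ (@enum_rank_bij (edge D)))) /=.
  by apply: eq_bigr => e _; rewrite !mxE !enum_rankK mulrC.
rewrite twisted_flowP; split=> H.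
  by move=> c; apply/matrixP => i j; rewrite ord1 -E H !mxE.
apply/matrixP => i j; rewrite -[j]enum_valK E H !mxE.
by [].
Qed.

Lemma nullity_max k (A : 'M[X]_(k, #|edge D|)) : A *m incidence = 0 -> (\rank A <= nullity)%N.
Proof. by move=> /sub_kermxP; exact: mxrankS. Qed.

End Weights.
End Incidence.

Section Flows.
Variables (R : realType) (D : diagram R).
Hypothesis wfD : wf_diagram D.
Local Notation R2 := (R * R)%type.
Implicit Types (e f : edge D) (a b c : corner D).

Lemma is_underP c : reflect (exists a, passes_over a c) (is_under_corner c).
Proof. exact: asboolP. Qed.

Definition corner_flow (Z : zmodType) (phi : edge D -> Z) : Prop :=
  forall a, \sum_(e | src e == a) phi e = \sum_(e | tgt e == a) phi e.

(* At an under corner [c] of a generic diagram there is exactly one term. *)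
Definition crossing_weight (Z : zmodType) (phi : edge D -> Z) c : Z :=
  \sum_(a | `[< passes_over a c >]) \sum_(e | tgt e == a) \sum_(f | tgt f == c)
    if 0 < det2 (dir e) (dir f) then phi e else - phi e.

Lemma crossing_frame_over a b : passes_over a b ->
  exists ia oa ib ob, crossing_frame a b ia oa ib ob.
Proof.
move=> ab; apply: crossing_frame_exists => //; first exact: passes_over_neq ab.
by case: ab.
Qed.

Lemma crossing_weightE (Z : zmodType) (phi : edge D -> Z) a b ia oa ib ob : passes_over a b ->
  crossing_frame a b ia oa ib ob ->
  crossing_weight phi b = if 0 < det2 (dir ia) (dir ib) then phi ia else - phi ia.
Proof.
move=> ab [_ [Eia _] [Eib _] _ _]; rewrite /crossing_weight (bigD1 a)/=; last exact/asboolP.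
rewrite (eq_bigl _ _ Eia) big_pred1_eq (eq_bigl _ _ Eib) big_pred1_eq big1 ?addr0//.
by move=> c /andP[/asboolP cb /eqP ca]; case: ca; exact: passes_over_unique cb ab.
Qed.

Lemma shadow_sum (V : zmodType) (F : edge D -> V) (end_ : edge D -> corner D) a b :
  a <> b -> (forall c, shadow c = shadow b -> c = a \/ c = b) -> shadow a = shadow b ->
  \sum_(e | shadow (end_ e) == shadow b) F e =
  \sum_(e | end_ e == a) F e + \sum_(e | end_ e == b) F e.
Proof.
move=> ab only sab; rewrite (bigID (fun e => end_ e == a)) /=; congr (_ + _).
  apply: eq_bigl => e; apply/andP/eqP => [[_ /eqP//]|->].
  by rewrite sab !eqxx.
apply: eq_bigl => e; apply/andP/eqP => [[/eqP /only [->|//]]|->].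
  by rewrite eqxx.
by rewrite eqxx; split=> //; apply/eqP => /esym.
Qed.

Lemma shadow_sum1 (V : zmodType) (F : edge D -> V) (end_ : edge D -> corner D) a :
  (forall c, shadow c = shadow a -> c = a) ->
  \sum_(e | shadow (end_ e) == shadow a) F e = \sum_(e | end_ e == a) F e.
Proof.
move=> alone; apply: eq_bigl => e.
by apply/eqP/eqP => [/alone//|->].
Qed.

Lemma corner_cases a : [\/ exists b, passes_over b a, exists b, passes_over a b |
  forall c, shadow c = shadow a -> c = a].
Proof.
have [h1|n1] := pselect (exists b, passes_over b a); first exact: Or31.
have [h2|n2] := pselect (exists b, passes_over a b); first exact: Or32.
apply: Or33; apply: (shadow_alone wfD) => b ab; [apply: n2|apply: n1]; by exists b.
Qed.

Lemma corner_flow_conserved (Z : zmodType) (phi : edge D -> Z) : corner_flow phi -> conserved phi.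
Proof.
move=> fl a; case: (corner_cases a) => [[b ba]|[b ab]|alone].
- have [ia [oa [ib [ob [[sab only] _ _ _ _]]]]] := crossing_frame_over ba.
  have ne := passes_over_neq ba.
  by rewrite !(shadow_sum _ _ ne only sab) !fl.
- have [ia [oa [ib [ob [[sab only] _ _ _ _]]]]] := crossing_frame_over ab.
  have ne := passes_over_neq ab.
  by rewrite sab !(shadow_sum _ _ ne only sab) !fl.
- by rewrite !shadow_sum1//; exact: fl.
Qed.

(** At a crossing, conservation at the common shadow minus equality along the lower strand is
    equality along the upper strand. *)
Lemma conserved_corner_flow (Z : zmodType) (phi : edge D -> Z) : conserved phi ->
  (forall a b e e', passes_over a b -> tgt e = b -> src e' = b -> phi e = phi e') ->
  corner_flow phi.
Proof.
move=> cons und.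
have under a b : passes_over a b -> \sum_(e | src e == b) phi e = \sum_(e | tgt e == b) phi e.
  move=> ab; have [ia [oa [ib [ob [_ _ [Eib Eob] _ _]]]]] := crossing_frame_over ab.
  rewrite (eq_bigl _ _ Eib) (eq_bigl _ _ Eob) !big_pred1_eq; apply/esym; apply: (und a b) => //.
    by apply/eqP; rewrite Eib.
  by apply/eqP; rewrite Eob.
move=> a; case: (corner_cases a) => [[b ba]|[b ab]|alone].
- exact: under ba.
- have [ia [oa [ib [ob [[sab only] _ _ _ _]]]]] := crossing_frame_over ab.
  have ne := passes_over_neq ab.
  have := cons b; rewrite !(shadow_sum _ _ ne only sab) (under _ _ ab).
  by move/addIr.
- by have := cons a; rewrite !shadow_sum1.
Qed.

(** At an under corner, conservation is the condition attached to the over corner with the same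
    shadow, which sums over both strands. *)
Lemma twisted_flow_conserved (X : fieldType) (w : corner D -> X) (V : lmodType X)
    (beta : edge D -> V) : twisted_flow w beta -> conserved beta.
Proof.
move=> fl a; case: (boolP (is_under_corner a)) => ua.
  have [b ba] := is_underP _ ua.
  have /is_underP nb : ~ exists c, passes_over c b.
    by move=> [c cb]; exact: (passes_over_asym wfD ba cb).
  by have := fl b; case: is_underP nb => // _ _; case: ba => ->.
by have := fl a; rewrite (negbTE ua).
Qed.

Lemma under_sums (V : zmodType) (F : edge D -> V) a b ia oa ib ob :
  crossing_frame a b ia oa ib ob ->
  [/\ \sum_(e | src e == a) F e = F oa, \sum_(e | tgt e == a) F e = F ia,
      \sum_(e | src e == b) F e = F ob & \sum_(e | tgt e == b) F e = F ib].
Proof.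
move=> [_ [Eia Eoa] [Eib Eob] _ _].
by rewrite (eq_bigl _ _ Eia) (eq_bigl _ _ Eoa) (eq_bigl _ _ Eib) (eq_bigl _ _ Eob) !big_pred1_eq.
Qed.

(** Passing along the lower strand, the region on its right crosses the upper strand, whose flow is
    added with the sign of the crossing. So the exponent of the twist is a difference of region
    indices. *)
Lemma crossing_right (Z : zmodType) (r : R2 -> Z) (l rr phi : edge D -> Z) a b ia oa ib ob :
  lconst D r -> (forall e, side_value r e (dir e) (l e)) ->
  (forall e, side_value r e (- dir e) (rr e)) -> (forall e, phi e = l e - rr e) ->
  corner_flow phi -> passes_over a b -> crossing_frame a b ia oa ib ob ->
  rr ob - rr ib = crossing_weight phi b.
Proof.
move=> lr rl rrr phiE fl ab fr; rewrite (crossing_weightE _ ab fr).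
have [So Si _ _] := under_sums phi fr.
have pio : phi ia = phi oa by rewrite -So -Si fl.
case: ifPn => [d0|]; first have [E1 _ _ E4] := crossing_sides wfD lr rl rrr fr d0.
  by rewrite E4 -E1 pio phiE.
have [_ _ _ _ dn] := fr; rewrite -leNgt le_eqVlt (negbTE dn) /= => d0.
have d0' : 0 < det2 (dir ib) (dir ia) by rewrite det2C oppr_gt0.
have [_ _ E3 E4] := crossing_sides wfD lr rl rrr (crossing_frame_swap fr) d0'.
by rewrite E3 -E4 phiE opprB.
Qed.

End Flows.

Lemma mulmx_col (X : fieldType) m n p (A : 'M[X]_(m, n)) (B : 'M_(n, p)) j :
  A *m col j B = col j (A *m B).
Proof. by rewrite !colE mulmxA. Qed.

(** * Transfer of solutions between diagrams *)

Section SolutionTransfer.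
Variables (R : realType) (Z : zmodType) (X : fieldType) (chi : Z -> X).
Hypothesis chiP : character_to chi.
Local Notation R2 := (R * R)%type.

Definition flow_weight (D : diagram R) (phi : edge D -> Z) c : X := chi (crossing_weight phi c).

(** A basis of the kernel is read as one solution [beta1] with values in $X^k$; its potential and
    that of the flow are the components of [K1]. By the formula for jumps in the semidirect product,
    equality of the jumps at an under corner is the twisted condition there, so the transferred
    function can be read back as a flow and a solution. *)
Lemma nullity_transfer (D1 D2 : diagram R) (H : set (S3 R)) (phi1 : edge D1 -> Z) :
  represents D1 H -> represents D2 H -> corner_flow phi1 ->
  exists2 phi2 : edge D2 -> Z, corner_flow phi2 &
    (nullity (flow_weight phi1) <= nullity (flow_weight phi2))%N.
Proof.
move=> rep1 rep2 fl1; have [wf1 _] := rep1; have [wf2 _] := rep2.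
set k := nullity _; pose A := row_base (kermx (incidence (flow_weight phi1))).
have A0 : A *m incidence (flow_weight phi1) = 0.
  by apply/sub_kermxP; rewrite eq_row_base.
have [c gc] := generic_direction wf1.
pose beta1 := columns A; have tw1 : twisted_flow (flow_weight phi1) beta1 by apply/columns_flow.
have cons1 := twisted_flow_conserved wf1 tw1.
have consp := corner_flow_conserved wf1 fl1.
pose r1 := potential phi1 c; pose B1 := potential beta1 c.
have lr1 : lconst D1 r1 := potential_lconst wf1 consp gc.
have lB1 : lconst D1 B1 := potential_lconst wf1 cons1 gc.
have dirL (D : diagram R) (e : edge D) : dir e = dir e \/ dir e = - dir e by left.
have dirR (D : diagram R) (e : edge D) : - dir e = dir e \/ - dir e = - dir e by right.
have /choice[rl Hrl] e := side_value_exists wf1 lr1 (dirL D1 e).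
have /choice[rr Hrr] e := side_value_exists wf1 lr1 (dirR D1 e).
have /choice[Bl HBl] e := side_value_exists wf1 lB1 (dirL D1 e).
have /choice[Br HBr] e := side_value_exists wf1 lB1 (dirR D1 e).
have phiE e : phi1 e = rl e - rr e by rewrite (potential_jump wf1 consp gc (Hrl e) (Hrr e)).
have betaE e : beta1 e = Bl e - Br e by rewrite (potential_jump wf1 cons1 gc (HBl e) (HBr e)).
pose G : groupType := twisted k chiP.
pose K1 x : G := (r1 x, B1 x); pose L1 e : G := (rl e, Bl e); pose Rv1 e : G := (rr e, Br e).
have lK1 : lconst D1 K1.
  by move=> x nx; apply: filterS2 (lr1 x nx) (lB1 x nx) => y; rewrite /K1 => -> ->.
have KL1 e : side_value K1 e (dir e) (L1 e).
  move=> t t01; apply: filterS2 (Hrl e t t01) (HBl e t t01) => y h1 h2 d0.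
  by rewrite /K1 h1// h2.
have KR1 e : side_value K1 e (- dir e) (Rv1 e).
  move=> t t01; apply: filterS2 (Hrr e t t01) (HBr e t t01) => y h1 h2 d0.
  by rewrite /K1 h1// h2.
have J1 e : edge_jump L1 Rv1 e = (phi1 e, chi (- rr e) *: beta1 e).
  by rewrite /edge_jump twisted_jump /= -phiE -betaE.
have under1 : under_compatible L1 Rv1.
  move=> a b e e' ab te se.
  have [ia [oa [ib [ob fr]]]] := crossing_frame_over wf1 ab.
  have [_ _ [Eib Eob] _ _] := fr.
  have -> : e = ib by apply/eqP; rewrite -Eib te.
  have -> : e' = ob by apply/eqP; rewrite -Eob se.
  rewrite !J1; have [_ _ So Si] := under_sums phi1 fr.
  have pio : phi1 ib = phi1 ob by rewrite -So -Si fl1.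
  have [_ _ bo bi] := under_sums beta1 fr.
  have ub : is_under_corner b by apply/is_underP; exists a.
  have := tw1 b; rewrite ub bo bi => ->.
  rewrite pio /flow_weight -(crossing_right wf1 lr1 Hrl Hrr phiE fl1 ab fr).
  by rewrite scalerA -chiP.2 addrA addNr add0r.
have [Br1 HBr1] := potential_bounded consp gc; have [BB HBB] := potential_bounded cons1 gc.
have bK1 x : Num.max Br1 BB < `|x| -> K1 x = 1%g.
  by rewrite gt_max => /andP[h1 h2]; rewrite /K1 /r1 /B1 HBr1// HBB.
have [K2 [L2 [Rv2 [lK2 KLR2 under2 gen]]]] :=
  jump_transfer rep1 rep2 lK1 KL1 KR1 under1 bK1.
pose phi2 e := (L2 e).1 - (Rv2 e).1; pose beta2 e := (L2 e).2 - (Rv2 e).2.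
pose r2 x := (K2 x).1; pose B2 x := (K2 x).2.
have lr2 : lconst D2 r2 by move=> x /lK2; apply: filterS => y; rewrite /r2 => ->.
have lB2 : lconst D2 B2 by move=> x /lK2; apply: filterS => y; rewrite /B2 => ->.
have Hr2l e : side_value r2 e (dir e) (L2 e).1.
  by move=> t t01; apply: filterS ((KLR2 e).1 t t01) => y h /h; rewrite /r2 => ->.
have Hr2r e : side_value r2 e (- dir e) (Rv2 e).1.
  by move=> t t01; apply: filterS ((KLR2 e).2 t t01) => y h /h; rewrite /r2 => ->.
have HB2l e : side_value B2 e (dir e) (L2 e).2.
  by move=> t t01; apply: filterS ((KLR2 e).1 t t01) => y h /h; rewrite /B2 => ->.
have HB2r e : side_value B2 e (- dir e) (Rv2 e).2.
  by move=> t t01; apply: filterS ((KLR2 e).2 t t01) => y h /h; rewrite /B2 => ->.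
have J2 e : edge_jump L2 Rv2 e = (phi2 e, chi (- (Rv2 e).1) *: beta2 e).
  by rewrite /edge_jump twisted_jump.
have und2 a b e e' : passes_over a b -> tgt e = b -> src e' = b ->
    phi2 e = phi2 e' /\ chi (- (Rv2 e).1) *: beta2 e = chi (- (Rv2 e').1) *: beta2 e'.
  by move=> ab te se; have := under2 a b e e' ab te se; rewrite !J2 => -[-> ->].
have fl2 : corner_flow phi2.
  apply: (conserved_corner_flow wf2).
    by move=> a; exact: (fan_conservation wf2 lr2 Hr2l Hr2r).
  by move=> a b e e' ab te se; case: (und2 a b e e' ab te se).
have tw2 : twisted_flow (flow_weight phi2) beta2.
  move=> b; case: ifPn => [/is_underP[a ab]|_]; last first.
    exact: (fan_conservation wf2 lB2 HB2l HB2r).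
  have [ia [oa [ib [ob fr]]]] := crossing_frame_over wf2 ab.
  have [_ _ -> ->] := under_sums beta2 fr.
  rewrite /flow_weight -(crossing_right wf2 lr2 Hr2l Hr2r (fun=> erefl) fl2 ab fr).
  have [_ _ [Eib Eob] _ _] := fr.
  have tb : tgt ib = b by apply/eqP; rewrite Eib.
  have sb : src ob = b by apply/eqP; rewrite Eob.
  have [_ E] := und2 a b ib ob ab tb sb.
  rewrite chiP.2 -scalerA E scalerA -chiP.2 addrN chiP.1 scale1r.
  by [].
exists phi2 => //.
pose A2 : 'M[X]_(k, #|edge D2|) := \matrix_(i, j) beta2 (enum_val j) i 0.
have colA2 e : columns A2 e = beta2 e.
  by apply/matrixP => i j; rewrite ord1 !mxE enum_rankK.
have A20 : A2 *m incidence (flow_weight phi2) = 0.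
  apply/columns_flow; have -> : columns A2 = beta2 by apply/funext.
  exact: tw2.
apply: leq_trans (nullity_max A20).
suff : row_free A2 by rewrite /row_free => /eqP ->.
rewrite -kermx_eq0; apply/eqP/row_matrixP => i; rewrite row0.
set u := row i _; have uA2 : u *m A2 = 0.
  by rewrite /u -row_mul mulmx_ker row0.
(* [u] is a relation among the rows of [A2]. Its annihilator is a subgroup that contains all jumps
   on [D2], hence those on [D1]; so [u] is a relation among the rows of the basis [A]. *)
have ann := annihilator_subgroup chiP u.
have ann2 e : u *m (edge_jump L2 Rv2 e).2 = 0.
  rewrite J2 /= -scalemxAr -colA2 /columns mulmx_col uA2.
  by rewrite (_ : col _ 0 = 0) ?scaler0//; apply/matrixP => x y; rewrite !mxE.
have ann1 := gen _ ann ann2.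
have uA : u *m A = 0.
  apply/matrixP => x j; rewrite ord1 [RHS]mxE -[j]enum_valK.
  have := ann1 (enum_val j); rewrite J1 /= -scalemxAr => /eqP.
  rewrite scaler_eq0 => /orP[/eqP chi0|/eqP E].
    have := chiP.1; rewrite -(addNr (rr (enum_val j))) chiP.2 chi0 mul0r => /eqP.
    by rewrite eq_sym oner_eq0.
  have := congr1 (fun M : 'cV[X]_1 => M 0 0) E.
  by rewrite /beta1 /columns mulmx_col [LHS]mxE [RHS]mxE.
have := row_base_free (kermx (incidence (flow_weight phi1))).
by rewrite -kermx_eq0 => /eqP kz; move/sub_kermxP: uA; rewrite kz submx0 => /eqP.
Qed.

End SolutionTransfer.

(** The part of the kernel of [A] that also kills the column [j0] of [A'] lies in the kernel of
    [A'], and one linear condition costs at most one dimension. The other columns of [A'] may sit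
    anywhere in [A]. *)
Lemma kermx_column_change (X : fieldType) m n (A A' : 'M[X]_(m, n)) (j0 : 'I_n) :
  (forall j, j != j0 -> exists j', col j A' = col j' A) ->
  (\rank (kermx A) <= \rank (kermx A') + 1)%N.
Proof.
move=> H; pose q := col j0 A'.
have sub : (kermx A :&: kermx q <= kermx A')%MS.
  apply/sub_kermxP/matrixP => i j; rewrite [RHS]mxE.
  suff : (kermx A :&: kermx q)%MS *m col j A' = 0.
    by rewrite mulmx_col => /matrixP/(_ i 0); rewrite !mxE.
  have [->|/H[j' ->]] := eqVneq j j0; first by apply/sub_kermxP; rewrite capmxSr.
  rewrite mulmx_col; have -> : (kermx A :&: kermx q)%MS *m A = 0.
    by apply/sub_kermxP; rewrite capmxSl.
  by apply/matrixP => x y; rewrite !mxE.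
have := mxrankS sub; have := mxrank_sum_cap (kermx A) (kermx q).
have := rank_leq_col (kermx A + kermx q)%MS.
have := mxrank_ker q; have := rank_leq_col q.
move: (\rank (kermx A + kermx q)%MS) (\rank (kermx A :&: kermx q)%MS)
  (\rank (kermx A)) (\rank (kermx q)) (\rank (kermx A')) (\rank q) => ? ? ? ? ? ?.
by move=> *; lia.
Qed.

(** * Trivial twist and the transposed incidence matrix *)

Section Trivial.
Variables (R : realType) (D : diagram R) (X : fieldType).
Hypothesis wfD : wf_diagram D.
Implicit Types (e f : edge D) (a b c : corner D).

(** With weight 1 the twisted condition is equality along the lower strand, so the solutions are the
    ordinary flows of the graph. *)
Lemma twisted_flow1 (V : lmodType X) (beta : edge D -> V) :
  twisted_flow (fun=> 1 : X) beta <-> corner_flow beta.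
Proof.
split=> H.
  apply: (conserved_corner_flow wfD) => [|a b e e' ab te se].
    exact: (twisted_flow_conserved wfD H).
  have [ia [oa [ib [ob fr]]]] := crossing_frame_over wfD ab.
  have [_ _ [Eib Eob] _ _] := fr; have [_ _ So Si] := under_sums beta fr.
  have ub : is_under_corner b by apply/is_underP; exists a.
  have -> : e = ib by apply/eqP; rewrite -Eib te.
  have -> : e' = ob by apply/eqP; rewrite -Eob se.
  by have := H b; rewrite ub So Si scale1r.
move=> c; case: ifPn => _; first by rewrite scale1r; exact: H.
exact: corner_flow_conserved.
Qed.

Lemma same_shadow_under b c : shadow b = shadow c -> b != c ->
  ~~ is_under_corner b -> is_under_corner c.
Proof.
move=> sbc bc nb; apply/is_underP; exists b; split=> //.
have [lt|//|eq] := ltgtP (height b) (height c).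
  by case/is_underP: nb; exists c; split=> //; rewrite -?sbc.
case/eqP: bc; case: wfD => inj _ _ _ _; apply: inj.
by rewrite [LHS]surjective_pairing [RHS]surjective_pairing; congr pair.
Qed.

Section Dual.
Variables (w : corner D -> X) (y : corner D -> X).
(** Applied to a function [y] on the corners, the transposed matrix gives for each edge an outgoing
    value at its source minus an incoming value at its target. At an under corner both contain the
    value of the over corner, and a term of their own that is weighted on the incoming side. *)
Definition over_part c : X := \sum_(c' | ~~ is_under_corner c' && (shadow c == shadow c')) y c'.
Definition out_part c : X := over_part c + (is_under_corner c)%:R * y c.
Definition in_part c : X := over_part c + (is_under_corner c)%:R * (w c * y c).

Lemma incidence_dual e :
  \sum_c incidence_coef w e c * y c = out_part (src e) - in_part (tgt e).
Proof.
have E c : incidence_coef w e c * y c =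
    ((~~ is_under_corner c && (shadow (src e) == shadow c))%:R * y c +
     (src e == c)%:R * ((is_under_corner c)%:R * y c)) -
    ((~~ is_under_corner c && (shadow (tgt e) == shadow c))%:R * y c +
     (tgt e == c)%:R * ((is_under_corner c)%:R * (w c * y c))).
  by rewrite /incidence_coef; case: (is_under_corner c) => /=; ring.
rewrite (eq_bigr _ (fun c _ => E c)) sumrB !big_split /=.
have sel (P : pred (corner D)) (F : corner D -> X) : \sum_c (P c)%:R * F c = \sum_(c | P c) F c.
  by rewrite [RHS]big_mkcond; apply: eq_bigr => c _; case: (P c); rewrite ?mul1r ?mul0r.
rewrite !sel /out_part /in_part /over_part.
have sel1 c0 (F : corner D -> X) : \sum_(c | c0 == c) F c = F c0.
  by rewrite (eq_bigl (pred1 c0)) ?big_pred1_eq// => c; rewrite eq_sym.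
by rewrite !sel1.
Qed.

Lemma over_part_alone c : ~~ is_under_corner c -> over_part c = y c.
Proof.
move=> nc; rewrite /over_part (bigD1 c) ?nc ?eqxx//= big1 ?addr0// => c' /andP[/andP[nc' /eqP sc] cc].
by move: nc; rewrite (@same_shadow_under c' c).
Qed.

Lemma over_part_shadow a c : shadow a = shadow c -> over_part a = over_part c.
Proof. by move=> E; apply: eq_bigl => c'; rewrite E. Qed.

End Dual.

(** Both sides are the number of edges plus the number of corners minus the rank. *)
Lemma nullity_dual (w : corner D -> X) :
  (nullity w + #|corner D| = #|edge D| + \rank (kermx (incidence w)^T))%N.
Proof.
rewrite /nullity !mxrank_ker mxrank_tr.
have := rank_leq_row (incidence w); have := rank_leq_col (incidence w).
by lia.
Qed.

Definition corner_row n (Y : 'I_n -> corner D -> X) : 'M[X]_(n, #|corner D|) :=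
  \matrix_(i, j) Y i (enum_val j).

Lemma corner_row_ker (w : corner D -> X) n (A : 'M[X]_(n, #|corner D|)) :
  A *m (incidence w)^T = 0 <-> forall i e, \sum_c incidence_coef w e c * A i (enum_rank c) = 0.
Proof.
have E i e : (A *m (incidence w)^T) i (enum_rank e) =
    \sum_c incidence_coef w e c * A i (enum_rank c).
  rewrite mxE (reindex _ (onW_bij _ (@enum_rank_bij (corner D)))) /=.
  by apply: eq_bigr => c _; rewrite !mxE !enum_rankK mulrC.
split=> H; first by move=> i e; rewrite -E H mxE.
by apply/matrixP => i j; rewrite -[j]enum_valK E H mxE.
Qed.

Definition connected_graph := forall P : corner D -> Prop,
  (forall e, P (src e) <-> P (tgt e)) -> forall c c', P c -> P c'.

(** By duality the kernel of the transposed matrix must have dimension at most 1. On it [out_part]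
    agrees at both ends of each edge, hence is constant by connectedness. This determines [y]: the
    constant on the corners that are not under, 0 on the others. *)
Lemma connected_nullity : connected_graph ->
  (nullity (fun _ : corner D => 1%R : X) + #|corner D| <= #|edge D| + 1)%N.
Proof.
move=> con; rewrite nullity_dual leq_add2l.
set A := kermx _; pose r : 'rV[X]_#|corner D| := \row_j (~~ is_under_corner (enum_val j))%:R.
suff : (A <= r)%MS by move=> /mxrankS/leq_trans; apply; exact: rank_leq_row.
apply/row_subP => i; have A0 : A *m (incidence (fun _ : corner D => 1 : X))^T = 0 by exact: mulmx_ker.
pose y c : X := A i (enum_rank c).
have H e : out_part y (src e) = out_part y (tgt e).
  apply/eqP; rewrite -subr_eq0; apply/eqP.
  have := (corner_row_ker _ A).1 A0 i e; rewrite (incidence_dual (fun=> 1) y e).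
  by rewrite /in_part mul1r.
have [c0 _|noc] := pickP (fun _ : corner D => true); last first.
  apply/eqP => //; rewrite -(_ : (0 : 'rV_#|corner D|) = row i A) ?sub0mx//.
  by apply/matrixP => x j; have := noc (enum_val j).
have const c : out_part y c = out_part y c0.
  apply: (con (fun c => out_part y c = out_part y c0) _ c0 c) => // e.
  by rewrite H.
have -> : row i A = out_part y c0 *: r; last exact: scalemx_sub.
apply/matrixP => x j; rewrite [LHS]mxE [RHS]mxE [r _ _]mxE; set c := enum_val j.
have -> : A i j = y c by rewrite /y /c enum_valK.
have nonunder a : ~~ is_under_corner a -> y a = out_part y c0.
  by move=> na; rewrite -(const a) /out_part (negbTE na) mul0r addr0 over_part_alone.
case: (boolP (is_under_corner c)) => uc; last by rewrite mulr1; exact: nonunder.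
rewrite mulr0; have [a ac] := is_underP _ uc.
have na : ~~ is_under_corner a.
  by apply/is_underP => -[b ba]; exact: (passes_over_asym wfD ac ba).
have := const c; rewrite /out_part uc mul1r -(over_part_shadow y (proj1 ac)).
rewrite over_part_alone// (nonunder a na) => /eqP.
by rewrite -subr_eq0 addrAC subrr add0r => /eqP.
Qed.

End Trivial.

(** * Effect of a switch on the incidence matrix *)

Section CrossingChange.
Variables (R : realType) (D : diagram R) (X : fieldType) (z : corner D -> R).
Local Notation D' := (set_heights z).
Hypotheses (wfD : wf_diagram D) (wfD' : wf_diagram D').
Implicit Types (a b c : corner D).

(** For trivial twist the solutions are the flows of the graph, which do not see heights. *)
Lemma nullity1_set_heights :
  (nullity (fun _ : corner D' => 1%R : X) <= nullity (fun _ : corner D => 1%R : X))%N.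
Proof.
set n' := nullity _; pose A : 'M[X]_(n', #|edge D|) := row_base (kermx (incidence (fun _ : corner D' => 1%R : X))).
have A0 : A *m incidence (fun _ : corner D' => 1 : X) = 0.
  by apply/sub_kermxP; rewrite eq_row_base.
have tw' : @twisted_flow R D' X (fun=> 1) _ (@columns R D' X n' A) by apply/columns_flow.
have fl : @corner_flow R D _ (@columns R D X n' A) := (twisted_flow1 wfD' _).1 tw'.
have tw : @twisted_flow R D X (fun=> 1) _ (@columns R D X n' A) := (twisted_flow1 wfD _).2 fl.
have := nullity_max ((columns_flow _ _).2 tw).
by rewrite eq_row_base.
Qed.

(** After the switch [b] is the over corner and its column is the old column of [a], as both express
    conservation at the same shadow. Only the column of [a] is new. *)
Lemma nullity_switch (Z : zmodType) (chi : Z -> X) (phi : edge D -> Z) : switches z ->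
  (nullity (@flow_weight R Z X chi D phi) <= nullity (@flow_weight R Z X chi D' phi) + 1)%N.
Proof.
move=> [a [b [ab sw]]].
have po c d : @passes_over R D' c d <-> (passes_over c d /\ (c, d) != (a, b)) \/ (c, d) = (b, a).
  split=> [[scd hcd]|[[cd ne]|[-> ->]]].
  - have ncd : c <> d by move=> E; move: hcd; rewrite E /height /= ltxx.
    have [lt|gt|eq] := ltgtP (@height R D c) (@height R D d).
    + have dc : @passes_over R D d c by split.
      right; have := sw d c dc; case: eqP => [[-> ->]//|_ h].
      by have := lt_trans h hcd; rewrite ltxx.
    + have dc : @passes_over R D c d by split.
      left; split=> //; have := sw c d dc; case: eqP => // _ h.
      by have := lt_trans h hcd; rewrite ltxx.
    + case: ncd; case: wfD => inj _ _ _ _; apply: inj.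
      by rewrite [LHS]surjective_pairing [RHS]surjective_pairing; congr pair.
  - by split; [case: cd|have := sw c d cd; rewrite (negbTE ne)].
  - by split; [case: ab => sab _; exact: esym sab|have := sw a b ab; rewrite eqxx].
have nab := passes_over_neq ab.
have other c d : d <> a -> d <> b -> @passes_over R D' c d <-> passes_over c d.
  move=> da db; rewrite po; split=> [[[]//|[_ /da//]]|cd].
  by left; split=> //; apply/eqP => -[_ /db].
have under_other d : d <> a -> d <> b -> @is_under_corner R D' d = is_under_corner d.
  by move=> da db; apply/is_underP/is_underP => -[c cd]; exists c; apply/(other c d).
have ua' : ~~ is_under_corner a.
  by apply/is_underP => -[c ca]; exact: (passes_over_asym wfD ab ca).
have ba' : @passes_over R D' b a by apply/po; right.
have ub' : ~~ @is_under_corner R D' b.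
  by apply/is_underP => -[c ca]; exact: (passes_over_asym wfD' ba' ca).
apply: (@kermx_column_change _ _ _ _ _ (enum_rank a)) => j ja.
pose d := enum_val j; have da : d <> a by move=> E; case/eqP: ja; rewrite -E enum_valK.
have [db|/eqP db] := eqVneq d b.
  exists (enum_rank a); apply/matrixP => i x; rewrite !mxE -/d enum_rankK.
  rewrite /incidence_coef (negbTE ua') db (negbTE ub').
  by rewrite -[@shadow R D' b]/(@shadow R D b) -(proj1 ab).
exists j; apply/matrixP => i x; rewrite !mxE -/d /incidence_coef under_other//.
have -> // : @flow_weight R Z X chi D' phi d = flow_weight chi phi d.
rewrite /flow_weight /crossing_weight; congr chi; apply: eq_bigl => c.
by apply/asboolP/asboolP => /(other c d da db).
Qed.

End CrossingChange.

(** Among three nonzero signs two agree, and an equal pair decides the cyclic order. A zero comes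
    from opposite directions and leaves the two other signs equal. *)
Lemma sign_pigeonhole (R : realType) (a b c : R) :
  ((a == 0) ==> ((0 < b) && (0 < c) || (b < 0) && (c < 0))) ->
  ((b == 0) ==> ((0 < c) && (0 < a) || (c < 0) && (a < 0))) ->
  ((c == 0) ==> ((0 < a) && (0 < b) || (a < 0) && (b < 0))) ->
  [|| (0 < a) && (0 < b), (0 < b) && (0 < c) | (0 < c) && (0 < a)] ||
  [|| (c < 0) && (b < 0), (b < 0) && (a < 0) | (a < 0) && (c < 0)].
Proof. by case: (ltgtP a 0) => _; case: (ltgtP b 0) => _; case: (ltgtP c 0) => _. Qed.

Lemma counterclockwise_total (R : realType) (x y z : R * R) : x != 0 -> y != 0 -> z != 0 ->
  ~ same_ray x y -> ~ same_ray y z -> ~ same_ray z x ->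
  counterclockwise x y z || counterclockwise x z y.
Proof.
have zero (x' y' z' : R * R) : x' != 0 -> y' != 0 -> z' != 0 ->
    ~ same_ray x' y' -> ~ same_ray y' z' -> ~ same_ray z' x' -> (det2 x' y' == 0) ==>
    ((0 < det2 y' z') && (0 < det2 z' x') || (det2 y' z' < 0) && (det2 z' x' < 0)).
  move=> x0 y0 z0 xy yz zx; apply/implyP => /eqP d0.
  have [k k0 yE] := ray_param_opp x0 y0 d0 xy.
  have E : det2 y' z' = k * det2 z' x'.
    by rewrite yE det2Zl (det2C x') mulrNN.
  rewrite E pmulr_rgt0// pmulr_rlt0//.
  have [lt|gt|eq] := ltgtP (det2 z' x') 0; rewrite ?andbT ?orbT//.
  have [l l0 xE] := ray_param_opp z0 x0 eq zx.
  have yE' : y' = (k * l) *: z' by rewrite yE xE scalerA mulrNN.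
  have kl : 0 < k * l by rewrite mulr_gt0.
  case: yz; rewrite /same_ray yE' det2Zl det2xx mulr0; split=> //.
  by rewrite dot2C dot2Zr mulr_gt0 ?dot2_gt0.
move=> x0 y0 z0 xy yz zx; rewrite /counterclockwise.
rewrite (det2C x z) (det2C z y) (det2C y x) !oppr_gt0.
by apply: sign_pigeonhole; apply: zero.
Qed.

(** * Crossings and vertices in terms of corners *)

Section Vertices.
Variables (R : realType) (D : diagram R).
Hypothesis wfD : wf_diagram D.
Local Notation R2 := (R * R)%type.
Implicit Types (e f : edge D) (a b c : corner D).

(** Strengthens [at_vertex] by listing all edges at the corner, as sums over edges require. *)
Definition trivalent_at c (ga al be : edge D) : Prop := al != be /\
  ([/\ forall e, (tgt e == c) = (e == ga), forall e, (src e == c) = (e == al) || (e == be) &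
       counterclockwise (ray_dir (ga, false)) (ray_dir (al, true)) (ray_dir (be, true))] \/
   [/\ forall e, (src e == c) = (e == ga), forall e, (tgt e == c) = (e == al) || (e == be) &
       counterclockwise (ray_dir (ga, true)) (ray_dir (be, false)) (ray_dir (al, false))]).

Lemma ray_order c i j k : ray_at c i -> ray_at c j -> ray_at c k ->
  i != j -> j != k -> k != i ->
  counterclockwise (ray_dir i) (ray_dir j) (ray_dir k) ||
  counterclockwise (ray_dir i) (ray_dir k) (ray_dir j).
Proof.
move=> ri rj rk ij jk ki; apply: counterclockwise_total; rewrite ?ray_dir_neq0//.
- exact: (ray_distinct wfD ri rj).
- exact: (ray_distinct wfD rj rk).
- exact: (ray_distinct wfD rk ri).
Qed.

Lemma cards2E (P : pred (edge D)) : #|[set e | P e]%SET| = 2%N ->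
  exists x y, x != y /\ forall e, P e = (e == x) || (e == y).
Proof.
move/eqP/cards2P => [x [y [xy E]]]; exists x, y; split=> // e.
by move/setP/(_ e): E; rewrite !inE.
Qed.

(** Three distinct rays have one of two cyclic orders, and this decides which of the two similar
    edges is [al] and which is [be]. *)
Lemma corner_shape c : bivalent c \/ exists ga al be, trivalent_at c ga al be.
Proof.
have /or3P[] : [|| (indegree c, outdegree c) == (1, 1)%N, (indegree c, outdegree c) == (2, 1)%N |
    (indegree c, outdegree c) == (1, 2)%N].
  by case: wfD => _ /(_ c) + _ _ _; rewrite !inE.
- by rewrite xpair_eqE => /andP[/eqP ? /eqP ?]; left.
- rewrite xpair_eqE => /andP[/eqP/cards2E[x [y [xy Et]]] /eqP o1]; right.
  have [ga Es] : exists ga, forall e, (src e == c) = (e == ga).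
    move/eqP/cards1P: o1 => [ga E]; exists ga => e.
    by move/setP/(_ e): E; rewrite !inE.
  have rg : ray_at c (ga, true) by rewrite /ray_at /ray_end /= (eqP (_ : src ga == c)) ?Es.
  have rx : ray_at c (x, false) by rewrite /ray_at /ray_end /= (eqP (_ : tgt x == c)) ?Et ?eqxx.
  have ry : ray_at c (y, false).
    by rewrite /ray_at /ray_end /= (eqP (_ : tgt y == c)) ?Et ?eqxx ?orbT.
  have /orP[cc|cc] : counterclockwise (ray_dir (ga, true)) (ray_dir (x, false)) (ray_dir (y, false)) ||
      counterclockwise (ray_dir (ga, true)) (ray_dir (y, false)) (ray_dir (x, false)).
    by apply: (ray_order rg rx ry); rewrite !xpair_eqE ?andbF// andbT.
  + by exists ga, y, x; split; [rewrite eq_sym|right; split=> // e; rewrite Et orbC].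
  + by exists ga, x, y; split=> //; right.
- rewrite xpair_eqE => /andP[/eqP i1 /eqP/cards2E[x [y [xy Es]]]]; right.
  have [ga Et] : exists ga, forall e, (tgt e == c) = (e == ga).
    move/eqP/cards1P: i1 => [ga E]; exists ga => e.
    by move/setP/(_ e): E; rewrite !inE.
  have rg : ray_at c (ga, false) by rewrite /ray_at /ray_end /= (eqP (_ : tgt ga == c)) ?Et.
  have rx : ray_at c (x, true) by rewrite /ray_at /ray_end /= (eqP (_ : src x == c)) ?Es ?eqxx.
  have ry : ray_at c (y, true).
    by rewrite /ray_at /ray_end /= (eqP (_ : src y == c)) ?Es ?eqxx ?orbT.
  have /orP[cc|cc] : counterclockwise (ray_dir (ga, false)) (ray_dir (x, true)) (ray_dir (y, true)) ||
      counterclockwise (ray_dir (ga, false)) (ray_dir (y, true)) (ray_dir (x, true)).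
    by apply: (ray_order rg rx ry); rewrite !xpair_eqE ?andbF// andbT.
  + by exists ga, x, y; split=> //; left.
  + by exists ga, y, x; split; [rewrite eq_sym|left; split=> // e; rewrite Es orbC].
Qed.

Lemma trivalent_vertex c ga al be : trivalent_at c ga al be -> at_vertex ga al be.
Proof.
move=> [ne [[Et Es cc]|[Es Et cc]]]; exists c; split=> //; [left|right].
  have tg : tgt ga = c by apply/eqP; rewrite Et.
  have sa : src al = c by apply/eqP; rewrite Es eqxx.
  have sb : src be = c by apply/eqP; rewrite Es eqxx orbT.
  split=> //; rewrite -(@ray_dir_outward _ _ wfD c (ga, false))//.
  by rewrite -(@ray_dir_outward _ _ wfD c (al, true))// -(@ray_dir_outward _ _ wfD c (be, true)).
have sg : src ga = c by apply/eqP; rewrite Es.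
have ta : tgt al = c by apply/eqP; rewrite Et eqxx.
have tb : tgt be = c by apply/eqP; rewrite Et eqxx orbT.
split=> //; rewrite -(@ray_dir_outward _ _ wfD c (ga, true))//.
by rewrite -(@ray_dir_outward _ _ wfD c (al, false))// -(@ray_dir_outward _ _ wfD c (be, false)).
Qed.

Lemma trivalent_sums (V : zmodType) (F : edge D -> V) c ga al be : trivalent_at c ga al be ->
  F ga = F al + F be -> \sum_(e | src e == c) F e = \sum_(e | tgt e == c) F e.
Proof.
have two (P : pred (edge D)) : al != be -> (forall e, P e = (e == al) || (e == be)) ->
    \sum_(e | P e) F e = F al + F be.
  move=> ne E; rewrite (bigD1 al) ?E ?eqxx//= (bigD1 be) ?E ?eqxx ?orbT 1?eq_sym//= big1 ?addr0//.
  by move=> e /andP[/andP[]]; rewrite E => /orP[] /eqP ->; rewrite eqxx.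
move=> [ne [[E1 E2 _]|[E1 E2 _]]] FE; rewrite (two _ ne E2) (eq_bigl _ _ E1) big_pred1_eq//.
Qed.

Lemma trivalent_incident c ga al be e : trivalent_at c ga al be -> incident e c ->
  [\/ e = ga, e = al | e = be].
Proof.
move=> [_ [[E1 E2 _]|[E1 E2 _]]]; rewrite /incident E1 E2.
  by move=> /orP[/orP[]|] /eqP ->; [apply: Or32|apply: Or33|apply: Or31].
by move=> /orP[|/orP[]] /eqP ->; [apply: Or31|apply: Or32|apply: Or33].
Qed.

Lemma trivalent_not_bivalent c ga al be : trivalent_at c ga al be -> ~ bivalent c.
Proof.
move=> [ne H] /bivalent_edges[i [o [Ei Eo]]]; case/eqP: ne; case: H => -[_ E2 _].
  have /eqP -> : al == o by rewrite -Eo E2 eqxx.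
  by have /eqP -> : be == o by rewrite -Eo E2 eqxx orbT.
have /eqP -> : al == i by rewrite -Ei E2 eqxx.
by have /eqP -> : be == i by rewrite -Ei E2 eqxx orbT.
Qed.

Lemma passes_over_bivalent a b : passes_over a b -> bivalent a /\ bivalent b.
Proof.
move=> ab; have gen : forall a b : corner D, a <> b -> shadow a = shadow b ->
  generic_crossing a b by case: wfD.
have ne := passes_over_neq ab; have [sab _] := ab.
by have [? _ _ _] := gen a b ne sab; have [? _ _ _] := gen b a (nesym ne) (esym sab).
Qed.

Lemma trivalent_alone c ga al be : trivalent_at c ga al be ->
  forall c', shadow c' = shadow c -> c' = c.
Proof.
move=> /trivalent_not_bivalent nb; apply: (shadow_alone wfD) => b ab; apply: nb.
  by case: (passes_over_bivalent ab).
by case: (passes_over_bivalent ab).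
Qed.

Lemma trivalent_right (Z : zmodType) (r : R2 -> Z) (l rr : edge D -> Z) c ga al be :
  lconst D r -> (forall e, side_value r e (dir e) (l e)) ->
  (forall e, side_value r e (- dir e) (rr e)) -> trivalent_at c ga al be ->
  rr al = rr ga /\ rr be = l al.
Proof.
move=> lr rl rrr tri; have alone := trivalent_alone tri.
case: tri => ne [[Et Es cc]|[Es Et cc]].
  have tg : tgt ga = c by apply/eqP; rewrite Et.
  have sa : src al = c by apply/eqP; rewrite Es eqxx.
  have sb : src be = c by apply/eqP; rewrite Es eqxx orbT.
  have Hu : uniq [:: (ga, false); (al, true); (be, true)].
    by rewrite /= !inE !xpair_eqE ?andbF /= !andbT.
  have Hall q : ray_end q = c -> q \in [:: (ga, false); (al, true); (be, true)].
    case: q => e []; rewrite /ray_end /= => /eqP; rewrite ?Et ?Es !inE !xpair_eqE ?andbT ?andbF ?orbF//.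
  have [E1 E2 E3] := @vertex_sides _ _ wfD Z r l rr lr rl rrr c (ga, false) (al, true) (be, true) alone tg sa sb Hu Hall cc.
  by split; [exact: esym E1|exact: esym E2].
have sg : src ga = c by apply/eqP; rewrite Es.
have ta : tgt al = c by apply/eqP; rewrite Et eqxx.
have tb : tgt be = c by apply/eqP; rewrite Et eqxx orbT.
have Hu : uniq [:: (ga, true); (be, false); (al, false)].
  by rewrite /= !inE !xpair_eqE ?andbF /= !andbT eq_sym.
have Hall q : ray_end q = c -> q \in [:: (ga, true); (be, false); (al, false)].
  case: q => e []; rewrite /ray_end /= => /eqP; rewrite ?Et ?Es !inE !xpair_eqE ?andbT ?andbF ?orbF//.
  by rewrite orbC.
have [E1 E2 E3] := @vertex_sides _ _ wfD Z r l rr lr rl rrr c (ga, true) (be, false) (al, false) alone sg tb ta Hu Hall cc.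
by split; [exact: E3|exact: E2].
Qed.

(** With positive determinant the lower strand goes from the right of the upper one to its left, so
    [ib] is behind and [ob] in front; the upper strand goes from the left of the lower one to its
    right, so [oa] is behind and [ia] in front. *)
Lemma crossing_labels a b ia oa ib ob : passes_over a b -> crossing_frame a b ia oa ib ob ->
  if 0 < det2 (dir ia) (dir ib) then at_crossing ib ob oa ia else at_crossing ob ib ia oa.
Proof.
move=> ab fr; have [_ [Eia Eoa] [Eib Eob] [[ka ka0 dka] [kb kb0 dkb]] dn] := fr.
have ta : tgt ia = a by apply/eqP; rewrite Eia.
have sa : src oa = a by apply/eqP; rewrite Eoa.
have tb : tgt ib = b by apply/eqP; rewrite Eib.
have sb : src ob = b by apply/eqP; rewrite Eob.
have oia : outward a ia = - dir ia by rewrite -(@ray_dir_outward _ _ wfD a (ia, false)).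
have ooa : outward a oa = dir oa by rewrite -(@ray_dir_outward _ _ wfD a (oa, true)).
have oib : outward b ib = - dir ib by rewrite -(@ray_dir_outward _ _ wfD b (ib, false)).
have oob : outward b ob = dir ob by rewrite -(@ray_dir_outward _ _ wfD b (ob, true)).
have inc : [/\ incident ia a, incident oa a, incident ib b & incident ob b].
  by rewrite /incident ta sa tb sb !eqxx ?orbT.
have [ic1 ic2 ic3 ic4] := inc.
case: ifPn => [d0|]; last rewrite -leNgt le_eqVlt (negbTE dn) /= => d0.
  exists a, b; split=> //; rewrite ?oia ?ooa ?oib ?oob ?dka ?dkb ?det2Nr ?det2Zl ?det2Zr.
    by rewrite oppr_lt0 !pmulr_rgt0// d0.
  by rewrite (det2C (dir ib)) mulrN oppr_lt0 opprK pmulr_rgt0// d0.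
exists a, b; split=> //; rewrite ?oia ?ooa ?oib ?oob ?dka ?dkb ?det2Nr ?det2Zl ?det2Zr.
  by rewrite oppr_gt0 pmulr_rlt0// d0.
rewrite (det2C (dir ib)) !mulrN !opprK !oppr_gt0 pmulr_rlt0// d0 /=.
by rewrite !pmulr_rlt0.
Qed.

End Vertices.

Section PowerCharacter.
Variables (X : fieldType) (m : nat) (x : X).
Definition power_char (k : 'I_m.+1) : X := x ^+ k.

Lemma power_charP : x ^+ m.+1 = 1 -> character_to power_char.
Proof.
move=> xm; split; first by rewrite /power_char expr0.
by move=> a b; rewrite /power_char -exprD -[RHS](expr_mod _ xm).
Qed.
End PowerCharacter.

Lemma characterN (Z : zmodType) (X : fieldType) (chi : Z -> X) : character_to chi ->
  forall k, chi (- k) * chi k = 1 /\ chi k != 0.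
Proof.
move=> chiP k; have E : chi (- k) * chi k = 1 by rewrite -chiP.2 addNr chiP.1.
split=> //; apply: contra_eq_neq E => ->; rewrite mulr0 eq_sym; exact: oner_neq0.
Qed.

(** * Colorings *)

Section Coloring.
Variables (R : realType) (D : diagram R) (X : fieldType) (s t : X) (m : nat).
Hypothesis wfD : wf_diagram D.
Hypotheses (sm : s ^+ m.+1 = 1) (tm : t ^+ m.+1 = 1).
Variable phi : edge D -> 'I_m.+1.
Hypothesis phi_flow : is_flow phi.
Local Notation R2 := (R * R)%type.
Implicit Types (e f : edge D) (a b c : corner D).

Lemma crossing_under_flow a b ia oa ib ob : passes_over a b ->
  crossing_frame a b ia oa ib ob -> phi ib = phi ob.
Proof.
move=> ab fr; have [_ fc _] := phi_flow.
have := crossing_labels wfD ab fr; case: ifP => _ /fc //.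
Qed.

Lemma trivalent_flow c ga al be : trivalent_at c ga al be -> phi ga = phi al + phi be.
Proof.
move=> /(trivalent_vertex wfD) vx; have [_ _ /(_ _ _ _ vx) E] := phi_flow.
by apply: val_inj; rewrite /= -E modn_small.
Qed.

Lemma flow_corner : corner_flow phi.
Proof.
move=> c; have [biv|[ga [al [be tri]]]] := corner_shape wfD c; last first.
  exact: (trivalent_sums tri (trivalent_flow tri)).
have [i [o [Ei Eo]]] := bivalent_edges biv.
rewrite (eq_bigl _ _ Ei) (eq_bigl _ _ Eo) !big_pred1_eq.
have [[b bc]|nb] := pselect (exists b, passes_over b c); last first.
  have [ca _ _] := phi_flow; apply/esym; apply: (ca c) => //.
    by apply/eqP; rewrite Ei.
  by apply/eqP; rewrite Eo.
have [ia [oa [ib [ob fr]]]] := crossing_frame_over wfD bc.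
have [_ _ [Eib Eob] _ _] := fr.
have -> : i = ib by apply/eqP; rewrite -Eib Ei.
have -> : o = ob by apply/eqP; rewrite -Eob Eo.
by rewrite (crossing_under_flow bc fr).
Qed.

Variables (r : R2 -> 'I_m.+1) (l rr : edge D -> 'I_m.+1).
Hypotheses (lr : lconst D r) (rl : forall e, side_value r e (dir e) (l e))
  (rrr : forall e, side_value r e (- dir e) (rr e)) (phiE : forall e, phi e = l e - rr e).

Local Notation cs := (@power_char X m s).
Local Notation ct := (@power_char X m t).
Local Notation chi := (@power_char X m (s / t)).

Let csP : character_to cs := power_charP sm.
Let ctP : character_to ct := power_charP tm.
Lemma chiP : character_to chi.
Proof. by apply: power_charP; rewrite expr_div_n sm tm divr1. Qed.

(** [rr e] is the index of the region to the right of [e]. The factor by which a coloring changes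
    along an over strand or at a vertex is the power of [s] by which this index changes, so the
    untwisted function is constant there. *)
Definition untwist (C : edge D -> X) e : X := cs (- rr e) * C e.

Section OneColoring.
Variable C : edge D -> X.
Hypothesis col : is_coloring s t phi C.
Local Notation A := (untwist C).

(** In $C(w)=t^n C(u)+(s^n-t^n)C(v)$ with $n=\phi(v)$, the index of [w] is larger by $n$ than those
    of [u] and [v]. Division by $s^n$ makes the two coefficients add up to 1 and leaves the ratio
    $(s/t)^n$. *)
Lemma untwist_crossing u w v v' : rr u = rr v -> rr w = rr v + phi v ->
  rr v' = rr u + phi u -> at_crossing u w v v' ->
  A v' = A v /\ A u - A v = chi (phi v) * (A w - A v).
Proof.
move=> Eu Ew Ev at_; have [_ /(_ _ _ _ _ at_)[Cw Cv] _] := col.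
rewrite /untwist Ev Ew Cv Cw Eu /biq_over /biq_under -!exprnP.
have [c1 n1] := characterN csP (phi u); have [c2 n2] := characterN csP (phi v).
have [c3 n3] := characterN ctP (phi v).
have chE : chi (phi v) = cs (phi v) / ct (phi v) by rewrite /power_char expr_div_n.
rewrite -[s ^+ phi u]/(cs (phi u)) -[s ^+ phi v]/(cs (phi v)) -[t ^+ phi v]/(ct (phi v)).
rewrite chE !opprD !csP.2.
split; first by rewrite mulrA -[_ * _ * cs _]mulrA c1 mulr1.
have c2' : cs (- phi v) = (cs (phi v))^-1 by apply: (mulIf n2); rewrite c2 mulVf.
rewrite c2'; field; by apply/andP.
Qed.

(** The sign of the crossing decides which lower edge plays the role of [u]. Exchanging the two
    inverts the factor, and so does the sign in [crossing_weight]. *)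
Lemma untwist_over a b ia oa ib ob : passes_over a b -> crossing_frame a b ia oa ib ob ->
  A ia = A oa /\ A ib - A ia = chi (crossing_weight phi b) * (A ob - A ia).
Proof.
move=> ab fr; rewrite (crossing_weightE wfD _ ab fr).
have [So Si _ _] := under_sums phi fr.
have pio : phi ia = phi oa by rewrite -So -Si flow_corner.
have := crossing_labels wfD ab fr.
case: ifPn => [d0|d0] at_.
  have [E1 E2 E3 E4] := crossing_sides wfD lr rl rrr fr d0.
  have [|||E5 E6] := @untwist_crossing ib ob oa ia _ _ _ at_.
  - exact: E4.
  - by rewrite -E1 phiE addrC subrK.
  - by rewrite E3 phiE addrC subrK.
  by rewrite E5 pio.
have d0' : 0 < det2 (dir ib) (dir ia).
  by have [_ _ _ _ dn] := fr; rewrite det2C oppr_gt0 lt_neqAle dn leNgt.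
have [E1 E2 E3 E4] := crossing_sides wfD lr rl rrr (crossing_frame_swap fr) d0'.
have [|||E5 E6] := @untwist_crossing ob ib ia oa _ _ _ at_.
- by rewrite E4.
- by rewrite E3 phiE addrC subrK.
- by rewrite -E1 phiE addrC subrK.
rewrite E5; split=> //; have [ch nz] := characterN chiP (phi ia).
by rewrite E6 mulrA ch mul1r.
Qed.

Lemma untwist_vertex c ga al be : trivalent_at c ga al be -> A al = A ga /\ A be = A ga.
Proof.
move=> tri; have [Er El] := trivalent_right wfD lr rl rrr tri.
have [_ _ /(_ _ _ _ (trivalent_vertex wfD tri))[Ca Cb]] := col.
rewrite /untwist Er Ca Cb; split=> //.
have -> : rr be = rr ga + phi al by rewrite El -Er phiE addrC subrK.
rewrite /biq_over -exprnP -[s ^+ _]/(cs (phi al)) opprD csP.2.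
have [ch _] := characterN csP (phi al).
by rewrite mulrA -[_ * _ * cs _]mulrA ch mulr1.
Qed.

Lemma untwist_corner c e f : ~~ is_under_corner c -> incident e c -> incident f c -> A e = A f.
Proof.
move=> nc; have [biv|[ga [al [be tri]]]] := corner_shape wfD c; last first.
  have [E1 E2] := untwist_vertex tri.
  by move=> /(trivalent_incident tri)[] -> /(trivalent_incident tri)[] ->; rewrite ?E1 ?E2.
have [i [o [Ei Eo]]] := bivalent_edges biv.
suff E : A i = A o.
  by rewrite /incident !Ei !Eo => /orP[] /eqP -> /orP[] /eqP ->; rewrite ?E.
have [[b cb]|nb] := pselect (exists b, passes_over c b).
  have [ia [oa [ib [ob fr]]]] := crossing_frame_over wfD cb.
  have [_ [Eia Eoa] _ _ _] := fr.
  have -> : i = ia by apply/eqP; rewrite -Eia Ei.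
  have -> : o = oa by apply/eqP; rewrite -Eoa Eo.
  by have [] := untwist_over cb fr.
have na : ~ exists b, passes_over b c by move=> h; move/is_underP: nc; apply.
have alone : forall c', shadow c' = shadow c -> c' = c.
  by apply: (shadow_alone wfD) => b h; [apply: nb|apply: na]; exists b.
have [_ Er] := bend_sides wfD lr rl rrr alone Ei Eo.
have [cc _ _] := col; rewrite /untwist Er (cc c i o) //.
- by apply/eqP; rewrite Ei.
- by apply/eqP; rewrite Eo.
- by move=> [b [h|h]]; [apply: na|apply: nb]; exists b.
Qed.

End OneColoring.

(** For an untwisted coloring any edge at a corner that is not under gives the same value; the
    default 0 does not occur, since every corner has an edge. *)
Definition corner_value (A : edge D -> X) c : X :=
  if [pick e | incident e c] is Some e then A e else 0.

(* Chosen so that [out_part] and [in_part] return the value of [A] on the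
   outgoing and incoming edges. *)
Definition dual_value (A : edge D -> X) c : X :=
  if is_under_corner c then
    \sum_(e | src e == c) A e - \sum_(a | `[< passes_over a c >]) corner_value A a
  else corner_value A c.

Lemma corner_valueE C c e : is_coloring s t phi C -> ~~ is_under_corner c -> incident e c ->
  corner_value (untwist C) c = untwist C e.
Proof.
move=> col nc ec; rewrite /corner_value; case: pickP => [f fc|/(_ e)]; last by rewrite ec.
exact: (untwist_corner col nc).
Qed.

Lemma dual_parts C : is_coloring s t phi C ->
  (forall e, out_part (dual_value (untwist C)) (src e) = untwist C e) /\
  (forall e, in_part (flow_weight chi phi) (dual_value (untwist C)) (tgt e) = untwist C e).
Proof.
move=> col; set A := untwist C; set y := dual_value A.
have under a b ia oa ib ob : passes_over a b -> crossing_frame a b ia oa ib ob ->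
    over_part y b = A ia /\ y b = A ob - A ia.
  move=> ab fr; have [[sab _] [Eia Eoa] [Eib Eob] _ _] := fr.
  have na : ~~ is_under_corner a.
    by apply/is_underP => -[c ca]; exact: (passes_over_asym wfD ab ca).
  have ub : is_under_corner b by apply/is_underP; exists a.
  have inc : incident ia a by rewrite /incident Eia eqxx orbT.
  have va : corner_value A a = A ia by exact: corner_valueE.
  split.
    rewrite -(over_part_shadow y sab) over_part_alone//.
    by rewrite /y /dual_value (negbTE na).
  rewrite /y /dual_value ub (eq_bigl _ _ Eob) big_pred1_eq (bigD1 a)/=; last exact/asboolP.
  rewrite va big1 ?addr0// => c /andP[/asboolP cb /eqP ca].
  by case: ca; exact: (passes_over_unique wfD cb ab).
split=> e.
  rewrite /out_part; case: (boolP (is_under_corner (src e))) => [ue|ne]; last first.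
    rewrite mul0r addr0 over_part_alone// /y /dual_value (negbTE ne).
    by apply: corner_valueE => //; rewrite /incident eqxx.
  have [a ab] := is_underP _ ue; have [ia [oa [ib [ob fr]]]] := crossing_frame_over wfD ab.
  have [-> ->] := under _ _ _ _ _ _ ab fr; have [_ _ [_ Eob] _ _] := fr.
  have -> : e = ob by apply/eqP; rewrite -Eob.
  by rewrite mul1r addrC subrK.
rewrite /in_part; case: (boolP (is_under_corner (tgt e))) => [ue|ne]; last first.
  rewrite mul0r addr0 over_part_alone// /y /dual_value (negbTE ne).
  by apply: corner_valueE => //; rewrite /incident eqxx orbT.
have [a ab] := is_underP _ ue; have [ia [oa [ib [ob fr]]]] := crossing_frame_over wfD ab.
have [-> ->] := under _ _ _ _ _ _ ab fr; have [_ _ [Eib _] _ _] := fr.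
have [_ E] := untwist_over col ab fr.
have -> : A e = A ib by congr A; apply/eqP; rewrite -Eib.
by rewrite mul1r /flow_weight -E addrC subrK.
Qed.

Lemma coloring_dual C e : is_coloring s t phi C ->
  \sum_c incidence_coef (flow_weight chi phi) e c * dual_value (untwist C) c = 0.
Proof.
by move=> col; have [E1 E2] := dual_parts col; rewrite incidence_dual// E1 E2 subrr.
Qed.

Lemma dual_value_sum n (u : 'I_n -> X) (A : 'I_n -> edge D -> X) c :
  dual_value (fun e => \sum_i u i * A i e) c = \sum_i u i * dual_value (A i) c.
Proof.
have cv c' : corner_value (fun e => \sum_i u i * A i e) c' = \sum_i u i * corner_value (A i) c'.
  rewrite /corner_value; case: pickP => // _.
  by rewrite big1// => i _; rewrite mulr0.
rewrite /dual_value; case: (is_under_corner c); last exact: cv.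
under [X in _ = X]eq_bigr do rewrite mulrBr !mulr_sumr.
rewrite sumrB; congr (_ - _); first by rewrite exchange_big.
by rewrite exchange_big; apply: eq_bigr => a _; rewrite cv.
Qed.

(** A basis of colorings gives rows in the kernel of the transposed matrix. They are independent
    because [dual_value] is linear and [out_part] recovers from it the untwisted coloring, hence the
    coloring. *)
Lemma coloring_nullity :
  (\dim (Col s t phi) + #|edge D| <= nullity (flow_weight chi phi) + #|corner D|)%N.
Proof.
rewrite nullity_dual addnC leq_add2l.
pose n := \dim (Col s t phi); pose b := vbasis (Col s t phi).
have colb (i : 'I_n) : is_coloring s t phi (b`_i : {ffun edge D -> X^o}).
  by apply/mem_Col; apply: vbasis_mem; rewrite mem_nth// size_tuple.
pose Y (i : 'I_n) := dual_value (untwist (b`_i : {ffun edge D -> X^o})).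
have Yker : corner_row Y *m (incidence (flow_weight chi phi))^T = 0.
  apply/corner_row_ker => i e; rewrite -[RHS](coloring_dual e (colb i)).
  by apply: eq_bigr => c _; rewrite mxE enum_rankK.
have rank : (\rank (corner_row Y) <= \rank (kermx (incidence (flow_weight chi phi))^T))%N.
  by apply: mxrankS; apply/sub_kermxP.
suff : row_free (corner_row Y) by rewrite /row_free => /eqP E; move: rank; rewrite E.
rewrite -kermx_eq0; apply/eqP/row_matrixP => j; rewrite row0; set u := row j _.
have uY : u *m corner_row Y = 0 by rewrite /u -row_mul mulmx_ker row0.
pose C : {ffun edge D -> X^o} := \sum_(i < n) u 0 i *: b`_i.
have CE e : C e = \sum_(i < n) u 0 i * (b`_i : {ffun edge D -> X^o}) e.
  by rewrite /C sum_ffunE; apply: eq_bigr => i _; rewrite ffunE.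
have colC : is_coloring s t phi C.
  apply/mem_Col; apply: memv_suml => i _; apply: memvZ.
  by apply: vbasis_mem; rewrite mem_nth// size_tuple.
have y0 c : dual_value (untwist C) c = 0.
  have -> : untwist C = fun e => \sum_(i < n) u 0 i * untwist (b`_i : {ffun edge D -> X^o}) e.
    by apply/funext => e; rewrite /untwist CE mulr_sumr; apply: eq_bigr => i _; rewrite mulrCA.
  have := congr1 (fun M : 'rV[X]_#|corner D| => M 0 (enum_rank c)) uY.
  rewrite [LHS]mxE [RHS]mxE dual_value_sum => uYc; rewrite -[RHS]uYc.
  by apply: eq_bigr => i _; rewrite [corner_row _ _ _]mxE enum_rankK.
have C0 : C = 0.
  apply/ffunP => e; rewrite [RHS]ffunE.
  have [E _] := dual_parts colC; have := E e.
  rewrite /out_part /over_part big1 ?y0 ?mulr0 ?addr0//.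
  have [_ n0] := characterN csP (- rr e).
  by move/esym/eqP; rewrite /untwist mulf_eq0 (negbTE n0) => /eqP.
have /freeP fr := basis_free (vbasisP (Col s t phi)).
by apply/matrixP => x i; rewrite ord1 [RHS]mxE; apply: (fr (fun i => u 0 i)).
Qed.

End Coloring.

(** * Connectedness of the graph *)

Section Connectivity.
Variables (R : realType) (D : diagram R).
Local Notation R2 := (R * R)%type.
Local Notation R3 := (R * R * R)%type.
Implicit Types (e f : edge D) (a b c : corner D) (p q : R3).

Lemma edges_apart e f : wf_diagram D ->
  (forall t u, 0 <= t <= 1 -> 0 <= u <= 1 -> edge_point e t <> edge_point f u) ->
  exists2 d : R, 0 < d & forall t u, 0 <= t <= 1 -> 0 <= u <= 1 ->
    d <= `|edge_point e t - edge_point f u|.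
Proof.
move=> wfD ne; have [C C1 HC] := edge_proj_lip wfD.
pose g t : R := `|edge_point e t - edge_proj f (edge_point e t)|.
have c : {within `[0, 1], continuous g}%classic.
  apply: continuous_subspaceT => t; apply: cvg_norm; apply: cvgB.
    exact: edge_point_continuous.
  apply: (@continuous_comp _ _ _ (edge_point e) (edge_proj f)); first exact: edge_point_continuous.
  exact: (edge_proj_continuous wfD).
have [t0] := EVT_min (@ler01 R) c; rewrite in_itv /= => t001 Hmin.
have g0 : 0 < g t0.
  rewrite normr_gt0 subr_eq0; apply/eqP; apply: ne => //; exact: clamp01.
have C2 : 0 < 1 + C by lra.
exists (g t0 / (1 + C)); first by rewrite divr_gt0.
move=> t u t01 u01; rewrite ler_pdivrMr// mulrC.
apply: le_trans (edge_proj_dist wfD HC f (edge_point e t) u01).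
by apply: Hmin; rewrite in_itv.
Qed.

(** A point level with the holes first moves down to the edge of the square, in a column free of
    holes; then it moves parallel to the first axis to the face where that coordinate is 0, and
    inside this face to the origin. *)
Lemma model_path (g : nat) (P : R3 -> Prop) :
  (forall x y : R3, (forall t, 0 <= t <= 1 -> handlebody_model g (x + t *: (y - x))) -> P x <-> P y) ->
  forall x, handlebody_model g x -> P x <-> P (0, 0, 0).
Proof.
move=> seg.
have g0 : 0 <= (2 * g + 1)%:R :> R by [].
have comb (x y lo hi t : R) : lo <= x <= hi -> lo <= y <= hi -> 0 <= t <= 1 ->
    lo <= x + t * (y - x) <= hi.
  by move=> /andP[? ?] /andP[? ?] /andP[? ?]; apply/andP; split; nra.
have step (x y : R3) : handlebody_model g x -> handlebody_model g y ->
    (forall i t, (i < g)%N -> 0 <= t <= 1 ->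
      ~ ((2 * i + 1)%:R < (x + t *: (y - x)).1.1 < (2 * i + 2)%:R /\
         1 < (x + t *: (y - x)).1.2 < 2)) -> P x <-> P y.
  move=> [x1 x2 x3 _] [y1 y2 y3 _] H; apply: seg => t t01; split; [exact: comb..|].
  by move=> i ig; exact: H.
have bot : handlebody_model g (0, 0, 0 : R).
  split; rewrite /= ?lexx ?g0 ?ler0n ?ler01//.
  by move=> i _ [_ /andP[h _]]; have := lt_trans ltr01 h; rewrite ltxx.
have col0 (y z : R) : 0 <= y <= 3 -> 0 <= z <= 1 -> P (0, y, z) <-> P (0, 0, 0).
  move=> y03 z01; apply: step => //.
    split; rewrite /= ?lexx ?g0// => i _ [/andP[h _] _].
    by move: h; rewrite ltNge ler0n.
  move=> i t _ _ /= [/andP[h _] _]; move: h; rewrite subrr scaler0 addr0.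
  by rewrite ltNge ler0n.
have row (x y z : R) : handlebody_model g (x, y, z) -> ~ (1 < y < 2) -> P (x, y, z) <-> P (0, 0, 0).
  move=> [x1 x2 x3 _] ny; rewrite -(col0 y z x2 x3); apply: step.
  - by split=> // i _ [_ /ny].
  - by split=> //=; [rewrite lexx g0|move=> i _ [_ /ny]].
  - by move=> i t _ _ /= [_]; rewrite subrr scaler0 addr0.
move=> [[x y] z] mx; have [/andP[y1 y2]|ny] := boolP (1 < y < 2); last exact/row/negP.
have [x1 x2 x3 xh] := mx.
have ncol i : (i < g)%N -> ~ ((2 * i + 1)%:R < x < (2 * i + 2)%:R).
  by move=> ig h; apply: (xh i ig) => /=; rewrite y1 y2.
have m0 : handlebody_model g (x, 0, z).
  by split=> //=; [rewrite lexx ler0n|move=> i ig [h _]; exact: (ncol i ig h)].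
rewrite -(@row x 0 z) //; last by rewrite ltr10 => /andP[].
by apply: step => // i t ig _ /= [h _]; apply: (ncol i ig); move: h; rewrite subrr scaler0 addr0.
Qed.

(** If the edges separated the corners into two nonempty parts, a thin tube would split accordingly
    into two parts open in it. But the tube is an image of the handlebody model, which is
    connected. *)
Lemma represents_connected (H : handlebody_knot R) :
  represents D (hk_set H) -> connected_graph D.
Proof.
move=> [wfD [e0 e00 Hh]] P eP c c' Pc; apply: contrapT => nPc'.
have apart e f : P (src e) -> ~ P (src f) -> forall t u, 0 <= t <= 1 -> 0 <= u <= 1 ->
    edge_point e t <> edge_point f u.
  move=> Pe nPf t u t01 u01 E.
  have ne : e <> f by move=> ef; rewrite ef in Pe.
  have [tE uE] : (t = 0 \/ t = 1) /\ (u = 0 \/ u = 1).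
    by case: wfD => _ _ _ H0 _; apply: (H0 e f t u ne t01 u01); rewrite E.
  have ends g v : v = 0 \/ v = 1 -> exists2 d, edge_point g v = pos d & P d <-> P (src g).
    case=> ->; [exists (src g) => //|exists (tgt g); last by rewrite eP].
      by rewrite /edge_point subr0 scale1r scale0r addr0.
    by rewrite /edge_point subrr scale1r scale0r add0r.
  have [d dE Pd] := ends e t tE; have [d' dE' Pd'] := ends f u uE.
  have dd : d = d' by case: wfD => inj _ _ _ _; apply: inj; rewrite -dE -dE'.
  by apply: nPf; apply/Pd'; rewrite -dd; apply/Pd.
have /choice[dd ddP] (ef : edge D * edge D) : exists d : R, 0 < d /\
    (P (src ef.1) -> ~ P (src ef.2) -> forall t u, 0 <= t <= 1 -> 0 <= u <= 1 ->
       d <= `|edge_point ef.1 t - edge_point ef.2 u|).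
  have [[Pe nPf]|n] := pselect (P (src ef.1) /\ ~ P (src ef.2)); last first.
    by exists 1; split=> // Pe nPf; case: n.
  have [d d0 Hd] := edges_apart wfD (apart _ _ Pe nPf).
  by exists d; split=> // _ _; exact: Hd.
have [d d0 Hd] := fin_lower_bound (fun ef => (ddP ef).1).
have far e f t u : P (src e) -> ~ P (src f) -> 0 <= t <= 1 -> 0 <= u <= 1 ->
    d <= `|edge_point e t - edge_point f u|.
  by move=> Pe nPf t01 u01; exact: le_trans (Hd (e, f)) ((ddP (e, f)).2 Pe nPf t u t01 u01).
(* [d] is a lower bound for the distance between the two parts of the spine, so three steps of
   length at most [eps] cannot lead from one to the other. *)
pose eps := Num.min (e0 / 2) (d / 4).
have [eps1 eps2] : eps <= e0 / 2 /\ eps <= d / 4 by rewrite !ge_min !lexx orbT.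
have eps0 : 0 < eps by rewrite lt_min !divr_gt0.
have [|h [[ch [k [ck hK kK]]] Eh]] := Hh eps; first by rewrite eps0 /=; lra.
have [hm [chm _ Em _]] := hk_handlebody H.
pose Q (y : S3 R) := exists q, y = Some q /\ exists e t,
  [/\ P (src e), 0 <= t <= 1 & `|q - edge_point e t| <= eps].
have Qloc q : \forall q' \near q, tube D eps q -> tube D eps q' ->
    Q (Some q) <-> Q (Some q').
  apply/near_norm; exists eps => // q' qq'.
  have go p p' : `|p - p'| < eps -> tube D eps p' -> Q (Some p) -> Q (Some p').
    move=> pp' [_ [f [u [u01 ->]]] fle] [_ [[<-] [e [t [Pe t01 ele]]]]].
    exists p'; split=> //; exists f, u; split=> //; apply: contrapT => nPf.
    have := far e f t u Pe nPf t01 u01; apply/negP; rewrite -ltNge.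
    apply: le_lt_trans (ler_distD p _ _) _.
    apply: le_lt_trans (lerD (lexx _) (ler_distD p' _ _)) _.
    rewrite distrC; apply: le_lt_trans (lerD ele (lerD (ltW pp') fle)) _.
    by lra.
  move=> tq tq'; split; first exact: go.
  by apply: go => //; rewrite distrC.
have inT x : handlebody_model (hk_genus H) x -> exists2 q, k (hm x) = Some q & tube D eps q.
  move=> mx; have : hk_set H (hm x) by rewrite -Em; exists x.
  by rewrite -Eh => -[_ [q tq <-] <-]; exists q; rewrite ?hK.
have loc x : handlebody_model (hk_genus H) x -> \forall x' \near x,
    handlebody_model (hk_genus H) x' -> Q (k (hm x)) <-> Q (k (hm x')).
  move=> mx; have [q qE tq] := inT x mx.
  have N : \forall y \near k (hm x), in_S3 (tube D eps) y -> Q (k (hm x)) <-> Q y.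
    rewrite qE; apply/near_some; apply: filterS (Qloc q) => q' Hq [p tp [pq]].
    by apply: Hq => //; rewrite -pq.
  have N1 := ck _ _ N.
  have N2 : \forall x' \near x, handlebody_model (hk_genus H) x' ->
      in_S3 (tube D eps) (k (hm x')) -> Q (k (hm x)) <-> Q (k (hm x')).
    exact: ((@subspace_continuousP R3 (handlebody_model (hk_genus H)) (S3 R) hm).1 chm x mx _ N1).
  apply: filterS N2 => x' H' mx'; apply: H' => //.
  by have [q' -> tq'] := inT x' mx'; exists q'.
have const x : handlebody_model (hk_genus H) x ->
    Q (k (hm x)) <-> Q (k (hm (0, 0, 0))).
  apply: (model_path (P := fun x => Q (k (hm x)))) => {}x y mxy.
  have cl : continuous (fun t : R => x + t *: (y - x)).
    move=> t; apply: cvgD; first exact: cvg_cst.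
    by apply: cvgZ; [exact: cvg_id|exact: cvg_cst].
  pose S t := Q (k (hm (x + t *: (y - x)))).
  have Sind t u : 0 <= t <= 1 -> 0 <= u <= 1 -> S t -> S u.
    apply: segment_induction => {}t t01; have := continuous_near (cl t) (loc _ (mxy t t01)).
    by apply: filterS => v Hv v01; apply: Hv; exact: mxy.
  have E0 : S 0 = Q (k (hm x)) by rewrite /S scale0r addr0.
  have E1 : S 1 = Q (k (hm y)) by rewrite /S scale1r addrC subrK.
  have z01 : 0 <= (0 : R) <= 1 by rewrite lexx ler01.
  have o01 : 0 <= (1 : R) <= 1 by rewrite lexx ler01.
  by rewrite -E0 -E1; split; exact: Sind.
have end_edge a : exists e t, [/\ 0 <= t <= 1, edge_point e t = pos a & P (src e) <-> P a].
  have [e ea] := corner_edge wfD a; have [t t01 tE] := incident_sh ea.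
  exists e, t; split=> //; first by case: t01 => ->; rewrite lexx ler01.
  by move: ea => /orP[] /eqP <- //; rewrite eP.
have pre a : exists2 x, handlebody_model (hk_genus H) x & k (hm x) = Some (pos a).
  have : hk_set H (h (Some (pos a))).
    rewrite -Eh; exists (Some (pos a)) => //; exists (pos a) => //.
    by exists (pos a); [exact: spine_corner|rewrite subrr normr0 ltW].
  by rewrite -Em => -[x mx xE]; exists x => //; rewrite xE hK.
have [x mx xE] := pre c; have [x' mx' xE'] := pre c'.
have Qc : Q (Some (pos c)).
  exists (pos c); split=> //; have [e [t [t01 tE Pe]]] := end_edge c.
  by exists e, t; split=> //; [exact/Pe|rewrite tE subrr normr0 (ltW eps0)].
have : Q (Some (pos c')) by rewrite -xE'; apply/(const _ mx'); apply/(const _ mx); rewrite xE.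
move=> [_ [[<-] [e [t [Pe t01 le]]]]].
have [f [u [u01 uE Pf]]] := end_edge c'.
have nPf : ~ P (src f) by rewrite Pf.
have := far e f t u Pe nPf t01 u01; rewrite uE distrC => h1.
by have := le_trans h1 le; lra.
Qed.

End Connectivity.

(** * Crossing changes *)

Section Deformations.
Variables (R : realType) (X : fieldType).
Implicit Types (D : diagram R) (H : handlebody_knot R).

Definition trivial_nullity D : nat := nullity (fun _ : corner D => 1%R : X).

Lemma diagram_represents D H : is_diagram_of D H -> represents D (hk_set H).
Proof.
move=> [wfD [e0 e00 Hh] _]; split=> //; exists e0 => // e /Hh[h [[hh _] _ Eh]].
by exists h.
Qed.

Lemma trivial_nullity_transfer D1 D2 (H : set (S3 R)) :
  represents D1 H -> represents D2 H -> (trivial_nullity D1 <= trivial_nullity D2)%N.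
Proof.
(* With the one-element group and the character 1, the weights of all flows are 1. *)
move=> rep1 rep2; have chiP : character_to (fun _ : 'I_1 => 1 : X).
  by split=> // x y; rewrite mulr1.
have fl : corner_flow (fun _ : edge D1 => 0 : 'I_1) by move=> a; rewrite !big1.
by have [phi _] := nullity_transfer chiP rep1 rep2 fl.
Qed.

Lemma represents_equiv D H1 H2 : hk_equiv H1 H2 -> represents D (hk_set H1) ->
  represents D (hk_set H2).
Proof.
move=> [g [[[cg [k [ck gK kK]]] _] Eg _]] [wfD [e0 e00 Hh]]; split=> //.
exists e0 => // e /Hh[h [[ch [j [cj hK jK]]] Eh]].
exists (g \o h); split.
  split; first by move=> y; apply: continuous_comp; [exact: ch|exact: cg].
  exists (j \o k); split; last exact: can_comp.
    by move=> y; apply: continuous_comp; [exact: ck|exact: cj].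
  exact: can_comp.
by rewrite -Eg -Eh image_comp.
Qed.

Variables (Z : zmodType) (chi : Z -> X).
Hypothesis chiP : character_to chi.

(** The inequalities run in opposite directions: the twisted nullity is followed forwards, while the
    trivial one at the end is bounded by that of the initial diagram. A crossing change comes with
    its own diagram [D], to which [D1] is compared before the switch. *)
Lemma deforms_nullity n H1 H2 : deforms n H1 H2 -> forall D1, represents D1 (hk_set H1) ->
  exists D2, [/\ represents D2 (hk_set H2), (trivial_nullity D2 <= trivial_nullity D1)%N &
    forall phi1 : edge D1 -> Z, corner_flow phi1 -> exists2 phi2 : edge D2 -> Z, corner_flow phi2 &
      (nullity (flow_weight chi phi1) <= nullity (flow_weight chi phi2) + n)%N].
Proof.
elim=> {n H1 H2} [H1 H2 eq12 D1 rep1|H1 H2 [D [z [sw dD dD']]] D1 rep1|n k H1 H2 H3 _ IH1 _ IH2 D1 rep1].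
- exists D1; split=> //; first exact: represents_equiv rep1.
  by move=> phi fl; exists phi; rewrite ?addn0.
- have rep := diagram_represents dD; have rep' := diagram_represents dD'.
  have [wfD _] := rep; have [wfD' _] := rep'.
  exists (set_heights z); split=> //.
    exact: leq_trans (nullity1_set_heights X wfD wfD') (trivial_nullity_transfer rep rep1).
  move=> phi1 fl1; have [phi fl le] := nullity_transfer chiP rep1 rep fl1.
  exists phi; first exact: fl.
  exact: leq_trans le (nullity_switch wfD wfD' chi phi sw).
- have [D2 [rep2 le2 IH]] := IH1 D1 rep1; have [D3 [rep3 le3 IH']] := IH2 D2 rep2.
  exists D3; split=> //; first exact: leq_trans le3 le2.
  move=> phi1 fl1; have [phi2 fl2 l2] := IH phi1 fl1; have [phi3 fl3 l3] := IH' phi2 fl2.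
  by exists phi3 => //; move: l2 l3; lia.
Qed.

Lemma crossingless_nullity D (w : corner D -> X) : crossingless D -> nullity w = trivial_nullity D.
Proof.
move=> nc; congr (\rank (kermx _)); apply/matrixP => i j; rewrite !mxE /incidence_coef.
case: is_underP => // -[a ac]; case: (passes_over_neq ac); apply: nc.
by case: ac.
Qed.

(** The sequence of crossing changes ends at a handlebody-knot with a crossingless diagram, where
    twisted and trivial nullity coincide; the trivial nullity is then traced back to [D]. *)
Lemma unknotting_nullity D H u : is_diagram_of D H -> is_unknotting_number H u ->
  forall phi : edge D -> Z, corner_flow phi ->
    (nullity (flow_weight chi phi) <= trivial_nullity D + u)%N.
Proof.
move=> dD [O [[DO [dO nc]] _ [def _]]] phi fl; have rep := diagram_represents dD.
have repO := diagram_represents dO.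
have [D2 [rep2 le2 H2]] := deforms_nullity def rep.
have [phi2 fl2 l2] := H2 phi fl.
have [phiO flO lO] := nullity_transfer chiP rep2 repO fl2.
rewrite (crossingless_nullity (flow_weight chi phiO) nc) in lO.
have l3 := trivial_nullity_transfer repO rep2.
by move: l2 lO l3 le2; lia.
Qed.

End Deformations.

Theorem corollary6p2 (R : realType) (p : nat) (p_prime : prime p)
    (f s : laurent 'F_p) (f_irr : laurent_irreducible f)
    (X : fieldType) (cl : {rmorphism laurent 'F_p -> X})
    (cl_surj : forall x : X, exists a, cl a = x)
    (cl_ker : forall a, cl a = 0 <-> exists b, a = b * f)
    (s_unit : cl s \is a GRing.unit)
    (m : nat) (m_type : is_biq_type (cl s) (cl (laurentX 'F_p)) m)
    (H : handlebody_knot R) (D : diagram R) (DH : is_diagram_of D H)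
    (u : nat) (uH : is_unknotting_number H u) :
  (\max_(phi in Flow D m)
      \dim (Col (cl s) (cl (laurentX 'F_p)) phi))%:Z - 1 <= u%:Z.
Proof.
(* The type is positive, so the labels ['I_m.+1] form a group; evaluating its defining property at
   $a=1$, $b=0$ shows that the corresponding powers of [s] and [t] are 1. *)
case: m m_type => [|m] [//] _ triv _; set t := cl (laurentX 'F_p) in triv *.
have sm : cl s ^+ m.+1 = 1.
  by have [_] := triv 1 0; rewrite /biq_over mulr1 -exprnP.
have tm : t ^+ m.+1 = 1.
  by have [+ _] := triv 1 0; rewrite /biq_under mulr1 mulr0 addr0 -exprnP.
have rep := diagram_represents DH; have [wfD _] := rep.
have con := represents_connected rep.
suff : (\max_(phi in Flow D m.+1) \dim (Col (cl s) t phi) <= u + 1)%N.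
  by move: (\max_(_ in _) _) => n; lia.
apply/bigmax_leqP => phi; rewrite inE => /asboolP fl.
have flc := flow_corner wfD fl.
have [c gc] := generic_direction wfD.
have lr := potential_lconst wfD (corner_flow_conserved wfD flc) gc.
have dirL (e : edge D) : dir e = dir e \/ dir e = - dir e by left.
have dirR (e : edge D) : - dir e = dir e \/ - dir e = - dir e by right.
have /choice[l Hl] e := side_value_exists wfD lr (dirL e).
have /choice[rr Hr] e := side_value_exists wfD lr (dirR e).
have phiE e : phi e = l e - rr e.
  by rewrite (potential_jump wfD (corner_flow_conserved wfD flc) gc (Hl e) (Hr e)).
have le1 := coloring_nullity wfD sm tm fl lr Hl Hr phiE.
have le2 := unknotting_nullity (chiP sm tm) DH uH flc.
have le3 := connected_nullity X wfD con.
(* In the sum of [le1], [le2] and [le3] the numbers of edges and of corners cancel. *)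
rewrite -(leq_add2r #|edge D|); apply: leq_trans le1 _.
apply: leq_trans (leq_add le2 (leqnn _)) _; rewrite addnAC.
apply: leq_trans (leq_add le3 (leqnn u)) _.
by rewrite -addnA [(_ + (1 + u))%N]addnC [(1 + u)%N]addnC.
Qed.
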